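(* Let $\beta>0$ be a real number and let $f\in C^1([0,1])$. For every $\varepsilon\in(0,1)$ let $u_\varepsilon\in H^2((0,1))$ be a minimizer over $H^2((0,1))$ of the functional $\mathbb{PMF}_\varepsilon(\beta,f,(0,1),\cdot)$, and let $x_\varepsilon\in(0,1)$ be points such that $x_\varepsilon\to x_0\in(0,1)$ as $\varepsilon\to 0^+$. Let $$v_\varepsilon(y):=\frac{u_\varepsilon(x_\varepsilon+\omega(\varepsilon)y)-u_\varepsilon(x_\varepsilon)}{\omega(\varepsilon)}.$$ Assume that $f'(x_0)\neq 0$, set $$H:=\left(\frac{24}{\beta^2|f'(x_0)|^3}\right)^{1/5},\qquad V:=f'(x_0)H,$$ and assume that, as $\varepsilon\to 0^+$, $v_\varepsilon$ converges locally strictly in $BV_{\mathrm{loc}}(\mathbb{R})$ to the canonical staircase $S_{H,V}$. Then the family $\{v_\varepsilon(y)/\omega(\varepsilon)^2\}$ is relatively compact (as $\varepsilon\to0^+$) in $C^1([a,b])$ for every interval $[a,b]\subseteq(-H,H)$, and every limit point $w_0$ is of the form $$w_0(x)=-\frac{\beta}{6}f'(x_0)x^3+\zeta_0x\qquad\forall x\in(-H,H),$$ for some $\zeta_0\in\mathbb{R}$.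
   Context: For $\varepsilon\in(0,1)$ set $\omega(\varepsilon):=\varepsilon|\log\varepsilon|^{1/2}$. For $\beta>0$, $f\in L^2((0,1))$ and $u\in H^2((0,1))$, $$\mathbb{PMF}_\varepsilon(\beta,f,(0,1),u):=\int_0^1\left\{\varepsilon^6\omega(\varepsilon)^4u''(x)^2+\log\left(1+u'(x)^2\right)+\beta(u(x)-f(x))^2\right\}dx.$$ Staircases: let $S(x):=2\left\lfloor\frac{x+1}{2}\right\rfloor$ for $x\in\mathbb{R}$. For real numbers $H>0$ and $V$, the canonical $(H,V)$-staircase is $S_{H,V}(x):=V\cdot S(x/H)$, $x\in\mathbb{R}$. Strict convergence: functions $v_\varepsilon\in BV((a,b))$ converge strictly to $v_0\in BV((a,b))$ if $v_\varepsilon\to v_0$ in $L^1((a,b))$ and the total variation of $v_\varepsilon$ in $(a,b)$ converges to the total variation of $v_0$ in $(a,b)$. Locally strict convergence in $BV_{\mathrm{loc}}(\mathbb{R})$ to a function $v_0$ defined on $\mathbb{R}$ means strict convergence in $BV((a,b))$ for every bounded interval $(a,b)$ whose endpoints are not jump points of $v_0$ (where $v_\varepsilon$ needs to be defined on $(a,b)$ only for $\varepsilon$ small enough, depending on the interval). The function $v_\varepsilon(y)$ is defined for those $y$ with $x_\varepsilon+\omega(\varepsilon)y\in(0,1)$. Relative compactness of the family as $\varepsilon\to0^+$ is meant in the sequential sense: from every sequence $\varepsilon_n\to0^+$ one can extract a subsequence along which the functions converge in $C^1([a,b])$. A limit point $w_0:(-H,H)\to\mathbb{R}$ is a function to which $v_{\varepsilon_n}/\omega(\varepsilon_n)^2$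 converges in $C^1([a,b])$ for every $[a,b]\subseteq(-H,H)$, along some sequence $\varepsilon_n\to0^+$. *)

(* Defs.v *)
From HB Require Import structures.
From mathcomp Require Import all_boot all_order all_algebra.
From mathcomp Require Import all_classical all_reals all_analysis.

Set Implicit Arguments.
Unset Strict Implicit.
Unset Printing Implicit Defensive.

Import Order.TTheory GRing.Theory Num.Theory.
Import numFieldNormedType.Exports.

Local Open Scope classical_set_scope.
Local Open Scope ring_scope.

(* Functions on an interval are represented by total functions [R -> R]; every
   definition below only looks at their values on the interval (or almost
   everywhere on it, for Lebesgue, Sobolev and BV classes). *)

Section Spaces.
Context {R : realType}.
Implicit Types (a b : R) (u g phi : R -> R).

Let mu := @lebesgue_measure R.

(* phi is extended by zero to the whole of R. *)
Definition C1c a b phi : Prop :=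
  [/\ forall x, derivable phi x 1,
      continuous (derive1 phi),
      compact (closure [set x | phi x != 0]) &
      closure [set x | phi x != 0] `<=` `]a, b[].

Definition L1 a b u : Prop := mu.-integrable `]a, b[ (EFin \o u).

Definition L2 a b u : Prop :=
  measurable_fun `]a, b[ u /\
  mu.-integrable `]a, b[ (fun x => (u x ^+ 2)%:E).

(* As in one-dimensional Sobolev theory (e.g. Brezis), the test functions are
   of class C^1_c. *)
Definition is_weak_derivative a b u g : Prop :=
  forall phi, C1c a b phi ->
    (\int[mu]_(x in `]a, b[) (u x * derive1 phi x)%:E =
     - \int[mu]_(x in `]a, b[) (g x * phi x)%:E)%E.

Definition H1 a b u : Prop :=
  L2 a b u /\ exists2 g, L2 a b g & is_weak_derivative a b u g.

(* A representative of the weak derivative, which is unique up to null sets;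
   it is meaningful for u \in H^1((a, b)) and is the zero function when no
   weak derivative in L^2((a, b)) exists. *)
Definition wderiv a b u : R -> R :=
  xget (fun=> 0) [set g | L2 a b g /\ is_weak_derivative a b u g].

Definition H2 a b u : Prop := H1 a b u /\ H1 a b (wderiv a b u).

(* |Du|((a, b)), the total variation of the distributional derivative.  The
   library's [total_variation] is the pointwise variation on [a, b], which
   depends on the representative and on the values at the endpoints. *)
Definition TV a b u : \bar R :=
  ereal_sup [set (\int[mu]_(x in `]a, b[) (u x * derive1 phi x)%:E)%E
            | phi in [set phi | C1c a b phi /\ forall x, `|phi x| <= 1]].

Definition BV a b u : Prop := L1 a b u /\ (TV a b u < +oo)%E.

(* u \in C^1([a, b]), with derivative g on [a, b]: at the endpoints g is the
   continuous extension of the derivative of u in (a, b), for a < b. *)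
Definition C1_with_derivative a b u g : Prop :=
  [/\ {within `[a, b], continuous u},
      {within `[a, b], continuous g} &
      forall x, x \in `]a, b[ -> is_derive x 1 u (g x)].

Definition C1 a b u : Prop := exists g, C1_with_derivative a b u g.

(* Convergence in C^1([a, b]); the members of the sequence need to be (defined
   and) of class C^1 on [a, b] only from some index on. *)
Definition cvg_C1 a b (u_ : nat -> R -> R) u : Prop :=
  exists (g_ : nat -> R -> R) g,
    [/\ \forall n \near \oo, C1_with_derivative a b (u_ n) (g_ n),
        C1_with_derivative a b u g,
        {uniform `[a, b], u_ @ \oo --> u} &
        {uniform `[a, b], g_ @ \oo --> g}].

Definition strict_cvg a b (v : R -> R -> R) (v0 : R -> R) : Prop :=
  [/\ \forall e \near 0^'+, BV a b (v e),
      BV a b v0,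
      (\int[mu]_(y in `]a, b[) (`|v e y - v0 y|)%:E)%E @[e --> 0^'+] --> 0%E &
      TV a b (v e) @[e --> 0^'+] --> TV a b v0].

Definition jump_point (v : R -> R) (x : R) : Prop :=
  exists l r : R, [/\ v y @[y --> x^'-] --> l, v y @[y --> x^'+] --> r & l != r].

Definition locally_strict_cvg (v : R -> R -> R) (v0 : R -> R) : Prop :=
  forall a b, a < b -> ~ jump_point v0 a -> ~ jump_point v0 b ->
    strict_cvg a b v v0.

End Spaces.

Section PeronaMalik.
Context {R : realType}.
Implicit Types (eps beta : R) (f u x : R -> R).

Definition omega eps : R := eps * Num.sqrt `|ln eps|.

(* The integrand is nonnegative, so the integral is meaningful in \bar R. *)
Definition PMF eps beta f (a b : R) u : \bar R :=
  (\int[@lebesgue_measure R]_(x in `]a, b[)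
    (eps ^+ 6 * omega eps ^+ 4 * wderiv a b (wderiv a b u) x ^+ 2
     + ln (1 + wderiv a b u x ^+ 2)
     + beta * (u x - f x) ^+ 2)%:E)%E.

(* Elements of H^2((0, 1)) are identified, as usual, with their continuous
   representative, so that the values u(x) make sense.  The competitors w are
   arbitrary representatives, since PMF only depends on the class of w. *)
Definition is_minimizer_PMF eps beta f u : Prop :=
  [/\ H2 0 1 u,
      {in `]0, 1[, continuous u} &
      forall w, H2 0 1 w -> (PMF eps beta f 0 1 u <= PMF eps beta f 0 1 w)%E].

Definition canonical_staircase (x : R) : R := 2 * (Num.floor ((x + 1) / 2))%:~R.

Definition staircase (H V : R) (x : R) : R := V * canonical_staircase (x / H).

(* v_eps; it is only meaningful for y with x_eps + omega(eps) y in (0, 1),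
   hence for all y in a given bounded set as soon as eps is small. *)
Definition blow_up (u : R -> R -> R) x eps (y : R) : R :=
  (u eps (x eps + omega eps * y) - u eps (x eps)) / omega eps.

Definition rescaled_blow_up (u : R -> R -> R) x eps (y : R) : R :=
  blow_up u x eps y / omega eps ^+ 2.

Definition vanishing_parameters (e : nat -> R) : Prop :=
  (forall n, e n \in `]0, 1[) /\ e @ \oo --> 0.

Definition relatively_compact_C1 (a b : R) (w : R -> R -> R) : Prop :=
  forall e, vanishing_parameters e ->
    exists (k : nat -> nat) (w0 : R -> R),
      {homo k : m n / (m < n)%N} /\ cvg_C1 a b (fun n => w (e (k n))) w0.

Definition limit_point_C1 (H : R) (w : R -> R -> R) (w0 : R -> R) : Prop :=
  exists2 e, vanishing_parameters e &
    forall a b, - H < a -> a < b -> b < H -> cvg_C1 a b (fun n => w (e n)) w0.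

End PeronaMalik.

(* Main.v *)
Require Import Defs.
From HB Require Import structures.
From mathcomp Require Import all_boot all_order all_algebra.
From mathcomp Require Import all_classical all_reals all_analysis.
From mathcomp Require Import measurable_realfun.
From mathcomp Require Import ring lra.

(** After the blow-up the minimizer v_e solves a singularly perturbed Perona-Malik
    equation.  Write w = omega(e), q = v', r = v'', k2 = e^6 w^2, and let
    g(y) = L_e + m y + o(1) be the blown-up datum, where m = f'(x0) and
    L_e = (f(x_e) - u_e(x_e))/w.  Integrating the Euler-Lagrange equation once gives
    k2 r' = q/(1 + q^2) + p with p' = - beta w^2 (v - g).  On the step of the
    staircase around 0 the slope is small and its second derivative is multiplied
    by k2, so that q = - p to leading order; also v -> 0, so that, once L_e -> 0 is
    known, p' = beta w^2 (m y + o(1)).  Hence q/w^2 = zeta_e - beta m y^2/2 + o(1),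
    and v/w^2 = zeta_e y - beta m y^3/6 + o(1).  With zeta_e bounded this is the
    theorem: compactness comes from compactness of bounded sets of reals, and
    limit points differ only by zeta_0.

    Three facts carry the argument.

    - A priori bounds (energy_bound, p_bound).  Comparing v between two points of
      the steps around 0 and 2H with a constant joined to v by layers of width e^2
      costs O(w^2), and bounds both the energy and L_e.  As v jumps by 2V across H,
      multiplying the equation by v turns the energy bound into p = O(w^2).

    - Small slopes on the steps (no_positive_spike, barrier).  Strict convergence
      makes v_e uniformly close to a constant inside a step.  The logarithmic
      energy is not convex, but by conservation of the Hamiltonian a spike of q
      would have a height of order at least |ln e|/w^2; it would then carry a
      definite increment of v, which is impossible.  Once |q| <= 1 the maximum
      principle gives q = O(w^2).

    - The mean datum vanishes (mean_datum_vanishes).  The Hamiltonian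
      2qp - k2 r^2 + ln(1 + q^2) + beta w^2 (v - g)^2 is almost conserved; at points
      on both sides of the jump at H only the last term matters, so the values 0
      and 2V have the same distance to g(H) = L_e + V + o(1), which forces L_e -> 0.

    Minimality over H^2 enters through the classical Euler-Lagrange system
    (minimizer_regular) and the comparison with smooth local competitors
    (local_comparison); strict convergence enters through a uniform bound and the
    uniform convergence on the steps (strict_cvg_uniform). *)

Set Implicit Arguments.
Unset Strict Implicit.
Unset Printing Implicit Defensive.

Import Order.TTheory GRing.Theory Num.Theory.
Import numFieldNormedType.Exports.

Local Open Scope classical_set_scope.
Local Open Scope ring_scope.

(** * Fubini's theorem on a triangle *)

Section Triangle.
Context {R : realType}.
Notation mu := (@lebesgue_measure R).
Implicit Types (a b : R) (h k : R -> R).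

Lemma integral_fineK (D : set R) (h : R -> R) : measurable D ->
  mu.-integrable D (EFin \o h) ->
  (\int[mu]_(x in D) (h x)%:E = (\int[mu]_(x in D) h x)%R%:E)%E.
Proof.
by move=> mD ih; rewrite /Rintegral fineK//; exact: integrable_fin_num ih.
Qed.

(** Both sides integrate h(x) k(t) over the triangle a < t <= x < b.  The weak
    derivative of a primitive and the two integrations by parts in the first
    variation all reduce to this exchange. *)
Lemma fubini_triangle a b h k : L1 a b h -> L1 a b k ->
  \int[mu]_(x in `]a, b[) (h x * \int[mu]_(t in `]a, x]) k t) =
  \int[mu]_(t in `]a, b[) (k t * \int[mu]_(x in `[t, b[) h x).
Proof.
move=> ih ik.
pose I : set (measurableTypeR R) := `]a, b[%classic.
pose hI : measurableTypeR R -> R := h \_ I; pose kI : measurableTypeR R -> R := k \_ I.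
pose F (z : measurableTypeR R * measurableTypeR R) : \bar R := (hI z.1 * (kI z.2 * (z.2 <= z.1)%R%:R))%:E.
have mI : measurable I by exact: measurable_itv.
have mhI : measurable_fun setT hI.
  apply/(measurable_restrictT (h : measurableTypeR R -> R) mI).
  by move/integrableP : ih => [/measurable_EFinP].
have mkI : measurable_fun setT kI.
  apply/(measurable_restrictT (k : measurableTypeR R -> R) mI).
  by move/integrableP : ik => [/measurable_EFinP].
have ihI : mu.-integrable setT (EFin \o hI).
  by have := (integrable_mkcond _ mI).1 ih; rewrite restrict_EFin.
have ikI : mu.-integrable setT (EFin \o kI).
  by have := (integrable_mkcond _ mI).1 ik; rewrite restrict_EFin.
have mF : measurable_fun setT F.
  apply/measurable_EFinP; apply: measurable_funM.
    by apply: measurableT_comp => //; exact: measurable_fst.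
  apply: measurable_funM.
    by apply: measurableT_comp => //; exact: measurable_snd.
  apply: (@measurableT_comp _ _ _ _ _ _ (fun b : bool => b%:R : R)) => //.
  apply: measurable_fun_ler; [exact: measurable_snd|exact: measurable_fst].
have iF : (mu \x mu)%E.-integrable setT F.
  apply/(integrable12ltyP _ _ mF).
  apply: (@le_lt_trans _ _ (\int[mu]_x (`|hI x|%:E * \int[mu]_y `|kI y|%:E))%E).
    apply: ge0_le_integral => //=.
    - by move=> x _; apply: integral_ge0.
    - apply: (measurable_fun_fubini_tonelli_F (abse \o F)) => //=.
      exact: measurableT_comp.
    - apply: emeasurable_funM => //.
      by apply/measurable_EFinP; exact: measurableT_comp.
    - move=> x _; rewrite -ge0_integralZl//=; last first.
        by apply/measurable_EFinP; exact: measurableT_comp.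
      apply: ge0_le_integral => //=.
      + have mFx : measurable_fun setT (fun y => F (x, y)) by exact: measurableT_comp.
        rewrite -[X in measurable_fun _ X]/(abse \o (fun y => F (x, y))).
        exact: measurableT_comp.
      + by apply: measurable_funeM; apply/measurable_EFinP; exact: measurableT_comp.
      + move=> y _; rewrite -EFinM lee_fin !normrM ler_wpM2l//.
        by rewrite normr_nat ler_piMr//; case: (y <= x)%R; rewrite ?lexx ?ler01.
  have fk : (\int[mu]_y `|kI y|%:E)%E \is a fin_num.
    by apply: integrable_fin_num => //; exact: integrable_norm.
  rewrite ge0_integralZr//=; last 2 first.
    by apply/measurable_EFinP; exact: measurableT_comp.
    exact: integral_ge0.
  rewrite -(fineK fk) lte_mul_pinfty ?integral_ge0 ?ltry//.
  by have := integrable_norm ihI => /integrable_fin_num-/(_ measurableT).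
have sub (l : R -> R) (J : set (measurableTypeR R)) (P : R -> bool) :
    measurable J -> J `<=` I -> L1 a b l ->
    (forall y, I y -> P y <-> J y) ->
    (\int[mu]_y ((l \_ I) y * (P y)%:R)%:E = (\int[mu]_(y in J) l y)%R%:E)%E.
  move=> mJ JI il PJ.
  rewrite -integral_fineK//; last exact: integrableS il.
  rewrite [RHS]integral_mkcond; apply: eq_integral => y _.
  rewrite !patchE; have [yI|yI] := boolP (y \in I); last first.
    rewrite mul0r ifF//; apply/negbTE; apply: contra yI.
    by rewrite !inE; exact: JI.
  move: yI; rewrite inE => /PJ Py; have [yJ|yJ] := boolP (y \in J).
    by move: yJ; rewrite inE => /Py ->; rewrite mulr1.
  have /negbTE-> : ~~ P y by apply: contra yJ => /Py; rewrite inE.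
  by rewrite mulr0.
have Fub := Fubini iF.
have JI1 x : I x -> `]a, x]%classic `<=` I.
  rewrite /I/= in_itv/= => /andP[_ xb] y /=; rewrite !in_itv/= => /andP[-> yx].
  exact: le_lt_trans yx xb.
have JI2 t : I t -> `[t, b[%classic `<=` I.
  rewrite /I/= in_itv/= => /andP[at_ _] y /=; rewrite !in_itv/= => /andP[ty ->].
  by rewrite (lt_le_trans at_ ty).
have mP1 x : measurable_fun setT (fun y : measurableTypeR R => (y <= x)%R%:R : R).
  have nb : measurable_fun setT (fun b : bool => b%:R : R) by [].
  exact: (measurableT_comp nb (measurable_fun_ler _ _)).
have mP2 y : measurable_fun setT (fun x : measurableTypeR R => (y <= x)%R%:R : R).
  have nb : measurable_fun setT (fun b : bool => b%:R : R) by [].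
  exact: (measurableT_comp nb (measurable_fun_ler _ _)).
have iM (l P : measurableTypeR R -> R) : mu.-integrable setT (EFin \o l) ->
    measurable_fun setT P -> (forall y, `|P y| <= 1) ->
    mu.-integrable setT (fun y => (l y * P y)%:E).
  move=> il mP P1; have ml := (measurable_EFinP _ _).1 (measurable_int _ il).
  apply: (le_integrable measurableT _ _ il).
    exact: ((measurable_EFinP _ _).2 (measurable_funM ml mP)).
  by move=> y _; rewrite /= lee_fin normrM ler_piMr.
have bN (c : bool) : `|c%:R : R| <= 1.
  by rewrite normr_nat; case: c; rewrite ?lexx ?ler01.
transitivity (fine (\int[mu]_x \int[mu]_y F (x, y))%E).
  rewrite /Rintegral [X in fine X]integral_mkcond; congr fine.
  apply: eq_integral => x _; rewrite patchE /F/=.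
  under [RHS]eq_integral do rewrite EFinM.
  rewrite (integralZl measurableT (iM _ _ ikI (mP1 x) (fun y => bN _))).
  rewrite /hI patchE; have [xI|xI] := boolP (x \in I); last by rewrite mul0e.
  move: (xI); rewrite inE => Ix.
  have Iax y : I y -> (y <= x) <-> `]a, x]%classic y.
    by rewrite /I set_itvE /= => /andP[ay _]; rewrite in_itv/= ay.
  by rewrite (sub k _ _ (measurable_itv _) (JI1 _ Ix) ik Iax).
rewrite Fub /Rintegral [X in _ = fine X]integral_mkcond; congr fine.
apply: eq_integral => y _; rewrite patchE /F/=.
under [LHS]eq_integral do rewrite mulrCA EFinM.
rewrite (integralZl measurableT (iM _ _ ihI (mP2 y) (fun y => bN _))).
rewrite /kI patchE; have [yI|yI] := boolP (y \in I); last by rewrite mul0e.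
move: (yI); rewrite inE => Iy.
have Iax x : I x -> (y <= x) <-> `[y, b[%classic x.
  by rewrite /I set_itvE /= => /andP[_ xb]; rewrite in_itv/= xb andbT.
by rewrite (sub h _ (fun x => y <= x) (measurable_itv _) (JI2 _ Iy) ih Iax).
Qed.
End Triangle.

(** * Differentiation and bump functions *)

Section Calculus.
Context {R : realType}.
Implicit Types (f g : R -> R) (a b s t x y z : R).

(** The way to differentiate the square of a positive part at its corner. *)
Lemma is_derive_quadratic f x d C :
  (forall y, `|f y - f x - d * (y - x)| <= C * (y - x) ^+ 2) ->
  is_derive x 1 f d.
Proof.
move=> H; apply/is_derive1_caratheodory.
exists (fun z => if z == x then d else (f z - f x) / (z - x)); split.
- move=> z; have [->|zx] := eqVneq z x; first by rewrite !subrr mulr0.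
  by rewrite divfK// subr_eq0.
- apply/cvgrPdist_le => e e0 /=; rewrite eqxx.
  have C0 : 0 < `|C| + 1 by rewrite ltr_wpDl.
  near=> z; have [_|zx] := eqVneq z x; first by rewrite subrr normr0 ltW.
  have zx0 : 0 < `|z - x| by rewrite normr_gt0 subr_eq0.
  rewrite distrC -(ler_pM2r zx0) -normrM mulrBl divfK ?subr_eq0//.
  apply: le_trans (H z) _; rewrite -real_normK ?num_real// expr2 mulrA ler_pM2r//.
  apply: (@le_trans _ _ ((`|C| + 1) * `|z - x|)).
    by rewrite ler_pM2r//; have := ler_norm C; lra.
  rewrite mulrC -ler_pdivlMr// distrC; near: z; apply: cvgr_dist_le => //.
  by rewrite divr_gt0.
- by rewrite eqxx.
Unshelve. all: by end_near. Qed.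

Lemma is_derive_continuous f x d : is_derive x 1 f d -> continuous_at x f.
Proof. by move=> [fd _]; apply/differentiable_continuous/derivable1_diffP. Qed.

Lemma cont_cst (c : R) x : continuous_at x (fun=> c).
Proof. exact: cvg_cst. Qed.

Lemma contD f g x : continuous_at x f -> continuous_at x g ->
  continuous_at x (fun y => f y + g y).
Proof. exact: cvgD. Qed.

Lemma contB f g x : continuous_at x f -> continuous_at x g ->
  continuous_at x (fun y => f y - g y).
Proof. exact: cvgB. Qed.

Lemma contM f g x : continuous_at x f -> continuous_at x g ->
  continuous_at x (fun y => f y * g y).
Proof. exact: cvgM. Qed.

Lemma contX f n x : continuous_at x f -> continuous_at x (fun y => f y ^+ n).
Proof.
move=> cf; apply: (@continuous_comp _ _ _ f (fun y => y ^+ n)) => //.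
exact: exprn_continuous.
Qed.

Lemma cont_comp f g x : continuous_at x f -> continuous_at (f x) g ->
  continuous_at x (fun y => g (f y)).
Proof. exact: continuous_comp. Qed.

Lemma is_derive_pow f x d n :
  is_derive x 1 f d -> is_derive x 1 (fun y => f y ^+ n) (n%:R * f x ^+ n.-1 * d).
Proof.
move=> fd; have h : is_derive (f x) 1 (fun y => y ^+ n) (n%:R * f x ^+ n.-1).
  split; first exact: exprn_derivable.
  by rewrite exp_derive /GRing.scale/= mulr1.
exact: (@is_derive1_comp _ (fun y => y ^+ n) f x _ _ h fd).
Qed.

(** Squares and cubes of the positive part are of class C^1 and C^2: they give
    bump functions and boundary layers by explicit formulas. *)
Definition pos z : R := Num.max z 0.

Lemma pos_id z : 0 <= z -> pos z = z. Proof. by move=> ?; apply/max_idPl. Qed.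
Lemma pos_0 z : z <= 0 -> pos z = 0. Proof. by move=> ?; apply/max_idPr. Qed.

Lemma pos_continuous : continuous pos.
Proof. by move=> z; apply: (@continuous_max _ _ id (cst 0)) => //; exact: cst_continuous. Qed.

Lemma is_derive_pos2 z : is_derive z 1 (fun y => pos y ^+ 2) (2 * pos z).
Proof.
apply: (is_derive_quadratic (C := 1)) => y; rewrite mul1r ler_norml.
have S := sqr_ge0 (y - z); have Sy := sqr_ge0 y; have Sz := sqr_ge0 z.
have [y0|y0] := leP 0 y; have [z0|z0] := leP 0 z.
- by rewrite !pos_id//; apply/andP; split; nra.
- rewrite (pos_id y0) (pos_0 (ltW z0)).
  have yz : y * z <= 0 by rewrite mulr_ge0_le0// ltW.
  by apply/andP; split; nra.
- rewrite (pos_id z0) (pos_0 (ltW y0)).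
  have yz : y * z <= 0 by rewrite mulr_le0_ge0// ltW.
  by apply/andP; split; nra.
- by rewrite (pos_0 (ltW y0)) (pos_0 (ltW z0)); apply/andP; split; nra.
Qed.

End Calculus.

Section Bump.
Context {R : realType}.
Notation mu := (@lebesgue_measure R).
Implicit Types (a b s t x : R) (phi d : R -> R).

Lemma C1c_intro a b s t phi d : a < s -> t < b ->
  (forall x, is_derive x 1 phi (d x)) -> continuous d ->
  (forall x, x \notin `[s, t] -> phi x = 0) -> C1c a b phi.
Proof.
move=> as_ tb Hd cd H0.
have sub : closure [set x | phi x != 0] `<=` `[s, t]%classic.
  rewrite [X in _ `<=` X](closure_id _).1; last exact: itv_closed.
  apply: closure_subset => x /=; apply: contraNP => /negP xst.
  by rewrite H0.
split.
- by move=> x; case: (Hd x).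
- suff -> : derive1 phi = d by [].
  by apply/funext => x; rewrite derive1E; case: (Hd x).
- apply: (@subclosed_compact _ _ `[s, t]%classic) => //.
    exact: closed_closure.
  exact: segment_compact.
- apply: subset_trans sub _ => x /=; rewrite !in_itv/= => /andP[sx xt].
  by rewrite (lt_le_trans as_ sx) (le_lt_trans xt tb).
Qed.

(** Normalized by (t - s)^4 so that its values on ]s, t[ lie in ]0, 1]. *)
Definition bump_base s t x : R := pos (x - s) ^+ 2 * pos (t - x) ^+ 2 / (t - s) ^+ 4.
Definition dbump_base s t x : R :=
  (2 * pos (x - s) * pos (t - x) ^+ 2 - pos (x - s) ^+ 2 * (2 * pos (t - x))) /
  (t - s) ^+ 4.

(** Powers of 1 - bump_base turn one bump into a sequence of test functions
    increasing to the indicator function of ]s, t[. *)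
Definition bump n s t x : R := 1 - (1 - bump_base s t x) ^+ n.+1.
Definition dbump n s t x : R :=
  n.+1%:R * (1 - bump_base s t x) ^+ n * dbump_base s t x.

Lemma is_derive_bump_base s t x :
  is_derive x 1 (bump_base s t) (dbump_base s t x).
Proof.
have h1 : is_derive x 1 (fun x => pos (x - s) ^+ 2) (2 * pos (x - s)).
  have /= := @is_derive1_comp _ (fun y => pos y ^+ 2) (fun x => x - s) x _ 1 (is_derive_pos2 _).
  by rewrite mulr1; apply; apply: is_derive_eq; rewrite subr0.
have h2 : is_derive x 1 (fun x => pos (t - x) ^+ 2) (- (2 * pos (t - x))).
  have /= := @is_derive1_comp _ (fun y => pos y ^+ 2) (fun x => t - x) x _ (-1) (is_derive_pos2 _).
  by rewrite mulrN1; apply; apply: is_derive_eq; lra.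
rewrite /bump_base /dbump_base; apply: is_derive_eq.
rewrite /GRing.scale/=; ring.
Qed.

Lemma is_derive_bump n s t x : is_derive x 1 (bump n s t) (dbump n s t x).
Proof.
have h : is_derive x 1 (fun y => 1 - bump_base s t y) (- dbump_base s t x).
  have h := is_derive_bump_base s t x.
  by apply: is_derive_eq; lra.
have h1 := is_derive_pow n.+1 h.
rewrite /bump /dbump; apply: is_derive_eq.
rewrite /GRing.scale/=; ring.
Qed.

Lemma bump_base_cont s t : continuous (bump_base s t).
Proof. by move=> x; apply: is_derive_continuous (is_derive_bump_base s t x). Qed.

Lemma bump_cont n s t : continuous (bump n s t).
Proof. by move=> x; apply: is_derive_continuous (is_derive_bump n s t x). Qed.

Lemma dbump_cont n s t : continuous (dbump n s t).
Proof.
have cs x : continuous_at x (fun x => pos (x - s)).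
  by apply: cont_comp; [apply: contB => //; exact: cont_cst|exact: pos_continuous].
have ct x : continuous_at x (fun x => pos (t - x)).
  by apply: cont_comp; [apply: contB => //; exact: cont_cst|exact: pos_continuous].
move=> x; rewrite /dbump /dbump_base.
apply: contM; first apply: contM; first exact: cont_cst.
  by apply/contX/contB; [exact: cont_cst|exact: bump_base_cont].
apply: contM; last exact: cont_cst.
apply: contB; apply: contM.
- by apply: contM; [exact: cont_cst|exact: cs].
- exact: contX.
- exact: contX.
- by apply: contM; [exact: cont_cst|exact: ct].
Qed.

Lemma bump_base_eq0 s t x : s < t -> x \notin `]s, t[ -> bump_base s t x = 0.
Proof.
move=> st; rewrite in_itv/= negb_and -!leNgt /bump_base => /orP[h|h].
  by rewrite (@pos_0 _ (x - s)) ?subr_le0// expr0n !mul0r.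
by rewrite (@pos_0 _ (t - x)) ?subr_le0// expr0n mulr0 mul0r.
Qed.

Lemma bump_base_in s t x : x \in `]s, t[ -> 0 < bump_base s t x <= 1.
Proof.
rewrite in_itv/= => /andP[sx xt].
have xs0 : 0 <= x - s by rewrite subr_ge0 ltW.
have tx0 : 0 <= t - x by rewrite subr_ge0 ltW.
rewrite /bump_base !pos_id//.
have st : 0 < t - s by rewrite subr_gt0 (lt_trans sx).
apply/andP; split; first by rewrite divr_gt0 ?mulr_gt0 ?exprn_gt0// subr_gt0.
rewrite ler_pdivrMr ?exprn_gt0// mul1r.
rewrite (_ : (t - s) ^+ 4 = (t - s) ^+ 2 * (t - s) ^+ 2); last by rewrite -exprD.
by rewrite ler_pM ?sqr_ge0// lerXn2r ?nnegrE ?subr_ge0 ?ltW//; lra.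
Qed.

Lemma bump_base01 s t x : s < t -> 0 <= bump_base s t x <= 1.
Proof.
move=> st; have [/bump_base_in/andP[/ltW-> ->]//|h] := boolP (x \in `]s, t[).
by rewrite bump_base_eq0// lexx ler01.
Qed.

Lemma bump01 n s t x : s < t -> 0 <= bump n s t x <= 1.
Proof.
move=> /(bump_base01 x)/andP[h0 h1]; rewrite /bump subr_ge0 lerBlDr lerDl.
by rewrite exprn_ge0 ?exprn_ile1 ?subr_ge0 // lerBlDr lerDl.
Qed.

Lemma bump_eq0 n s t x : s < t -> x \notin `]s, t[ -> bump n s t x = 0.
Proof. by move=> st xst; rewrite /bump bump_base_eq0// subr0 expr1n subrr. Qed.

Lemma bump_cvg s t x : s < t -> bump n s t x @[n --> \oo] --> (\1_(`]s, t[%classic) x : R).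
Proof.
move=> st; rewrite indicE; have [xst|xst] := boolP (x \in `]s, t[).
  have -> : x \in `]s, t[%classic by rewrite inE.
  have /andP[h0 h1] := bump_base_in xst.
  rewrite /bump -[X in _ --> X]subr0; apply: cvgB; first exact: cvg_cst.
  rewrite (cvg_shiftS (GRing.exp (1 - bump_base s t x))).
  by apply: cvg_expr; rewrite ger0_norm; lra.
have /negbTE-> : x \notin `]s, t[%classic by apply: contra xst; rewrite inE.
by under eq_fun do rewrite bump_eq0//; exact: cvg_cst.
Qed.

Lemma C1c_bump a b n s t : a < s -> s < t -> t < b -> C1c a b (bump n s t).
Proof.
move=> as_ st tb.
apply: (C1c_intro as_ tb (is_derive_bump n s t) (@dbump_cont n s t)) => x xst.
apply: bump_eq0 => //; apply: contra xst; rewrite !in_itv/= => /andP[sx xt].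
by rewrite !ltW.
Qed.

End Bump.

(** * Integrable functions on an interval *)

Section Integrals.
Context {R : realType}.
Notation mu := (@lebesgue_measure R).
Implicit Types (a b s t x : R) (f g h u : R -> R).

Lemma mitv (I : interval R) : measurable ([set` I] : set (measurableTypeR R)).
Proof. exact: measurable_itv. Qed.

Lemma L1_measurable a b u : L1 a b u -> measurable_fun (`]a, b[ : set R) u.
Proof. by move=> /integrableP[/measurable_EFinP]. Qed.

Lemma L1_le a b u g : measurable_fun (`]a, b[ : set (measurableTypeR R)) u -> L1 a b g ->
  (forall x, x \in `]a, b[ -> `|u x| <= `|g x|) -> L1 a b u.
Proof.
move=> mu_ ig ug; apply: (le_integrable (mitv _) _ _ ig).
  exact/measurable_EFinP.
by move=> x xab; rewrite /= lee_fin ug.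
Qed.

Lemma L1M a b u g M : L1 a b u -> measurable_fun (`]a, b[ : set (measurableTypeR R)) g ->
  (forall x, x \in `]a, b[ -> `|g x| <= M) -> L1 a b (fun x => u x * g x).
Proof.
move=> iu mg gM.
have iMu : L1 a b (fun x => M * u x).
  by have := integrableZl (mitv _) M iu; apply: eq_integrable => //; exact: mitv.
apply: (L1_le _ iMu).
  by apply: measurable_funM => //; exact: L1_measurable.
move=> x xab; rewrite !normrM mulrC; apply: ler_wpM2r => //.
by rewrite (le_trans (gM x xab))// ler_norm.
Qed.

Lemma L1D a b u g : L1 a b u -> L1 a b g -> L1 a b (fun x => u x + g x).
Proof. by move=> iu ig; have := integrableD (mitv _) iu ig. Qed.

Lemma L1Z a b c u : L1 a b u -> L1 a b (fun x => c * u x).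
Proof. by move=> iu; have := integrableZl (mitv _) c iu. Qed.

Lemma L1B a b u g : L1 a b u -> L1 a b g -> L1 a b (fun x => u x - g x).
Proof. by move=> iu ig; have := integrableB (mitv _) iu ig. Qed.

Lemma L1_bounded a b u M : measurable_fun (`]a, b[ : set (measurableTypeR R)) u ->
  (forall x, x \in `]a, b[ -> `|u x| <= M) -> L1 a b u.
Proof.
move=> mu_ uM.
have i1 : L1 a b (fun=> 1).
  apply/integrableP; split; first exact/measurable_EFinP/measurable_cst.
  under eq_integral do rewrite /= normr1.
  rewrite integral_cst//= mul1e lebesgue_measure_itv/=; case: ifPn => // _.
  by rewrite -EFinB ltry.
by have := L1M i1 mu_ uM; under eq_fun do rewrite mul1r.
Qed.

Lemma L2_L1 a b u : L2 a b u -> L1 a b u.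
Proof.
move=> [mu_ iu2].
have i1 : L1 a b (fun=> 1).
  by apply: (@L1_bounded _ _ _ 1) => // x _; rewrite normr1.
apply: (L1_le mu_ (L1D i1 iu2)) => x _ /=.
have S := sqr_ge0 (u x); have S1 := sqr_ge0 (u x - 1); have S2 := sqr_ge0 (u x + 1).
rewrite (@ger0_norm _ (1 + _)); last by nra.
by rewrite ler_norml; apply/andP; split; nra.
Qed.

Lemma L2M a b u g : L2 a b u -> L2 a b g -> L1 a b (fun x => u x * g x).
Proof.
move=> [mu_ iu2] [mg ig2].
apply: (L1_le (measurable_funM mu_ mg) (L1D iu2 ig2)) => x _.
have S := sqr_ge0 (u x); have S1 := sqr_ge0 (g x).
have S2 := sqr_ge0 (u x + g x); have S3 := sqr_ge0 (u x - g x).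
rewrite (@ger0_norm _ (_ + _)); last by nra.
by rewrite ler_norml /=; apply/andP; split; nra.
Qed.

Lemma L2D a b u g : L2 a b u -> L2 a b g -> L2 a b (fun x => u x + g x).
Proof.
move=> lu lg; split; first by apply: measurable_funD; [case: lu|case: lg].
have := L1D (L1D lu.2 (L1Z 2 (L2M lu lg))) lg.2.
by apply: (eq_integrable (mitv _)) => x _; rewrite /= sqrrD mulr_natl.
Qed.

Lemma L2Z a b c u : L2 a b u -> L2 a b (fun x => c * u x).
Proof.
move=> lu; split; first by apply: measurable_funM => //; case: lu.
by have := L1Z (c ^+ 2) lu.2; apply: (eq_integrable (mitv _)) => x _; rewrite /= exprMn.
Qed.

Lemma L2B a b u g : L2 a b u -> L2 a b g -> L2 a b (fun x => u x - g x).
Proof.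
move=> lu lg; have := L2D lu (L2Z (-1) lg).
by under eq_fun do rewrite mulN1r.
Qed.

Lemma L2_bounded a b u M : measurable_fun (`]a, b[ : set (measurableTypeR R)) u ->
  (forall x, x \in `]a, b[ -> `|u x| <= M) -> L2 a b u.
Proof.
move=> mu_ uM; split => //.
apply: (@L1_bounded _ _ _ (M ^+ 2)); first exact: measurable_funX.
move=> x xab; rewrite normrX lerXn2r ?nnegrE//; last exact: uM.
by rewrite (le_trans _ (uM x xab)).
Qed.

Lemma cont_measurable a b u : (forall x, x \in `]a, b[ -> continuous_at x u) ->
  measurable_fun (`]a, b[ : set (measurableTypeR R)) u.
Proof.
move=> cu; apply: open_continuous_measurable_fun; first exact: itv_open.
by move=> x; rewrite inE => /cu.
Qed.


Lemma within_cont a b f : (forall x, x \in `[a, b] -> continuous_at x f) ->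
  {within `[a, b], continuous f}.
Proof. by move=> cf; apply: continuous_in_subspaceT => x; rewrite inE => /cf. Qed.

Lemma L1_cc a b f : (forall x, x \in `[a, b] -> continuous_at x f) ->
  mu.-integrable (`[a, b] : set (measurableTypeR R)) (EFin \o f).
Proof.
move=> cf; apply: continuous_compact_integrable; first exact: segment_compact.
exact: within_cont.
Qed.

Lemma L1_cont a b f : (forall x, x \in `[a, b] -> continuous_at x f) -> L1 a b f.
Proof.
move=> /L1_cc; apply: integrableS; [exact: mitv|exact: mitv|].
exact: subset_itv_oo_cc.
Qed.

Lemma cont_oo_LR (F : R -> R) a b : (forall x, x \in `[a, b] -> derivable F x 1) -> a < b ->
  derivable_oo_LRcontinuous (F : R -> R^o) a b.
Proof.
move=> dF ab; split.
- by move=> x xab; apply: dF; exact: subset_itv_oo_cc xab.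
- apply: cvg_at_right_filter; apply/differentiable_continuous/derivable1_diffP.
  by apply: dF; rewrite in_itv/= lexx ltW.
- apply: cvg_at_left_filter; apply/differentiable_continuous/derivable1_diffP.
  by apply: dF; rewrite in_itv/= lexx ltW.
Qed.

Lemma ftc F f a b : a < b -> (forall x, x \in `[a, b] -> continuous_at x f) ->
  (forall x, x \in `[a, b] -> is_derive x 1 F (f x)) ->
  \int[mu]_(x in `[a, b]) f x = F b - F a.
Proof.
move=> ab cf dF; rewrite /Rintegral (continuous_FTC2 ab (within_cont cf) (F := F)).
- by [].
- by apply: cont_oo_LR => // x /dF[].
- move=> x xab; rewrite derive1E.
  by case: (dF x (subset_itv_oo_cc xab)).
Qed.

Lemma ftc_oo F f a b : a < b -> (forall x, x \in `[a, b] -> continuous_at x f) ->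
  (forall x, x \in `[a, b] -> is_derive x 1 F (f x)) ->
  \int[mu]_(x in `]a, b[) f x = F b - F a.
Proof.
move=> ab cf dF; rewrite -(ftc ab cf dF) -Rintegral_itv_obnd_cbnd.
  by rewrite Rintegral_itv_bndo_bndc//; exact: L1_cont.
apply: (integrableS _ _ _ (L1_cc cf)); [exact: mitv|exact: mitv|].
by apply: subset_itvr; rewrite bnd_simp.
Qed.

Lemma C1c_eq0 a b phi x : C1c a b phi -> x \notin `]a, b[ -> phi x = 0.
Proof.
move=> [_ _ _ sub]; apply: contraNeq => px; have : `]a, b[%classic x; last by [].
by apply: sub; apply: subset_closure.
Qed.

Lemma C1c_bounded a b phi : C1c a b phi ->
  exists M, forall x, x \in `[a, b] -> `|phi x| <= M /\ `|derive1 phi x| <= M.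
Proof.
move=> [dphi cphi _ _].
have B (h : R -> R) : continuous h -> exists M, forall x, x \in `[a, b] -> `|h x| <= M.
  move=> ch; have : {within `[a, b], continuous h} by apply: within_cont => x _; exact: ch.
  move=> /continuous_compact/(_ (@segment_compact _ a b))/compact_bounded[M [_ hM]].
  exists (M + 1) => x xab; apply: (hM (M + 1)); first by rewrite ltrDl.
  by exists x.
have [M1 h1] : exists M, forall x, x \in `[a, b] -> `|phi x| <= M.
  by apply: B => x; apply/differentiable_continuous/derivable1_diffP.
have [M2 h2] := B _ cphi; exists (Num.max M1 M2) => x xab.
by rewrite !le_max h1// h2// orbT.
Qed.

Lemma C1c_cont a b phi : C1c a b phi -> continuous phi.
Proof. by move=> [dphi _ _ _] x; apply/differentiable_continuous/derivable1_diffP. Qed.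

Lemma C1c_measurable a b phi : C1c a b phi ->
  measurable_fun (`]a, b[ : set (measurableTypeR R)) phi /\
  measurable_fun (`]a, b[ : set (measurableTypeR R)) (derive1 phi).
Proof.
move=> h; split; apply: cont_measurable => x _; first exact: (C1c_cont h).
by case: h.
Qed.

Lemma L1_C1c a b u phi : L1 a b u -> C1c a b phi ->
  L1 a b (fun x => u x * phi x) /\ L1 a b (fun x => u x * derive1 phi x).
Proof.
move=> iu h; have [M hM] := C1c_bounded h; have [m1 m2] := C1c_measurable h.
by split; apply: (L1M (M := M)) => // x /subset_itv_oo_cc/hM[].
Qed.

(** Real-valued integrals are easier to manipulate; the integrability of u and g
    makes both formulations equivalent. *)
Lemma weak_derivativeP a b u g : L1 a b u -> L1 a b g ->
  is_weak_derivative a b u g <-> forall phi, C1c a b phi ->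
    \int[mu]_(x in `]a, b[) (u x * derive1 phi x) =
    - \int[mu]_(x in `]a, b[) (g x * phi x).
Proof.
move=> iu ig; split=> H phi hphi; have := H phi hphi.
  rewrite !integral_fineK; last exact: (L1_C1c iu hphi).2.
    by rewrite -EFinN => -[].
    exact: mitv. exact: (L1_C1c ig hphi).1. exact: mitv.
rewrite !integral_fineK; last exact: (L1_C1c iu hphi).2.
  by rewrite -EFinN => ->.
  exact: mitv. exact: (L1_C1c ig hphi).1. exact: mitv.
Qed.

End Integrals.

(** * Primitives of integrable functions *)

Section Primitive.
Context {R : realType}.
Notation mu := (@lebesgue_measure R).
Implicit Types (a b s t x : R) (f g h u k : R -> R).

Definition prim a k x : R := \int[mu]_(t in `]a, x]) k t.

Lemma L1_sub a b k (I : interval R) : L1 a b k -> {subset I <= `]a, b[} ->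
  mu.-integrable ([set` I] : set (measurableTypeR R)) (EFin \o k).
Proof. by move=> ik sI; apply: (integrableS _ _ _ ik); [exact: mitv|exact: mitv|]. Qed.

Lemma sub_oc a b x : x < b -> {subset `]a, x] <= `]a, b[}.
Proof. by move=> xb y; rewrite !in_itv/= => /andP[-> yx]; exact: le_lt_trans xb. Qed.

Lemma restrict_integrable a b k : L1 a b k ->
  mu.-integrable [set: measurableTypeR R] (EFin \o (k \_ `]a, b[)).
Proof.
by move=> ik; have := (integrable_mkcond _ (mitv _)).1 ik; rewrite restrict_EFin.
Qed.

Lemma prim_restrict a b k x : L1 a b k -> x < b ->
  prim a k x = \int[mu]_(t in `[a, x]) (k \_ `]a, b[) t.
Proof.
move=> ik xb; rewrite -Rintegral_itv_obnd_cbnd; last first.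
  by apply: (integrableS _ _ _ (restrict_integrable ik)); [exact: measurableT|exact: mitv|].
apply: eq_Rintegral => t; rewrite inE => /= tx.
by rewrite patchE ifT// inE; exact: sub_oc tx.
Qed.

Lemma prim_cont a b k x : L1 a b k -> x \in `]a, b[ -> continuous_at x (prim a k).
Proof.
move=> ik xab; have ab : a < b by move: xab; rewrite in_itv/= => /andP[/lt_trans]; exact.
have iab : mu.-integrable (`[a, b] : set (measurableTypeR R)) (EFin \o (k \_ `]a, b[)).
  by apply: (integrableS _ _ _ (restrict_integrable ik)); [exact: measurableT|exact: mitv|].
have := parameterized_integral_continuous (ltW ab) iab.
move=> /(within_continuous_continuous ab)-/(_ x xab) cx.
have xb : x < b by move: xab; rewrite in_itv => /andP[].
apply: (@cvg_trans _ ((fun x => parameterized_integral mu a x (k \_ `]a, b[)) @ x)).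
  apply: near_eq_cvg; near=> y; apply/esym/prim_restrict => //.
  by near: y; exact: lt_nbhsl.
by rewrite (prim_restrict ik xb).
Unshelve. all: by end_near. Qed.

Lemma prim_derive a b k x : L1 a b k -> x \in `]a, b[ -> continuous_at x k ->
  is_derive x 1 (prim a k) (k x).
Proof.
rewrite in_itv/= => ik /andP[ax xb] ck.
have xu : x < (x + b) / 2 by lra.
have ub : (x + b) / 2 < b by lra.
have iu := L1_sub ik (@sub_oc a b _ ub).
have [d1 d2] := continuous_FTC1 xu iu ax ck.
by apply: DeriveDef; [exact: d1|rewrite -derive1E; exact: d2].
Qed.

Lemma prim_bound a b k x : L1 a b k -> x \in `]a, b[ ->
  `|prim a k x| <= \int[mu]_(t in `]a, b[) `|k t|.
Proof.
rewrite in_itv/= => ik /andP[ax xb]; rewrite /prim.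
have iax := L1_sub ik (@sub_oc a b x xb).
apply: le_trans; first exact: (le_normr_Rintegral (mitv _) iax).
rewrite /Rintegral fine_le//.
- by apply: integrable_fin_num; [exact: mitv|exact: integrable_norm].
- by apply: integrable_fin_num; [exact: mitv|exact: integrable_norm].
- apply: ge0_subset_integral; [exact: mitv|exact: mitv| | |].
  + by have := integrable_norm ik => /integrableP[].
  + by move=> y _; rewrite lee_fin.
  + exact: (@sub_oc a b x xb).
Qed.

Lemma prim_measurable a b k : L1 a b k ->
  measurable_fun (`]a, b[ : set (measurableTypeR R)) (prim a k).
Proof. by move=> ik; apply: cont_measurable => x; exact: prim_cont. Qed.

Lemma prim_L2 a b k : L1 a b k -> L2 a b (prim a k).
Proof.
move=> ik; apply: (L2_bounded (M := \int[mu]_(t in `]a, b[) `|k t|)).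
  exact: prim_measurable.
by move=> x; exact: prim_bound.
Qed.

(** Fubini on a triangle replaces the product rule, which is not available for
    a merely integrable k. *)
Lemma prim_weak a b k : a < b -> L1 a b k -> is_weak_derivative a b (prim a k) k.
Proof.
move=> ab ik; apply/(weak_derivativeP (L2_L1 (prim_L2 ik)) ik) => phi hphi.
have [dphi cphi _ _] := hphi.
have D x : is_derive x 1 phi (derive1 phi x) by split => //; rewrite derive1E.
have iphi' : L1 a b (derive1 phi) by apply: L1_cont => x _; exact: cphi.
transitivity (\int[mu]_(x in `]a, b[) (derive1 phi x * \int[mu]_(t in `]a, x]) k t)).
  by apply: eq_Rintegral => x _; rewrite mulrC.
rewrite fubini_triangle// -mulN1r -RintegralZl; [|exact: mitv|exact: (L1_C1c ik hphi).1].
apply: eq_Rintegral => t; rewrite inE/= => tab; rewrite mulrCA mulN1r; congr (_ * _).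
have [at_ tb] : a < t /\ t < b by move: tab; rewrite in_itv/= => /andP[].
rewrite Rintegral_itv_bndo_bndc; last first.
  apply: (L1_sub iphi') => y; rewrite !in_itv/= => /andP[ty ->].
  by rewrite (lt_le_trans at_).
rewrite (ftc (F := phi))//.
by rewrite (C1c_eq0 hphi (x := b)) ?sub0r// in_itv/= ltxx andbF.
Qed.

End Primitive.

(** * The fundamental lemma of the calculus of variations *)

Section Fundamental.
Context {R : realType}.
Notation mu := (@lebesgue_measure R).
Implicit Types (a b s t x : R) (f g h u k d : R -> R).

Lemma bump_norm_le1 n s t x : s < t -> `|bump n s t x| <= 1.
Proof. by move=> st; have /andP[h0 h1] := bump01 n x st; rewrite ger0_norm. Qed.

Lemma bump_measurable a b n s t :
  measurable_fun (`]a, b[ : set (measurableTypeR R)) (bump n s t).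
Proof. by apply: cont_measurable => x _; exact: bump_cont. Qed.

Lemma L1_bump a b n s t d : s < t -> L1 a b d -> L1 a b (fun x => d x * bump n s t x).
Proof.
move=> st id; apply: (L1M (M := 1)) => //; first exact: bump_measurable.
by move=> x _; exact: bump_norm_le1.
Qed.

(** Dominated convergence.  Integrals over arbitrary subintervals are thereby
    limits of integrals against test functions. *)
Lemma bump_int_cvg a b s t d : a < s -> s < t -> t < b -> L1 a b d ->
  \int[mu]_(x in `]a, b[) (d x * bump n s t x) @[n --> \oo] -->
  \int[mu]_(x in `]s, t[) d x.
Proof.
move=> as_ st tb id.
have sub : (`]s, t[%classic : set R) `<=` `]a, b[%classic.
  by move=> y /=; rewrite !in_itv/= => /andP[sy yt]; rewrite (lt_trans as_) ?(lt_trans yt).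
have md := L1_measurable id.
have [] := @dominated_convergence _ (measurableTypeR R) R mu `]a, b[%classic (mitv _)
  (fun n x => (d x * bump n s t x)%:E) (fun x => (d x * \1_(`]s, t[%classic) x)%:E)
  (fun x => `|d x|%:E).
- move=> n; apply/measurable_EFinP/measurable_funM => //; exact: bump_measurable.
- by apply/measurable_EFinP/measurable_funM => //; apply: measurable_indic; exact: mitv.
- apply: aeW => x _; apply/fine_cvgP; split; first by apply: nearW.
  exact: (cvgMl_tmp (a := d x) (bump_cvg st)).
- exact: integrable_norm.
- apply: aeW => x n _; rewrite /= lee_fin normrM ler_piMr//; exact: bump_norm_le1.
move=> ilim _ lim.
have -> : \int[mu]_(x in `]s, t[) d x =
    \int[mu]_(x in `]a, b[) (d x * \1_(`]s, t[%classic) x).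
  rewrite [in RHS]/Rintegral; congr fine.
  rewrite integral_mkcond [RHS]integral_mkcond; apply: eq_integral => x _.
  rewrite !patchE indicE; have [xs|xs] := boolP (x \in `]s, t[%classic).
    by rewrite ifT ?mulr1// inE; apply: sub; move: xs; rewrite inE.
  by rewrite mulr0; case: ifP.
apply: fine_cvg; rewrite -integral_fineK; [exact: lim|exact: mitv|exact: ilim].
Unshelve. all: by end_near. Qed.

(** The primitive of d is constant on ]a, b[, and Lebesgue's differentiation
    theorem recovers d from it almost everywhere. *)
Lemma ae_zero_of_intervals a b d : L1 a b d ->
  (forall s t, a < s -> s < t -> t < b -> \int[mu]_(x in `]s, t[) d x = 0) ->
  {ae mu, forall x, x \in `]a, b[ -> d x = 0}.
Proof.
move=> id H; pose D := d \_ `]a, b[.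
have iD := restrict_integrable id.
have iDy (I : interval R) : mu.-integrable ([set` I] : set (measurableTypeR R)) (EFin \o D).
  by apply: (integrableS _ _ _ iD); [exact: measurableT|exact: mitv|].
have locD : locally_integrable [set: R] D.
  by apply: integrable_locally => //; exact: mitv.
have := FTC1Ny (fun y => iDy _) locD; apply: filterS; first exact: (ae_filter_ringOfSetsType mu).
move=> x [dF dFE] xab.
have -> : d x = D x by rewrite /D patchE ifT// inE.
rewrite -dFE derive1E.
set F := fun x : R => _ in dF dFE *.
have -> : 'D_1 F x = 'D_1 (cst (F x)) x; last by rewrite derive_cst.
apply: near_eq_derive.
have [ax xb] : a < x /\ x < b by move: xab; rewrite in_itv/= => /andP[].
have incr s t : a < s -> s <= t -> t < b -> F t = F s.
  move=> as_; rewrite le_eqVlt => /predU1P[->//|st] tb; apply/eqP; rewrite -subr_eq0; apply/eqP.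
  rewrite /F (Rintegral_itvB (iDy (Interval -oo%O (BRight t))) _ (x := s)) ?bnd_simp ?ltW//.
  rewrite -(Rintegral_itv_bndo_bndc (iDy _)).
  rewrite -[RHS](H s t)//; apply: eq_Rintegral => y; rewrite inE/= in_itv/= => /andP[sy yt].
  by rewrite /D patchE ifT// inE/= in_itv/= (lt_trans as_ sy) (lt_trans yt tb).
near=> y; have [yx|xy] := leP y x.
  by rewrite /cst (incr y x)//; near: y; exact: lt_nbhsr.
by apply: incr; rewrite ?ltW//; near: y; exact: lt_nbhsl.
Unshelve. all: by end_near. Qed.

Lemma fundamental_lemma a b d : L1 a b d ->
  (forall n s t, a < s -> s < t -> t < b ->
    \int[mu]_(x in `]a, b[) (d x * bump n s t x) = 0) ->
  {ae mu, forall x, x \in `]a, b[ -> d x = 0}.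
Proof.
move=> id H; apply: ae_zero_of_intervals => // s t as_ st tb.
have := bump_int_cvg as_ st tb id.
under eq_fun do rewrite H//.
by move=> /cvg_lim <- //; rewrite lim_cst.
Qed.

(** The vanishing mean makes the primitive vanish to the right of the support,
    so that it is a test function. *)
Lemma zero_mean_primitive a b s t h : a < s -> s < t -> t < b -> continuous h ->
  (forall x, x \notin `[s, t] -> h x = 0) -> \int[mu]_(x in `]a, b[) h x = 0 ->
  C1c a b (prim a h) /\ derive1 (prim a h) = h.
Proof.
move=> as_ st tb ch h0 ih.
have ih1 : L1 a b h by apply: L1_cont => x _; exact: ch.
have P0 x : x \notin `[s, t] -> prim a h x = 0.
  move=> xst; have [xs|sx] := ltP x s.
    rewrite /prim (@eq_Rintegral _ _ _ mu _ (fun=> 0)) ?Rintegral_cst ?mul0r//.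
    move=> y; rewrite inE/= in_itv/= => /andP[_ yx]; apply: h0.
    by rewrite in_itv/= negb_and -ltNge (le_lt_trans yx xs).
  have tx : t < x by move: xst; rewrite in_itv/= sx/= -ltNge.
  rewrite -ih /prim Rintegral_mkcond [RHS]Rintegral_mkcond; apply: eq_Rintegral => y _.
  rewrite !patchE; have [yst|yst] := boolP (y \in `[s, t]); last first.
    by rewrite h0//; case: ifP; case: ifP.
  move: yst; rewrite in_itv/= => /andP[sy yt].
  rewrite ifT; last by rewrite inE/= in_itv/= (lt_le_trans as_ sy) (ltW (le_lt_trans yt tx)).
  by rewrite ifT// inE/= in_itv/= (lt_le_trans as_ sy) (le_lt_trans yt tb).
have D x : is_derive x 1 (prim a h) (h x).
  have [xst|xst] := boolP (x \in `[s, t]).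
    apply: (prim_derive ih1); last exact: ch.
    move: xst; rewrite !in_itv/= => /andP[sx xt].
    by rewrite (lt_le_trans as_ sx) (le_lt_trans xt tb).
  rewrite h0//; have dc : is_derive x 1 (cst (0 : R)) (0 : R) by exact: is_derive_cst.
  apply: near_eq_is_derive dc.
  have : open (~` `[s, t]%classic : set R) by apply: closed_openC; exact: itv_closed.
  move=> /(_ x)-/(_ (negP xst)); apply: filterS => y /= /negP yst.
  by rewrite /cst P0.
split; last by apply/funext => x; rewrite derive1E; case: (D x).
exact: (C1c_intro as_ tb D).
Qed.

(** A function orthogonal to all derivatives of test functions is orthogonal to
    all bumps of mean zero; subtracting from each bump the multiple of one fixed
    bump with the same mean reduces to the fundamental lemma. *)
Lemma du_bois_reymond a b z : L1 a b z ->
  (forall phi, C1c a b phi -> \int[mu]_(x in `]a, b[) (z x * derive1 phi x) = 0) ->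
  exists c, {ae mu, forall x, x \in `]a, b[ -> z x = c}.
Proof.
move=> iz Hz.
have zero_mean s t h : a < s -> s < t -> t < b -> continuous h ->
    (forall x, x \notin `[s, t] -> h x = 0) -> \int[mu]_(x in `]a, b[) h x = 0 ->
    \int[mu]_(x in `]a, b[) (z x * h x) = 0.
  move=> as_ st tb ch h0 ih.
  have [hphi dphi] := zero_mean_primitive as_ st tb ch h0 ih.
  by rewrite -(Hz _ hphi) dphi.
have bump0 n s t x : s < t -> x \notin `[s, t] -> bump n s t x = 0.
  move=> st xst; apply: bump_eq0 => //; apply: contra xst.
  by rewrite !in_itv/= => /andP[/ltW-> /ltW->].
have ibump n s t : L1 a b (bump n s t) by apply: L1_cont => x _; exact: bump_cont.
have [[[[n0 s0] t0] [/= as0 st0 tb0 m0]]|H] :=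
    pselect (exists p : nat * R * R, [/\ a < p.1.2, p.1.2 < p.2, p.2 < b &
      \int[mu]_(x in `]a, b[) bump p.1.1 p.1.2 p.2 x != 0]); last first.
  exists 0; apply: fundamental_lemma => // n s t as_ st tb.
  apply: (zero_mean s t) => //; [exact: bump_cont|by move=> x; exact: bump0|].
  apply/eqP/negPn/negP => h; apply: H; exists (n, s, t); split => //.
set m := \int[mu]_(x in _) _ in m0.
pose c := (\int[mu]_(x in `]a, b[) (z x * bump n0 s0 t0 x)) / m.
exists c.
have ic : L1 a b (fun x => z x - c).
  by apply: L1B => //; apply: (L1_bounded (M := `|c|)) => // x _.
suff : {ae mu, forall x, x \in `]a, b[ -> z x - c = 0}.
  apply: filterS; first exact: (ae_filter_ringOfSetsType mu).
  by move=> x h /h/eqP; rewrite subr_eq0 => /eqP.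
apply: fundamental_lemma => // n s t as_ st tb.
pose l := (\int[mu]_(x in `]a, b[) bump n s t x) / m.
pose h x := bump n s t x - l * bump n0 s0 t0 x.
have mn : Num.min s s0 < Num.max t t0 by rewrite gt_min !lt_max st.
have izb := L1_bump n st iz; have izb0 := L1_bump n0 st0 iz.
have := zero_mean (Num.min s s0) (Num.max t t0) h _ mn.
rewrite lt_min as_ as0 gt_max tb tb0 => /(_ isT isT).
have -> : \int[mu]_(x in `]a, b[) (z x * h x) =
    \int[mu]_(x in `]a, b[) (z x * bump n s t x) -
    l * \int[mu]_(x in `]a, b[) (z x * bump n0 s0 t0 x).
  rewrite -(RintegralZl l (mitv _) izb0) -(RintegralB (mitv _) izb (L1Z l izb0)).
  by apply: eq_Rintegral => x _; rewrite /h mulrBr mulrCA.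
have -> : \int[mu]_(x in `]a, b[) ((z x - c) * bump n s t x) =
    \int[mu]_(x in `]a, b[) (z x * bump n s t x) -
    c * \int[mu]_(x in `]a, b[) bump n s t x.
  rewrite -(RintegralZl c (mitv _) (ibump n s t)).
  rewrite -(RintegralB (mitv _) izb (L1Z c (ibump n s t))).
  by apply: eq_Rintegral => x _; rewrite mulrBl.
move=> <-.
- by rewrite /c /l; congr (_ - _); field.
- move=> x; apply: contB; first exact: bump_cont.
  by apply: contM; [exact: cont_cst|exact: bump_cont].
- move=> x; rewrite in_itv/= ge_min le_max => hx.
  rewrite /h !bump0 ?mulr0 ?subr0//; apply: contra hx; rewrite in_itv/= => /andP[-> ->] //.
  by rewrite !orbT.
- rewrite (RintegralB (mitv _) (ibump n s t) (L1Z l (ibump n0 s0 t0))).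
  by rewrite (RintegralZl l (mitv _) (ibump n0 s0 t0)) /l divfK ?subrr.
Qed.

Lemma weak_derivative_unique a b u g h : L1 a b u -> L1 a b g -> L1 a b h ->
  is_weak_derivative a b u g -> is_weak_derivative a b u h ->
  {ae mu, forall x, x \in `]a, b[ -> g x = h x}.
Proof.
move=> iu ig ih wg wh.
suff : {ae mu, forall x, x \in `]a, b[ -> g x - h x = 0}.
  apply: filterS; first exact: (ae_filter_ringOfSetsType mu).
  by move=> x e /e/eqP; rewrite subr_eq0 => /eqP.
apply: fundamental_lemma; first exact: L1B.
move=> n s t as_ st tb; have hphi := C1c_bump n as_ st tb.
have ig1 := (L1_C1c ig hphi).1; have ih1 := (L1_C1c ih hphi).1.
have e1 := (weak_derivativeP iu ig).1 wg _ hphi.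
have e2 := (weak_derivativeP iu ih).1 wh _ hphi.
transitivity (\int[mu]_(x in `]a, b[) (g x * bump n s t x) -
   \int[mu]_(x in `]a, b[) (h x * bump n s t x)); last by lra.
rewrite -(RintegralB (mitv _) ig1 ih1).
by apply: eq_Rintegral => x _; rewrite mulrBl.
Qed.

Lemma ae_eq_Rint a b u g : L1 a b u -> L1 a b g ->
  {ae mu, forall x, x \in `]a, b[ -> u x = g x} ->
  \int[mu]_(x in `]a, b[) u x = \int[mu]_(x in `]a, b[) g x.
Proof.
move=> /integrableP[mu_ _] /integrableP[mg _] e; rewrite /Rintegral; congr fine.
apply: ae_eq_integral => //.
apply: filterS e; first exact: (ae_filter_ringOfSetsType mu).
by move=> x e /= /e ->.
Qed.

Lemma weak_derivative_ae a b u u' g g' : L1 a b u -> L1 a b g -> L1 a b u' -> L1 a b g' ->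
  {ae mu, forall x, x \in `]a, b[ -> u x = u' x} ->
  {ae mu, forall x, x \in `]a, b[ -> g x = g' x} ->
  is_weak_derivative a b u g -> is_weak_derivative a b u' g'.
Proof.
move=> iu ig iu' ig' eu eg w; apply/weak_derivativeP => // phi hphi.
have e := (weak_derivativeP iu ig).1 w _ hphi.
rewrite -(ae_eq_Rint (L1_C1c iu hphi).2 (L1_C1c iu' hphi).2).
  rewrite e (ae_eq_Rint (L1_C1c ig hphi).1 (L1_C1c ig' hphi).1)//.
  apply: filterS eg; first exact: (ae_filter_ringOfSetsType mu).
  by move=> x e1 /e1 ->.
apply: filterS eu; first exact: (ae_filter_ringOfSetsType mu).
by move=> x e1 /e1 ->.
Qed.

End Fundamental.

(** * Functions with two weak derivatives *)

Section WeakDerivatives.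
Context {R : realType}.
Notation mu := (@lebesgue_measure R).
Implicit Types (a b s t x : R) (f g h u k d w : R -> R).

Lemma ae_and (P Q : R -> Prop) : {ae mu, forall x, P x} -> {ae mu, forall x, Q x} ->
  {ae mu, forall x, P x /\ Q x}.
Proof. by apply: filterS2; [exact: (ae_filter_ringOfSetsType mu)|]. Qed.

Lemma ae_impl (P Q : R -> Prop) : (forall x, P x -> Q x) ->
  {ae mu, forall x, P x} -> {ae mu, forall x, Q x}.
Proof. by move=> h; apply: filterS; first exact: (ae_filter_ringOfSetsType mu). Qed.

Lemma wderiv_spec a b u : H1 a b u ->
  L2 a b (wderiv a b u) /\ is_weak_derivative a b u (wderiv a b u).
Proof.
move=> [_ [g g1 g2]].
by have := @xgetPex _ (fun=> 0) [set g | L2 a b g /\ is_weak_derivative a b u g]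
  (ex_intro _ g (conj g1 g2)).
Qed.

Lemma wderiv_ae a b u g : L2 a b u -> L2 a b g -> is_weak_derivative a b u g ->
  {ae mu, forall x, x \in `]a, b[ -> wderiv a b u x = g x}.
Proof.
move=> lu lg wg; have [l1 w1] : L2 a b (wderiv a b u) /\ is_weak_derivative a b u (wderiv a b u).
  by apply: wderiv_spec; split => //; exists g.
by apply: (weak_derivative_unique (L2_L1 lu)) => //; exact: L2_L1.
Qed.

(** Chosen representatives of a function of H^2 and of its two weak derivatives;
    working with triples avoids the choice operator hidden in wderiv. *)
Definition weak2 a b w w1 w2 : Prop := [/\ L2 a b w, L2 a b w1, L2 a b w2,
  is_weak_derivative a b w w1 & is_weak_derivative a b w1 w2].

Lemma weak2_H2 a b w w1 w2 : weak2 a b w w1 w2 -> [/\ H2 a b w,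
  {ae mu, forall x, x \in `]a, b[ -> wderiv a b w x = w1 x} &
  {ae mu, forall x, x \in `]a, b[ -> wderiv a b (wderiv a b w) x = w2 x}].
Proof.
move=> [lw l1 l2 d1 d2].
have hw : H1 a b w by split => //; exists w1.
have [l1' _] := wderiv_spec hw; have e1 := wderiv_ae lw l1 d1.
have d2' : is_weak_derivative a b (wderiv a b w) w2.
  apply: (weak_derivative_ae (L2_L1 l1) (L2_L1 l2) (L2_L1 l1') (L2_L1 l2) _ _ d2).
    by apply: ae_impl e1 => x h /h.
  by apply: aeW.
split => //; first by split => //; split => //; exists w2.
exact: wderiv_ae.
Qed.

Lemma H2_weak2 a b w : H2 a b w ->
  weak2 a b w (wderiv a b w) (wderiv a b (wderiv a b w)).
Proof.
move=> [h1 h2]; have [l1 d1] := wderiv_spec h1; have [l2 d2] := wderiv_spec h2.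
by split => //; case: h1.
Qed.

Lemma weak_derivativeD a b u g u' g' : L1 a b u -> L1 a b g -> L1 a b u' -> L1 a b g' ->
  is_weak_derivative a b u g -> is_weak_derivative a b u' g' ->
  is_weak_derivative a b (fun x => u x + u' x) (fun x => g x + g' x).
Proof.
move=> iu ig iu' ig' w w'; apply/weak_derivativeP; [exact: L1D|exact: L1D|].
move=> phi hphi; have [] := L1_C1c iu hphi; have [] := L1_C1c iu' hphi.
have [] := L1_C1c ig hphi; have [] := L1_C1c ig' hphi => i1 _ i2 _ _ i3 _ i4.
transitivity (\int[mu]_(x in `]a, b[) (u x * derive1 phi x) +
   \int[mu]_(x in `]a, b[) (u' x * derive1 phi x)).
  by rewrite -(RintegralD (mitv _) i4 i3); apply: eq_Rintegral => x _; rewrite mulrDl.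
rewrite ((weak_derivativeP iu ig).1 w _ hphi) ((weak_derivativeP iu' ig').1 w' _ hphi).
rewrite -opprD -(RintegralD (mitv _) i2 i1); congr (- _).
by apply: eq_Rintegral => x _; rewrite mulrDl.
Qed.

Lemma weak_derivativeZ a b c u g : L1 a b u -> L1 a b g ->
  is_weak_derivative a b u g -> is_weak_derivative a b (fun x => c * u x) (fun x => c * g x).
Proof.
move=> iu ig w; apply/weak_derivativeP; [exact: L1Z|exact: L1Z|].
move=> phi hphi; have [_ i1] := L1_C1c iu hphi; have [i2 _] := L1_C1c ig hphi.
transitivity (c * \int[mu]_(x in `]a, b[) (u x * derive1 phi x)).
  by rewrite -(RintegralZl c (mitv _) i1); apply: eq_Rintegral => x _; rewrite mulrA.
rewrite ((weak_derivativeP iu ig).1 w _ hphi) mulrN; congr (- _).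
by rewrite -(RintegralZl c (mitv _) i2); apply: eq_Rintegral => x _; rewrite mulrA.
Qed.

Lemma weak2D a b w w1 w2 v v1 v2 t : weak2 a b w w1 w2 -> weak2 a b v v1 v2 ->
  weak2 a b (fun x => w x + t * v x) (fun x => w1 x + t * v1 x) (fun x => w2 x + t * v2 x).
Proof.
move=> [a1 a2 a3 a4 a5] [b1 b2 b3 b4 b5]; split.
- exact/L2D/L2Z.
- exact/L2D/L2Z.
- exact/L2D/L2Z.
- apply: weak_derivativeD (L2_L1 a1) (L2_L1 a2) (L1Z _ (L2_L1 b1)) (L1Z _ (L2_L1 b2)) a4 _.
  exact: weak_derivativeZ (L2_L1 b1) (L2_L1 b2) b4.
- apply: weak_derivativeD (L2_L1 a2) (L2_L1 a3) (L1Z _ (L2_L1 b2)) (L1Z _ (L2_L1 b3)) a5 _.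
  exact: weak_derivativeZ (L2_L1 b2) (L2_L1 b3) b5.
Qed.

(** Double primitives are the variations used for the Euler-Lagrange equation.
    They satisfy no boundary condition at b, so the natural boundary conditions
    come out together with the equation. *)
Lemma weak2_prim a b h : a < b -> L2 a b h -> weak2 a b (prim a (prim a h)) (prim a h) h.
Proof.
move=> ab lh; have l1 := prim_L2 (L2_L1 lh).
split => //; first exact: prim_L2 (L2_L1 l1).
- exact: prim_weak (L2_L1 l1).
- exact: prim_weak (L2_L1 lh).
Qed.

(** The primitive vanishes identically, hence so does its derivative. *)
Lemma ae_cont_eq0 a b e : L1 a b e -> (forall x, x \in `]a, b[ -> continuous_at x e) ->
  {ae mu, forall x, x \in `]a, b[ -> e x = 0} -> forall x, x \in `]a, b[ -> e x = 0.
Proof.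
move=> ie ce e0.
have P0 x : x \in `]a, b[ -> prim a e x = 0.
  move=> xab; have xb : x < b by move: xab; rewrite in_itv/= => /andP[].
  have sub := @sub_oc _ a b x xb.
  transitivity (\int[mu]_(t in `]a, x]) (fun=> 0 : R) t).
    rewrite /prim /Rintegral; congr fine; apply: ae_eq_integral; first exact: mitv.
    - by have := L1_sub ie sub => /integrableP[].
    - exact: measurable_cst.
    - by apply: ae_impl e0 => y h /sub/h ->.
  by rewrite Rintegral_cst ?mul0r//; exact: mitv.
move=> x xab; have [_ <-] := prim_derive ie xab (ce x xab).
have -> : 'D_1 (prim a e) x = 'D_1 (cst 0) x; last by rewrite derive_cst.
by apply: near_eq_derive; near=> y; rewrite P0//; near: y; exact: near_in_itvoo.
Unshelve. all: by end_near. Qed.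

Lemma fubini_prim a b h k : L1 a b h -> L1 a b k ->
  \int[mu]_(x in `]a, b[) (h x * prim a k x) =
  \int[mu]_(t in `]a, b[) (k t * (\int[mu]_(x in `]a, b[) h x - prim a h t)).
Proof.
move=> ih ik; rewrite /prim fubini_triangle//; apply: eq_Rintegral => t.
rewrite inE/= in_itv/= => /andP[at_ tb]; congr (_ * _).
rewrite (Rintegral_itvB ih) ?bnd_simp//; last exact: ltW.
rewrite Rintegral_itv_obnd_cbnd//; apply: (L1_sub ih) => y; rewrite !in_itv/= => /andP[ty ->].
by rewrite (lt_trans at_ ty).
Qed.

End WeakDerivatives.

(** * The Euler-Lagrange equation *)

Section Variation.
Context {R : realType}.
Notation mu := (@lebesgue_measure R).
Implicit Types (A beta a b s t x : R) (f g h u k d w : R -> R).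

(** The integrand of the functional, as a function of representatives of the
    derivatives.  The same formula with other constants is the integrand after
    the blow-up. *)
Definition density A beta f w w1 w2 x : R :=
  A * w2 x ^+ 2 + ln (1 + w1 x ^+ 2) + beta * (w x - f x) ^+ 2.

Lemma eq_leR (x y : R) : x = y -> x <= y. Proof. by move=> ->. Qed.

Lemma den_gt0 (q : R) : 0 < 1 + q ^+ 2.
Proof. by rewrite ltr_wpDr ?sqr_ge0. Qed.

Lemma flux_cont : continuous (fun q : R => q / (1 + q ^+ 2)).
Proof.
move=> q; apply: contM => //.
have cd : continuous_at q (fun q : R => 1 + q ^+ 2).
  by apply: contD; [exact: cont_cst|exact: contX].
by apply: (cvgV _ cd); rewrite gt_eqF// den_gt0.
Qed.

Lemma flux_le1 (q : R) : `|q / (1 + q ^+ 2)| <= 1.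
Proof.
rewrite normrM normfV (gtr0_norm (den_gt0 q)) ler_pdivrMr ?den_gt0// mul1r.
have S1 := sqr_ge0 (q - 1); have S2 := sqr_ge0 (q + 1).
by rewrite ler_norml; apply/andP; split; nra.
Qed.

(** Since 1 + (q+r)^2 = (1 + q^2)(1 + x) with x = (2qr + r^2)/(1 + q^2), this is
    ln(1 + x) <= x.  It bounds the non-convex term along a variation by its
    linearization plus a quadratic remainder. *)
Lemma ln_quadratic (q r : R) :
  ln (1 + (q + r) ^+ 2) <= ln (1 + q ^+ 2) + 2 * (q / (1 + q ^+ 2) * r) + r ^+ 2.
Proof.
have q0 : 0 < 1 + q ^+ 2 by rewrite ltr_wpDr ?sqr_ge0.
have qr0 : 0 < 1 + (q + r) ^+ 2 by rewrite ltr_wpDr ?sqr_ge0.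
rewrite -addrA -lerBlDl -ln_div ?posrE//.
have -> : (1 + (q + r) ^+ 2) / (1 + q ^+ 2) = 1 + (2 * q * r + r ^+ 2) / (1 + q ^+ 2).
  by field; rewrite gt_eqF.
apply: le_trans (le_ln1Dx _) _.
  rewrite -subr_gt0 opprK addrC.
  have -> : 1 + (2 * q * r + r ^+ 2) / (1 + q ^+ 2) = (1 + (q + r) ^+ 2) / (1 + q ^+ 2).
    by field; rewrite gt_eqF.
  exact: divr_gt0.
rewrite mulrDl; apply: lerD; first by apply: eq_leR; field; rewrite gt_eqF.
by rewrite ler_pdivrMr// ler_peMr ?sqr_ge0// lerDl sqr_ge0.
Qed.

Lemma ln1Dsqr_ge0 (q : R) : 0 <= ln (1 + q ^+ 2).
Proof. by rewrite ln_ge0// lerDl sqr_ge0. Qed.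

Lemma ln1Dsqr_le (q : R) : ln (1 + q ^+ 2) <= q ^+ 2.
Proof. by apply: le_ln1Dx; rewrite (lt_le_trans _ (sqr_ge0 q))// ltrN10. Qed.

Lemma ln1Dsqr_measurable a b h :
  measurable_fun (`]a, b[ : set (measurableTypeR R)) h ->
  measurable_fun (`]a, b[ : set (measurableTypeR R)) (fun x => ln (1 + h x ^+ 2)).
Proof.
move=> mh; apply: measurableT_comp; first exact: measurable_ln.
by apply: measurable_funD => //; exact: measurable_funX.
Qed.

Lemma ln1Dsqr_L1 a b h : L2 a b h -> L1 a b (fun x => ln (1 + h x ^+ 2)).
Proof.
move=> [mh ih]; apply: (L1_le (ln1Dsqr_measurable mh) ih) => x _.
by rewrite !ger0_norm ?sqr_ge0 ?ln1Dsqr_ge0// ln1Dsqr_le.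
Qed.

Lemma density_L1 A beta a b f w w1 w2 : L2 a b f -> L2 a b w -> L2 a b w1 -> L2 a b w2 ->
  L1 a b (density A beta f w w1 w2).
Proof.
move=> lf l0 l1 l2; apply: L1D; last by apply: L1Z; exact: (L2B l0 lf).2.
by apply: L1D; [apply: L1Z; exact: l2.2|exact: ln1Dsqr_L1].
Qed.

Lemma PMF_weak2 eps beta f a b w w1 w2 : L2 a b f -> weak2 a b w w1 w2 ->
  PMF eps beta f a b w = (\int[mu]_(x in `]a, b[)
    density (eps ^+ 6 * omega eps ^+ 4) beta f w w1 w2 x)%:E.
Proof.
move=> lf hw; have [hH2 e1 e2] := weak2_H2 hw; have [l0 l1 l2 _ _] := hw.
have [l0' l1' l2' _ _] := H2_weak2 hH2.
rewrite /PMF (integral_fineK (mitv _)); last exact: (density_L1 _ _ lf l0 l1' l2').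
congr EFin; apply: ae_eq_Rint; [exact: (density_L1 _ _ lf l0 l1' l2')|exact: density_L1|].
apply: ae_impl (ae_and e1 e2) => x [h1 h2] xab.
by rewrite /density h1// h2.
Qed.

Section EulerLagrange.
Variables (A beta a b : R) (f u g g2 : R -> R).
Hypotheses (ab : a < b) (A_gt0 : 0 < A).
Hypotheses (lf : L2 a b f) (hu : weak2 a b u g g2).
Hypothesis umin : forall w w1 w2, weak2 a b w w1 w2 ->
  \int[mu]_(x in `]a, b[) density A beta f u g g2 x <=
  \int[mu]_(x in `]a, b[) density A beta f w w1 w2 x.

Let N x := g x / (1 + g x ^+ 2).
Let F x := beta * (u x - f x).

Let lN : L2 a b N.
Proof.
apply: (L2_bounded (M := 1)) => [|x _]; last exact: flux_le1.
have mg : measurable_fun (`]a, b[ : set (measurableTypeR R)) g by case: hu => _ [].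
by apply: (measurableT_comp (f := fun q : R => q / (1 + q ^+ 2))) => //;
  apply: continuous_measurable_fun; exact: flux_cont.
Qed.

Let lF : L2 a b F.
Proof. by apply/L2Z/L2B => //; case: hu. Qed.

(** Along u + tv the functional grows by at most 2tI + t^2 J, where I is the
    first variation; minimality makes this nonnegative for every t, so I = 0. *)
Lemma first_variation v v1 v2 : weak2 a b v v1 v2 ->
  \int[mu]_(x in `]a, b[) (A * (g2 x * v2 x) + N x * v1 x + F x * v x) = 0.
Proof.
move=> hv; have [l0 l1 l2 _ _] := hv; have [lu lg lg2 _ _] := hu.
set I := LHS; pose J := \int[mu]_(x in `]a, b[) (A * v2 x ^+ 2 + v1 x ^+ 2 + beta * v x ^+ 2).
have iI : L1 a b (fun x => A * (g2 x * v2 x) + N x * v1 x + F x * v x).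
  by apply: L1D; [apply: L1D; [apply: L1Z; exact: L2M|exact: L2M]|exact: L2M].
have iJ : L1 a b (fun x => A * v2 x ^+ 2 + v1 x ^+ 2 + beta * v x ^+ 2).
  apply: L1D; [apply: L1D|]; [apply: L1Z; exact: l2.2|exact: l1.2|apply: L1Z; exact: l0.2].
have id := density_L1 A beta lf lu lg lg2.
have H t : 0 <= 2 * t * I + t ^+ 2 * J.
  have ht := weak2D t hu hv; have [m0 m1 m2 _ _] := ht.
  have := umin ht.
  (* Only the logarithm is estimated; the other two terms are exactly quadratic in t. *)
  have L : \int[mu]_(x in `]a, b[) density A beta f (fun x => u x + t * v x)
      (fun x => g x + t * v1 x) (fun x => g2 x + t * v2 x) x <=
    \int[mu]_(x in `]a, b[) (density A beta f u g g2 x +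
      (2 * t * (A * (g2 x * v2 x) + N x * v1 x + F x * v x) +
       t ^+ 2 * (A * v2 x ^+ 2 + v1 x ^+ 2 + beta * v x ^+ 2))).
    apply: le_Rintegral; [exact: mitv|exact: density_L1|apply: L1D => //; apply: L1D; exact: L1Z|].
    move=> x _; rewrite /density; have := ln_quadratic (g x) (t * v1 x).
    rewrite /N /F exprMn; set l1' := ln _; set l2' := ln _; set q := g x / _; nra.
  move=> /le_trans/(_ L); rewrite (RintegralD (mitv _)) //; last by apply: L1D; exact: L1Z.
  rewrite lerDl (RintegralD (mitv _)); [|exact: L1Z|exact: L1Z].
  by rewrite (RintegralZl _ (mitv _) iI) (RintegralZl _ (mitv _) iJ).
apply/eqP/negPn/negP => I0.
(* A step of the order of the minimizer - I / J of the quadratic; the shift by 1 avoids J = 0. *)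
have h1 := H (- I / (`|J| + 1)); have J0 : 0 < `|J| + 1 by rewrite ltr_wpDl.
have : 0 <= (I ^+ 2 / (`|J| + 1)) * (J / (`|J| + 1) - 2).
  by apply: le_trans h1 _; apply: eq_leR; field; rewrite gt_eqF.
rewrite pmulr_rge0 ?divr_gt0 ?exprn_even_gt0//.
rewrite subr_ge0 ler_pdivlMr//; have := ler_norm J; lra.
Qed.

Let P x := \int[mu]_(t in `]a, b[) F t - prim a F x.
Let G x := N x + P x.
Let Q x := \int[mu]_(t in `]a, b[) G t - prim a G x.
Let T x := A * g2 x + Q x.

Let lcst c : L2 a b (fun=> c).
Proof. by apply: (L2_bounded (M := `|c|)) => // x _; exact: measurable_cst. Qed.

Let lP : L2 a b P.
Proof. by apply: L2B => //; exact: prim_L2 (L2_L1 lF). Qed.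

Let lG : L2 a b G. Proof. exact: L2D. Qed.

Let lQ : L2 a b Q.
Proof. by apply: L2B => //; exact: prim_L2 (L2_L1 lG). Qed.

Let lT : L2 a b T.
Proof. by apply: L2D => //; apply: L2Z; case: hu. Qed.

(** Two exchanges of integration write the first variation along the double
    primitive of h as the integral of h T, where T = A u'' + Q.  The choice
    h = T gives T = 0. *)
Lemma euler_lagrange_ae : {ae mu, forall x, x \in `]a, b[ -> g2 x = - (Q x / A)}.
Proof.
have [lu lg lg2 _ _] := hu.
have lp := prim_L2 (L2_L1 lT); have lpp := prim_L2 (L2_L1 lp).
have i1 : L1 a b (fun x => A * (g2 x * T x)) by apply: L1Z; exact: L2M.
have i2 : L1 a b (fun x => N x * prim a T x) by exact: L2M.
have i3 : L1 a b (fun x => F x * prim a (prim a T) x) by exact: L2M.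
(* The variation whose second derivative is T itself. *)
have := first_variation (weak2_prim ab lT).
rewrite (RintegralD (mitv _) (L1D i1 i2) i3) (RintegralD (mitv _) i1 i2).
rewrite (fubini_prim (L2_L1 lF) (L2_L1 lp)) -/(P _).
have i4 : L1 a b (fun x => prim a T x * P x) by exact: L2M.
rewrite -addrA -(RintegralD (mitv _) i2 i4).
have -> : \int[mu]_(x in `]a, b[) (N x * prim a T x + prim a T x * P x) =
    \int[mu]_(x in `]a, b[) (G x * prim a T x).
  by apply: eq_Rintegral => x _; rewrite /G mulrDl (mulrC (P x)).
rewrite (fubini_prim (L2_L1 lG) (L2_L1 lT)).
have i5 : L1 a b (fun x => T x * Q x) by exact: L2M.
rewrite -(RintegralD (mitv _) i1 i5).
have -> : \int[mu]_(x in `]a, b[) (A * (g2 x * T x) + T x * Q x) =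
    \int[mu]_(x in `]a, b[) (T x ^+ 2).
  by apply: eq_Rintegral => x _; rewrite /T; ring.
move=> iT0.
have mT2 : measurable_fun (`]a, b[ : set (measurableTypeR R)) (fun x => (T x ^+ 2)%:E).
  by case/integrableP : lT.2.
have := (ae_eq_integral_abs mu (mitv _) mT2).1.
have -> : (\int[mu]_(x in `]a, b[) `|(T x ^+ 2)%:E|)%E = 0%E.
  under eq_integral do rewrite gee0_abs ?lee_fin ?sqr_ge0//.
  by rewrite (integral_fineK (mitv _) lT.2) iT0.
move=> /(_ erefl); apply: ae_impl => x h xab.
have := h xab => -[/eqP]; rewrite sqrf_eq0 /T addr_eq0 => /eqP h'.
by rewrite -mulNr -h' mulrAC divff ?gt_eqF// mul1r.
Qed.

(** The equation A u'' = - Q expresses u'' by primitives, hence by continuous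
    functions.  By du Bois-Reymond u and u' agree almost everywhere with the
    successive primitives of u''; with the continuity of u this bootstraps to a
    classical solution.  The function p collects the lower order terms: it is the
    integral of beta (u - f), and A u''' = u'/(1 + u'^2) + p is the first integral
    of the fourth order equation. *)
Lemma minimizer_regular : (forall x, x \in `]a, b[ -> continuous_at x u) ->
  (forall x, x \in `]a, b[ -> continuous_at x f) ->
  exists u1 u2 p : R -> R, weak2 a b u u1 u2 /\
    forall x, x \in `]a, b[ -> [/\ is_derive x 1 u (u1 x), is_derive x 1 u1 (u2 x),
      is_derive x 1 u2 ((u1 x / (1 + u1 x ^+ 2) + p x) / A) &
      is_derive x 1 p (- (beta * (u x - f x)))].
Proof.
move=> cu cf; have [lu lg lg2 wu wg] := hu.
pose u2 x := - (Q x / A).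
have lu2 : L2 a b u2.
  have := L2Z (- A^-1) lQ; rewrite (_ : (fun x => _) = u2)//.
  by apply/funext => x; rewrite /u2 mulNr mulrC.
have g2E := euler_lagrange_ae.
have cu2 x : x \in `]a, b[ -> continuous_at x u2.
  move=> xab; rewrite /u2; apply: (@cont_comp _ (fun x => Q x / A) -%R).
    apply: contM; last exact: cont_cst.
    by apply: contB; [exact: cont_cst|exact: prim_cont (L2_L1 lG) xab].
  exact: opp_continuous.
have zero u' u'' v : L1 a b u' -> L1 a b u'' -> L1 a b v ->
    is_weak_derivative a b u' v -> is_weak_derivative a b u'' v ->
    exists c, {ae mu, forall x, x \in `]a, b[ -> u' x = u'' x + c}.
  move=> iu' iu'' iv w' w''.
  have [] := @du_bois_reymond _ a b (fun x => u' x - u'' x); first exact: L1B.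
    move=> phi hphi.
    have [_ j1] := L1_C1c iu' hphi; have [_ j2] := L1_C1c iu'' hphi.
    transitivity (\int[mu]_(x in `]a, b[) (u' x * derive1 phi x) -
      \int[mu]_(x in `]a, b[) (u'' x * derive1 phi x)).
      by rewrite -(RintegralB (mitv _) j1 j2); apply: eq_Rintegral => x _; rewrite mulrBl.
    by rewrite ((weak_derivativeP iu' iv).1 w' _ hphi)
      ((weak_derivativeP iu'' iv).1 w'' _ hphi) subrr.
  move=> c h; exists c; apply: ae_impl h => x h /h.
  by move=> /eqP; rewrite subr_eq addrC => /eqP.
have refl (h : R -> R) : {ae mu, forall x, x \in `]a, b[ -> h x = h x} by exact: aeW.
have [c gE] : exists c, {ae mu, forall x, x \in `]a, b[ -> g x = prim a u2 x + c}.
  apply: (zero _ _ u2); [exact: L2_L1|exact/L2_L1/prim_L2/L2_L1|exact: L2_L1| |].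
    exact: weak_derivative_ae (L2_L1 lg) (L2_L1 lg2) (L2_L1 lg) (L2_L1 lu2) (refl g) g2E wg.
  exact: prim_weak (L2_L1 lu2).
pose u1 x := prim a u2 x + c.
have lu1 : L2 a b u1 by apply: L2D => //; exact: prim_L2 (L2_L1 lu2).
have [e uE] : exists e, {ae mu, forall x, x \in `]a, b[ -> u x = prim a u1 x + e}.
  apply: (zero _ _ u1); [exact: L2_L1|exact/L2_L1/prim_L2/L2_L1|exact: L2_L1| |].
    exact: weak_derivative_ae (L2_L1 lu) (L2_L1 lg) (L2_L1 lu) (L2_L1 lu1) (refl u) gE wu.
  exact: prim_weak (L2_L1 lu1).
have cu1 x : x \in `]a, b[ -> continuous_at x u1.
  by move=> xab; apply: contD; [exact: prim_cont (L2_L1 lu2) xab|exact: cont_cst].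
have uE' x : x \in `]a, b[ -> u x = prim a u1 x + e.
  move=> xab; apply/eqP; rewrite -subr_eq0; apply/eqP.
  apply: (@ae_cont_eq0 _ a b (fun x => u x - (prim a u1 x + e))) xab.
  - apply: L1B; [exact: L2_L1|apply: L1D; [exact/L2_L1/prim_L2/L2_L1|exact: L2_L1]].
  - move=> y yab; apply: contB; first exact: cu.
    by apply: contD; [exact: prim_cont (L2_L1 lu1) yab|exact: cont_cst].
  - by apply: ae_impl uE => y h /h ->; rewrite subrr.
pose k x := u1 x / (1 + u1 x ^+ 2) + P x.
have cP x : x \in `]a, b[ -> continuous_at x P.
  by move=> xab; apply: contB; [exact: cont_cst|exact: prim_cont (L2_L1 lF) xab].
have ck x : x \in `]a, b[ -> continuous_at x k.
  move=> xab; apply: contD; last exact: cP.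
  apply: (@cont_comp _ u1 (fun q => q / (1 + q ^+ 2))); first exact: cu1.
  exact: flux_cont.
have lk : L2 a b k.
  apply: L2D => //; apply: (L2_bounded (M := 1)) => [|x _]; last exact: flux_le1.
  apply: cont_measurable => x xab.
  apply: (@cont_comp _ u1 (fun q => q / (1 + q ^+ 2))); first exact: cu1.
  exact: flux_cont.
have GE x : x \in `]a, b[ -> prim a G x = prim a k x.
  move=> xab; have xb : x < b by move: xab; rewrite in_itv/= => /andP[].
  have sub := @sub_oc _ a b x xb.
  rewrite /prim /Rintegral; congr fine; apply: ae_eq_integral; first exact: mitv.
  - by have := L1_sub (L2_L1 lG) sub => /integrableP[].
  - by have := L1_sub (L2_L1 lk) sub => /integrableP[].
  - by apply: ae_impl gE => y h /sub/h; rewrite /G /N /k /= /u1 => ->.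
have nearE (h h' : R -> R) (x d : R) : x \in `]a, b[ -> (forall y, y \in `]a, b[ -> h y = h' y) ->
    is_derive x 1 h' d -> is_derive x 1 h d.
  move=> xab hh'; apply: near_eq_is_derive; near=> y; apply/esym/hh'.
  by near: y; exact: near_in_itvoo.
exists u1, u2, P; split.
  split; [exact: lu|exact: lu1|exact: lu2| |].
    exact: weak_derivative_ae (L2_L1 lu) (L2_L1 lg) (L2_L1 lu) (L2_L1 lu1) (refl u) gE wu.
  exact: weak_derivative_ae (L2_L1 lg) (L2_L1 lg2) (L2_L1 lu1) (L2_L1 lu2) gE g2E wg.
move=> x xab; split.
- apply: (nearE _ _ _ _ xab uE').
  have h := prim_derive (L2_L1 lu1) xab (cu1 x xab).
  by apply: is_derive_eq; rewrite addr0.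
- have h := prim_derive (L2_L1 lu2) xab (cu2 x xab).
  by apply: is_derive_eq; rewrite addr0.
- have h := prim_derive (L2_L1 lk) xab (ck x xab).
  apply: (nearE _ (fun y => - ((\int[mu]_(t in `]a, b[) G t - prim a k y) / A)) _ _ xab).
    by move=> y yab; rewrite /u2 /Q GE.
  by apply: is_derive_eq; rewrite /k /GRing.scale/=; ring.
- have cF : continuous_at x F.
    by apply: contM; [exact: cont_cst|apply: contB; [exact: cu|exact: cf]].
  have h := prim_derive (L2_L1 lF) xab cF.
  by rewrite /P; apply: is_derive_eq; rewrite /F; ring.
Unshelve. all: by end_near. Qed.

End EulerLagrange.

End Variation.

(** * Comparison with smooth competitors on a subinterval *)

Section Comparison.
Context {R : realType}.
Notation mu := (@lebesgue_measure R).
Implicit Types (A beta a b c d s t x : R) (f g h u k w : R -> R).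

Lemma Rintegral_cut a b c d h : a < c -> d < b ->
  \int[mu]_(x in `]a, b[) (h \_ `[c, d]) x = \int[mu]_(x in `[c, d]) h x.
Proof.
move=> ac db; rewrite Rintegral_mkcond [RHS]Rintegral_mkcond; apply: eq_Rintegral => x _.
rewrite !patchE; have [xcd|xcd] := boolP (x \in `[c, d]%classic); last by case: ifP.
rewrite ifT// inE/=; move: xcd; rewrite inE/= !in_itv/= => /andP[cx xd].
by rewrite (lt_le_trans ac cx) (le_lt_trans xd db).
Qed.

Lemma cont_bounded c d h : (forall x, x \in `[c, d] -> continuous_at x h) ->
  exists M, forall x, x \in `[c, d] -> `|h x| <= M.
Proof.
move=> /within_cont/continuous_compact/(_ (@segment_compact _ c d))/compact_bounded[M [_ hM]].
exists (M + 1) => x xab; apply: (hM (M + 1)); first by rewrite ltrDl.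
by exists x.
Qed.

Lemma L2_cut a b c d h : (forall x, x \in `[c, d] -> continuous_at x h) ->
  L2 a b (h \_ `[c, d]).
Proof.
move=> ch; have [M hM] := cont_bounded ch.
apply: (L2_bounded (M := `|M|)).
  apply: (measurable_funS (E := setT)) => //.
  apply/(measurable_restrictT (h : measurableTypeR R -> R) (mitv _)).
  by have := L1_cc ch => /integrableP[/measurable_EFinP].
move=> x _; rewrite patchE; case: ifPn => [|_]; last by rewrite normr0.
by rewrite inE => /hM /le_trans; apply; exact: ler_norm.
Qed.

(** Extension by zero preserves weak derivatives when the function vanishes at
    the end points: the boundary terms of the integration by parts are zero. *)
Lemma weak_cut a b c d h h1 : a < c -> c < d -> d < b ->
  (forall x, x \in `[c, d] -> is_derive x 1 h (h1 x)) ->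
  (forall x, x \in `[c, d] -> continuous_at x h1) -> h c = 0 -> h d = 0 ->
  is_weak_derivative a b (h \_ `[c, d]) (h1 \_ `[c, d]).
Proof.
move=> ac cd db dh ch1 hc hd.
have ch x : x \in `[c, d] -> continuous_at x h by move=> /dh/is_derive_continuous.
apply/weak_derivativeP; [exact/L2_L1/L2_cut|exact/L2_L1/L2_cut|].
move=> phi hphi; have cphi := C1c_cont hphi; have [dphi cdphi _ _] := hphi.
have cut (k : R -> R) l : (fun x => (k \_ `[c, d]) x * l x) = (fun x => k x * l x) \_ `[c, d].
  by apply/funext => x; rewrite !patchE; case: ifP => // _; rewrite mul0r.
rewrite !cut !Rintegral_cut//.
have c1 x : x \in `[c, d] -> continuous_at x (fun x => h x * derive1 phi x).
  by move=> xcd; apply: contM; [exact: ch|exact: cdphi].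
have c2 x : x \in `[c, d] -> continuous_at x (fun x => h1 x * phi x).
  by move=> xcd; apply: contM; [exact: ch1|exact: cphi].
apply/eqP; rewrite -addr_eq0 -(RintegralD (mitv _) (L1_cc c1) (L1_cc c2)).
have dF x : x \in `[c, d] ->
    is_derive x 1 (fun x => h x * phi x) (h x * derive1 phi x + h1 x * phi x).
  move=> xcd; have h' := dh x xcd.
  have p' : is_derive x 1 phi (derive1 phi x) by split => //; rewrite derive1E.
  by apply: is_derive_eq; rewrite /GRing.scale/=; ring.
have c3 x : x \in `[c, d] -> continuous_at x (fun x => h x * derive1 phi x + h1 x * phi x).
  by move=> xcd; apply: contD; [exact: c1|exact: c2].
by rewrite (ftc cd c3 dF) hc hd !mul0r subrr.
Qed.

Lemma density_cont A beta f w w1 w2 x : continuous_at x f -> continuous_at x w ->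
  continuous_at x w1 -> continuous_at x w2 -> continuous_at x (density A beta f w w1 w2).
Proof.
move=> cf cw cw1 cw2; apply: contD; first apply: contD.
- by apply: contM; [exact: cont_cst|exact: contX].
- apply: (@cont_comp _ (fun x => 1 + w1 x ^+ 2) (@ln R)).
    by apply: contD; [exact: cont_cst|exact: contX].
  exact/continuous_ln/den_gt0.
- by apply: contM; [exact: cont_cst|apply/contX/contB].
Qed.

(** A competitor with the same values and slopes at c and d extends by u to an
    element of H^2, so minimality passes to [c, d].  The difference of the
    energies on [c, d] is expressed by an antiderivative E of the difference of
    the densities, which keeps integrals out of the later estimates. *)
Lemma local_comparison A beta a b f u u1 u2 : a < b -> L2 a b f -> weak2 a b u u1 u2 ->
  (forall w w1 w2, weak2 a b w w1 w2 ->
     \int[mu]_(x in `]a, b[) density A beta f u u1 u2 x <=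
     \int[mu]_(x in `]a, b[) density A beta f w w1 w2 x) ->
  (forall x, x \in `]a, b[ -> [/\ is_derive x 1 u (u1 x), is_derive x 1 u1 (u2 x),
      continuous_at x u2 & continuous_at x f]) ->
  forall c d w w1 w2 E, a < c -> c < d -> d < b ->
  (forall x, x \in `[c, d] -> [/\ is_derive x 1 w (w1 x), is_derive x 1 w1 (w2 x) &
     continuous_at x w2]) ->
  w c = u c -> w d = u d -> w1 c = u1 c -> w1 d = u1 d ->
  (forall x, x \in `[c, d] -> is_derive x 1 E
     (density A beta f u u1 u2 x - density A beta f w w1 w2 x)) ->
  E d <= E c.
Proof.
move=> ab lf hu umin du c d w w1 w2 E ac cd db dw wc wd w1c w1d dE.
have sub x : x \in `[c, d] -> x \in `]a, b[.
  rewrite !in_itv/= => /andP[cx xd].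
  by rewrite (lt_le_trans ac cx) (le_lt_trans xd db).
pose v x := w x - u x; pose v1 x := w1 x - u1 x; pose v2 x := w2 x - u2 x.
have dv x : x \in `[c, d] -> is_derive x 1 v (v1 x).
  move=> xcd; have [h1 _ _] := dw x xcd; have [h2 _ _ _] := du x (sub x xcd).
  by apply: is_derive_eq; rewrite /v1.
have dv1 x : x \in `[c, d] -> is_derive x 1 v1 (v2 x).
  move=> xcd; have [_ h1 _] := dw x xcd; have [_ h2 _ _] := du x (sub x xcd).
  by apply: is_derive_eq; rewrite /v2.
have cv2 x : x \in `[c, d] -> continuous_at x v2.
  by move=> xcd; have [_ _ h1] := dw x xcd; have [_ _ h2 _] := du x (sub x xcd); exact: contB.
have cv x : x \in `[c, d] -> continuous_at x v by move=> /dv/is_derive_continuous.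
have cv1 x : x \in `[c, d] -> continuous_at x v1 by move=> /dv1/is_derive_continuous.
have hv : weak2 a b (v \_ `[c, d]) (v1 \_ `[c, d]) (v2 \_ `[c, d]).
  split; [exact: L2_cut|exact: L2_cut|exact: L2_cut| |].
    by apply: weak_cut => //; rewrite /v ?wc ?wd subrr.
  by apply: weak_cut => //; rewrite /v1 ?w1c ?w1d subrr.
have hw := weak2D 1 hu hv; have := umin _ _ _ hw.
have [l0 l1 l2 _ _] := hu; have [m0 m1 m2 _ _] := hw.
rewrite -subr_le0 -(RintegralB (mitv _) (density_L1 A beta lf l0 l1 l2)
  (density_L1 A beta lf m0 m1 m2)).
move=> int_le0; rewrite -subr_le0; apply: le_trans int_le0; apply: eq_leR.
have cD x : x \in `[c, d] -> continuous_at x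
    (fun x => density A beta f u u1 u2 x - density A beta f w w1 w2 x).
  move=> xcd; have [h1 h2 h3] := dw x xcd; have [k1 k2 k3 k4] := du x (sub x xcd).
  have e1 := is_derive_continuous h1; have e2 := is_derive_continuous h2.
  have e3 := is_derive_continuous k1; have e4 := is_derive_continuous k2.
  by apply: contB; exact: density_cont.
rewrite -(ftc cd cD dE) -(Rintegral_cut _ ac db); apply: eq_Rintegral => x _.
rewrite /density !patchE; case: ifPn => _; last by rewrite !mulr0 !addr0 subrr.
by rewrite !mul1r /v /v1 /v2 !subrKC.
Qed.

End Comparison.

(** * Total variation and strict convergence *)

Section Variation.
Context {R : realType}.
Notation mu := (@lebesgue_measure R).
Implicit Types (a b c s t x : R) (v : R -> R).

Definition C1oo a b v := exists v1, forall x, x \in `]a, b[ ->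
  is_derive x 1 v (v1 x) /\ continuous_at x v1.

Lemma TV_lower a b v phi : L1 a b v -> C1c a b phi -> (forall x, `|phi x| <= 1) ->
  ((\int[mu]_(x in `]a, b[) (v x * derive1 phi x))%R%:E <= Defs.TV a b v)%E.
Proof.
move=> iv hphi phi1; apply: ereal_sup_ubound; exists phi; first by split.
by rewrite (integral_fineK (mitv _) (L1_C1c iv hphi).2).
Qed.

(** Test the distributional derivative with the bumps increasing to the indicator
    function of ]s, t[, and pass to the limit. *)
Lemma TV_increment a b s t v : L1 a b v -> C1oo a b v -> a < s -> s < t -> t < b ->
  (`|v t - v s|%:E <= Defs.TV a b v)%E.
Proof.
move=> iv [v1 dv] as_ st tb.
have sub x : x \in `[s, t] -> x \in `]a, b[.
  rewrite !in_itv/= => /andP[sx xt].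
  by rewrite (lt_le_trans as_ sx) (le_lt_trans xt tb).
have dv' x : x \in `[s, t] -> is_derive x 1 v (v1 x) by move=> /sub/dv[].
have cv1 x : x \in `[s, t] -> continuous_at x v1 by move=> /sub/dv[].
have cv x : x \in `[s, t] -> continuous_at x v by move=> /dv'/is_derive_continuous.
pose d := v1 \_ `[s, t].
have id : L1 a b d by apply/L2_L1/L2_cut.
have dE : \int[mu]_(x in `]s, t[) d x = v t - v s.
  rewrite -(ftc_oo st cv1 dv'); apply: eq_Rintegral => x; rewrite inE => xst.
  by rewrite /d patchE ifT// inE; exact: subset_itv_oo_cc.
have lim := bump_int_cvg as_ st tb id; rewrite dE in lim.
have bs n : bump n s t s = 0 by apply: bump_eq0 => //; rewrite in_itv/= ltxx.
have bt n : bump n s t t = 0 by apply: bump_eq0 => //; rewrite in_itv/= ltxx andbF.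
have byparts n : \int[mu]_(x in `]a, b[) (v x * derive1 (bump n s t) x) =
    - \int[mu]_(x in `]a, b[) (d x * bump n s t x).
  have hphi := C1c_bump n as_ st tb.
  have dbE : derive1 (bump n s t) = dbump n s t.
    by apply/funext => x; rewrite derive1E; case: (is_derive_bump n s t x).
  rewrite dbE.
  have -> : \int[mu]_(x in `]a, b[) (v x * dbump n s t x) =
      \int[mu]_(x in `[s, t]) (v x * dbump n s t x).
    rewrite -(Rintegral_cut _ as_ tb); apply: eq_Rintegral => x _.
    rewrite patchE; case: ifPn => // xst; rewrite /dbump /dbump_base -[RHS]/0.
    have : x \notin `[s, t] by apply: contra xst; rewrite inE.
    rewrite in_itv/= negb_and -!ltNge => /orP[h|h].
      by rewrite (@pos_0 _ (x - s)) ?subr_le0 ?ltW// expr0n /=; ring.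
    by rewrite (@pos_0 _ (t - x)) ?subr_le0 ?ltW// expr0n /=; ring.
  have -> : \int[mu]_(x in `]a, b[) (d x * bump n s t x) =
      \int[mu]_(x in `[s, t]) (v1 x * bump n s t x).
    rewrite -(Rintegral_cut _ as_ tb); apply: eq_Rintegral => x _.
    by rewrite /d !patchE; case: ifP => // _; rewrite mul0r.
  have c1 x : x \in `[s, t] -> continuous_at x (fun x => v x * dbump n s t x).
    by move=> xst; apply: contM; [exact: cv|exact: dbump_cont].
  have c2 x : x \in `[s, t] -> continuous_at x (fun x => v1 x * bump n s t x).
    by move=> xst; apply: contM; [exact: cv1|exact: bump_cont].
  apply/eqP; rewrite -addr_eq0 -(RintegralD (mitv _) (L1_cc c1) (L1_cc c2)).
  have dF x : x \in `[s, t] -> is_derive x 1 (fun x => v x * bump n s t x)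
      (v x * dbump n s t x + v1 x * bump n s t x).
    move=> /dv' h; have h' := is_derive_bump n s t x.
    by apply: is_derive_eq; rewrite /GRing.scale/=; ring.
  have c3 x : x \in `[s, t] ->
      continuous_at x (fun x => v x * dbump n s t x + v1 x * bump n s t x).
    by move=> xcd; apply: contD; [exact: c1|exact: c2].
  by rewrite (ftc st c3 dF) bs bt !mulr0 subrr.
have le n : (`|\int[mu]_(x in `]a, b[) (d x * bump n s t x)|%:E <= Defs.TV a b v)%E.
  have hphi := C1c_bump n as_ st tb.
  have b1 x : `|bump n s t x| <= 1 by exact: bump_norm_le1.
  have h1 := TV_lower iv hphi b1.
  have db x : is_derive x 1 (fun x => - bump n s t x) (- dbump n s t x).
    by have h := is_derive_bump n s t x; exact: is_derive_eq.
  have hphi' : C1c a b (fun x => - bump n s t x).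
    apply: (C1c_intro as_ tb db); first by move=> x; apply: continuousN; exact: dbump_cont.
    move=> x xst; rewrite bump_eq0 ?oppr0//; apply: contra xst.
    by rewrite !in_itv/= => /andP[/ltW-> /ltW->].
  have b2 x : `|- bump n s t x| <= 1 by rewrite normrN.
  have := TV_lower iv hphi' b2.
  have -> : derive1 (fun x => - bump n s t x) = (fun x => - derive1 (bump n s t) x).
    apply/funext => x; rewrite !derive1E; case: (db x) => _ ->.
    by case: (is_derive_bump n s t x) => _ ->.
  under eq_Rintegral do rewrite mulrN -mulN1r.
  rewrite (RintegralZl _ (mitv _) (L1_C1c iv hphi).2) mulN1r byparts opprK => h2.
  rewrite byparts in h1.
  by have [_|_] := ger0P (\int[mu]_(x in `]a, b[) (d x * bump n s t x)).
have nlim := cvg_norm lim _; case: (Defs.TV a b v) le => [r|_|/(_ 0%N)//].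
  move=> le; rewrite lee_fin -(cvg_lim (@Rhausdorff R) (nlim _)).
  apply: limr_le; first exact: (cvgP _ (nlim _)).
  by apply: nearW => n; rewrite -lee_fin.
exact: leey.
Qed.

Lemma TV_cst a b c v : a < b -> (forall x, x \in `]a, b[ -> v x = c) -> Defs.TV a b v = 0%E.
Proof.
move=> ab vc; rewrite /Defs.TV.
rewrite (_ : [set _ | _ in _] = [set 0%E]) ?ereal_sup1//.
have E phi : C1c a b phi -> (\int[mu]_(x in `]a, b[) (v x * derive1 phi x)%:E = 0)%E.
  move=> hphi; have [dphi cphi _ _] := hphi.
  have dF x : x \in `[a, b] -> is_derive x 1 (fun x => c * phi x) (c * derive1 phi x).
    move=> _; have h : is_derive x 1 phi (derive1 phi x) by split => //; rewrite derive1E.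
    by apply: is_derive_eq.
  have cF x : x \in `[a, b] -> continuous_at x (fun x => c * derive1 phi x).
    by move=> _; apply: contM; [exact: cont_cst|exact: cphi].
  have := ftc_oo ab cF dF.
  rewrite !(C1c_eq0 hphi) ?in_itv/= ?ltxx ?andbF// mulr0 subrr => h.
  transitivity (\int[mu]_(x in `]a, b[) (c * derive1 phi x)%:E)%E.
    by apply: eq_integral => x; rewrite inE/= => /vc ->.
  by rewrite (integral_fineK (mitv _) (L1_cont cF)) h.
apply/seteqP; split => [_ [phi [hphi _] <-]|_ ->]; first exact: E.
have h0 : C1c a b (cst 0).
  have d0 x : is_derive x 1 (cst (0 : R)) (cst (0 : R) x) by exact: is_derive_cst.
  have as_ : a < (a + b) / 2 by lra.
  have tb : (a + b) / 2 < b by lra.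
  by apply: (C1c_intro as_ tb d0) => //; exact: cst_continuous.
by exists (cst 0); [split => // x; rewrite normr0|exact: E].
Qed.

Lemma TV_ge0 a b v : a < b -> (0 <= Defs.TV a b v)%E.
Proof.
move=> ab; apply: ereal_sup_ubound; exists (cst 0); first split.
- have d0 x : is_derive x 1 (cst (0 : R)) (cst (0 : R) x) by exact: is_derive_cst.
  have as_ : a < (a + b) / 2 by lra.
  have tb : (a + b) / 2 < b by lra.
  by apply: (C1c_intro as_ tb d0) => //; exact: cst_continuous.
- by move=> x; rewrite normr0.
- transitivity (\int[mu]_(x in `]a, b[) (0 : \bar R))%E; last exact: integral0.
  by apply: eq_integral => x _; rewrite derive1E derive_cst mulr0.
Qed.

Lemma near_increment a b (v : R -> R -> R) (l K : R) : l < K ->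
  (\forall e \near 0^'+, L1 a b (v e)) -> (\forall e \near 0^'+, C1oo a b (v e)) ->
  Defs.TV a b (v e) @[e --> 0^'+] --> l%:E ->
  \forall e \near 0^'+, forall s t, s \in `]a, b[ -> t \in `]a, b[ -> `|v e t - v e s| <= K.
Proof.
move=> lK iv cv /fine_cvgP[fin lim]; near=> e.
have iv' : L1 a b (v e) by near: e.
have cv' : C1oo a b (v e) by near: e.
have TVK : (Defs.TV a b (v e) <= K%:E)%E.
  have f' : Defs.TV a b (v e) \is a fin_num by near: e.
  by rewrite -(fineK f') lee_fin ltW//; near: e; exact: (cvgr_lt l).
have inc s t : s \in `]a, b[ -> t \in `]a, b[ -> s < t -> `|v e t - v e s| <= K.
  rewrite !in_itv/= => /andP[as_ _] /andP[_ tb] st.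
  by rewrite -lee_fin; apply: le_trans TVK; exact: TV_increment.
move=> s t sI tI; have [st|ts|->] := ltgtP s t; first exact: inc.
  by rewrite distrC; exact: inc.
rewrite subrr normr0 -lee_fin; apply: le_trans TVK; apply: TV_ge0.
by move: tI; rewrite in_itv/= => /andP[]; exact: lt_trans.
Unshelve. all: by end_near. Qed.

Lemma strict_cvg_bounded_increment a b (v : R -> R -> R) (v0 : R -> R) : a < b ->
  strict_cvg a b v v0 -> (\forall e \near 0^'+, C1oo a b (v e)) ->
  exists K, \forall e \near 0^'+, forall s t, s \in `]a, b[ -> t \in `]a, b[ ->
    `|v e t - v e s| <= K.
Proof.
move=> ab [bv bv0 _ lim] cv.
have f0 : Defs.TV a b v0 \is a fin_num by rewrite ge0_fin_numE ?TV_ge0//; case: bv0.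
exists (fine (Defs.TV a b v0) + 1).
have lK : fine (Defs.TV a b v0) < fine (Defs.TV a b v0) + 1 by rewrite ltrDl.
apply: (near_increment lK _ cv); first by apply: filterS bv => e [].
by rewrite fineK.
Qed.

(** On an interval where the limit is constant its variation is zero, hence the
    oscillation of v_e tends to zero there; a uniformly nonzero distance to the
    constant would then contradict the convergence in L^1. *)
Lemma strict_cvg_uniform a b c eta (v : R -> R -> R) (v0 : R -> R) : a < b ->
  strict_cvg a b v v0 -> (\forall e \near 0^'+, C1oo a b (v e)) ->
  (forall y, y \in `]a, b[ -> v0 y = c) -> 0 < eta ->
  \forall e \near 0^'+, forall y, y \in `]a, b[ -> `|v e y - c| <= eta.
Proof.
move=> ab [bv bv0 /fine_cvgP[fin limL1] lim] cv v0c eta0.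
have iv : \forall e \near 0^'+, L1 a b (v e) by apply: filterS bv => e [].
rewrite (TV_cst ab v0c) in lim.
have eta2 : 0 < eta / 2 by rewrite divr_gt0.
have inc := near_increment eta2 iv cv lim.
have ba : 0 < b - a by rewrite subr_gt0.
near=> e => y yab; rewrite leNgt; apply/negP => big.
have inc' : forall s t, s \in `]a, b[ -> t \in `]a, b[ -> `|v e t - v e s| <= eta / 2.
  by near: e.
have low z : z \in `]a, b[ -> eta / 2 <= `|v e z - v0 z|.
  move=> zab; rewrite v0c//; have := inc' z y zab yab; have := ler_distD (v e z) (v e y) c.
  lra.
have iv' : L1 a b (v e) by near: e.
have f' : (\int[mu]_(y in `]a, b[) (`|v e y - v0 y|)%:E)%E \is a fin_num by near: e.
have : fine (\int[mu]_(y in `]a, b[) (`|v e y - v0 y|)%:E)%E < (eta / 2) * (b - a).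
  near: e; apply: (cvgr_lt _ limL1); exact: mulr_gt0.
apply/negP; rewrite -leNgt -lee_fin fineK//.
have -> : ((eta / 2 * (b - a))%:E = \int[mu]_(x in `]a, b[) (eta / 2)%:E)%E.
  by rewrite integral_cst//= lebesgue_measure_itv/= lte_fin ab EFinM.
apply: ge0_le_integral => //=.
- by move=> x _; rewrite lee_fin ltW.
- apply/measurable_EFinP; apply: measurableT_comp => //; apply: measurable_funB.
    exact: L1_measurable iv'.
  exact: L1_measurable bv0.1.
Unshelve. all: by end_near. Qed.

End Variation.

(** * Mean values and maximum principles *)

Section RealFunctions.
Context {R : realType}.
Implicit Types (a b c x y : R) (f F z : R -> R).

Lemma mvt f (df : R -> R) a b : a < b -> (forall x, x \in `[a, b] -> is_derive x 1 f (df x)) ->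
  exists2 c, c \in `]a, b[ & f b - f a = df c * (b - a).
Proof.
move=> ab dfE.
have h1 x : x \in `]a, b[ -> is_derive x 1 f (df x).
  by move=> h; apply: dfE; exact: subset_itv_oo_cc.
have h2 : {within `[a, b], continuous f}.
  by apply: within_cont => x h; exact: (is_derive_continuous (dfE x h)).
exact: (@MVT R f df a b ab h1 h2).
Qed.

Lemma mvt_le f (df : R -> R) a b (k : R) : a <= b -> (forall x, x \in `[a, b] -> is_derive x 1 f (df x)) ->
  (forall x, x \in `[a, b] -> df x <= k) -> f b - f a <= k * (b - a).
Proof.
rewrite le_eqVlt => /predU1P[->|ab] dfE dk; first by rewrite !subrr mulr0.
have [c /subset_itv_oo_cc/dk dc ->] := mvt ab dfE.
by apply: ler_wpM2r => //; rewrite subr_ge0 ltW.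
Qed.

Lemma mvt_ge f (df : R -> R) a b (k : R) : a <= b -> (forall x, x \in `[a, b] -> is_derive x 1 f (df x)) ->
  (forall x, x \in `[a, b] -> k <= df x) -> k * (b - a) <= f b - f a.
Proof.
rewrite le_eqVlt => /predU1P[->|ab] dfE dk; first by rewrite !subrr mulr0.
have [c /subset_itv_oo_cc/dk dc ->] := mvt ab dfE.
by apply: ler_wpM2r => //; rewrite subr_ge0 ltW.
Qed.

Lemma mvt_norm f (df : R -> R) a b (k : R) : a <= b -> (forall x, x \in `[a, b] -> is_derive x 1 f (df x)) ->
  (forall x, x \in `[a, b] -> `|df x| <= k) -> `|f b - f a| <= k * (b - a).
Proof.
move=> ab dfE dk; rewrite ler_norml -mulNr; apply/andP; split.
  by apply: (mvt_ge ab dfE) => x /dk; rewrite ler_norml => /andP[].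
by apply: (mvt_le ab dfE) => x /dk; rewrite ler_norml => /andP[].
Qed.

Lemma interior_max F (dF : R -> R) (ddF : R) a b c : c \in `]a, b[ ->
  (forall x, x \in `]a, b[ -> is_derive x 1 F (dF x)) -> is_derive c 1 dF ddF ->
  (forall x, x \in `]a, b[ -> F x <= F c) -> dF c = 0 /\ ddF <= 0.
Proof.
move=> cab dFE ddFE Fmax.
have ab : a < b by move: cab; rewrite in_itv/= => /andP[/lt_trans]; exact.
have dF0 : dF c = 0.
  have dF' t : t \in `]a, b[ -> derivable F t 1 by move=> /dFE[].
  have [_ <-] := derive1_at_max (ltW ab) dF' cab Fmax.
  by case: (dFE c cab).
split=> //; rewrite leNgt; apply/negP => dd0.
move/is_derive1_caratheodory : ddFE => [g [gE cg gc]].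
have : \forall y \near c, 0 < g y /\ y \in `]a, b[.
  near=> y; split; last by near: y; exact: near_in_itvoo.
  by near: y; apply: (cvgr_gt _ cg); rewrite gc.
move=> /nbhs_ballP[e /= e0 he].
pose y := c + e / 2.
have e2 : 0 < e / 2 by rewrite divr_gt0.
have sub x : x \in `[c, y] -> 0 < g x /\ x \in `]a, b[.
  rewrite in_itv/= => /andP[cx xy]; apply: he; rewrite /ball/= distrC ger0_norm ?subr_ge0//.
  by move: xy; rewrite /y; lra.
have cy : c < y by rewrite /y ltrDl.
have [d + E] := mvt cy (fun x h => dFE x (sub x h).2).
rewrite in_itv/= => /andP[cd dy].
have [gd0 _] : 0 < g d /\ d \in `]a, b[ by apply: sub; rewrite in_itv/= !ltW.
have yab : y \in `]a, b[ by have [] := sub y; rewrite ?in_itv/= ?lexx ?ltW.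
have := Fmax y yab; rewrite -subr_le0 E leNgt => /negP; apply.
apply: mulr_gt0; last by rewrite subr_gt0.
by have := gE d; rewrite dF0 subr0 => ->; rewrite mulr_gt0// subr_gt0.
Unshelve. all: by end_near. Qed.

(** The supremum of the points up to which f is nonnegative. *)
Lemma first_zero f a b : a <= b -> (forall x, x \in `[a, b] -> continuous_at x f) ->
  0 < f a -> f b <= 0 ->
  exists c, [/\ c \in `[a, b], f c = 0 & forall x, x \in `[a, c] -> 0 <= f x].
Proof.
move=> ab cf fa fb.
pose S := [set x | x \in `[a, b] /\ forall y, y \in `[a, x] -> 0 <= f y].
have Sa : S a.
  split; first by rewrite in_itv/= lexx.
  by move=> y; rewrite in_itv/= => /le_anti <-; exact: ltW.
have hS : has_sup S.
  by split; [exists a|exists b => x [+ _]; rewrite in_itv/= => /andP[]].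
pose c := sup S.
have ac : a <= c by apply: ub_le_sup => //; case: hS.
have cb : c <= b by apply: ge_sup => [|x [+ _]]; [exists a|rewrite in_itv/= => /andP[]].
have cab : c \in `[a, b] by rewrite in_itv/= ac.
have below x : a <= x -> x < c -> 0 <= f x.
  move=> ax xc; have [s [_ hs] xs] : exists2 s, S s & x < s.
    by have := sup_adherent (eps := c - x) (E := S); rewrite subr_gt0 => /(_ xc hS)[s Ss]; rewrite subKr; exists s.
  by apply: hs; rewrite in_itv/= ax ltW.
have fc_ge0 : 0 <= f c.
  rewrite leNgt; apply/negP => fc0.
  have : \forall y \near c, f y < 0 by apply: (cvgr_lt _ (cf c cab)).
  have ac' : a < c by rewrite lt_neqAle ac andbT; apply/eqP => e; move: fc0; rewrite -e; lra.
  move=> /nbhs_ballP[e /= e0 he].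
  pose y := Num.max a (c - e / 2).
  have yc : y < c by rewrite gt_max ac'/= ltrBlDr ltrDl divr_gt0.
  have ay : a <= y by rewrite le_max lexx.
  have := he y; rewrite /ball/= ger0_norm ?subr_ge0 ?(ltW yc)// => /(_ _).
  have ye : c - y < e.
    have : c - e / 2 <= y by rewrite le_max lexx orbT.
    lra.
  by move=> /(_ ye); rewrite ltNge below.
have fc_le0 : f c <= 0.
  rewrite leNgt; apply/negP => fc0.
  have cb' : c < b by rewrite lt_neqAle cb andbT; apply/eqP => e; move: fc0; rewrite e; lra.
  have : \forall y \near c, 0 < f y by apply: (cvgr_gt _ (cf c cab)).
  move=> /nbhs_ballP[e /= e0 he].
  pose y := Num.min b (c + e / 2).
  have cy : c < y by rewrite lt_min cb'/= ltrDl divr_gt0.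
  have : S y.
    split; first by rewrite in_itv/= (le_trans ac (ltW cy)) ge_min lexx.
    move=> x; rewrite in_itv/= => /andP[ax xy].
    have [xc|cx] := ltP x c; first exact: below.
    apply: ltW; apply: he; rewrite /ball/= distrC ger0_norm ?subr_ge0//.
    have : y <= c + e / 2 by rewrite ge_min lexx orbT.
    lra.
  move=> /(ub_le_sup hS.2); rewrite leNgt => /negP; exact.
have fc : f c = 0 by apply/eqP; rewrite eq_le fc_le0 fc_ge0.
exists c; split => // x; rewrite in_itv/= => /andP[ax]; rewrite le_eqVlt => /predU1P[->//|].
exact: below.
Unshelve. all: by end_near. Qed.

Lemma evt_max F a b : a <= b -> (forall x, x \in `[a, b] -> continuous_at x F) ->
  exists2 c, c \in `[a, b] & forall x, x \in `[a, b] -> F x <= F c.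
Proof. by move=> ab cF; apply: EVT_max => //; exact: within_cont. Qed.

(** The parabola c0 + Z (s - y)^2 / rho^2 lies above z at both ends of the interval.
    If z(y) > c0, then z minus the parabola has a positive interior maximum,
    where the equation k2 z'' = theta z + e contradicts z'' <= 2 Z / rho^2. *)
Lemma barrier_upper (z dz ddz theta e : R -> R) (k2 y rho Z E : R) : 0 < k2 -> 0 < rho -> 0 <= E ->
  (forall s : R, s \in `[y - rho, y + rho] -> [/\ is_derive s 1 z (dz s), is_derive s 1 dz (ddz s),
     k2 * ddz s = theta s * z s + e s, 1 / 2 <= theta s & `|e s| <= E] /\ `|z s| <= Z) ->
  z y <= 2 * E + 4 * Z * k2 / rho ^+ 2.
Proof.
move=> k20 rho0 E0 H; rewrite leNgt; apply/negP => big.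
have r2 : 0 < rho ^+ 2 by rewrite exprn_gt0.
have yI : y \in `[y - rho, y + rho] by rewrite in_itv/=; apply/andP; split; lra.
have Z0 : 0 <= Z by have [_] := H y yI; exact: le_trans.
set c0 := 2 * E + _ in big.
have c00 : 0 <= c0.
  apply: addr_ge0; first lra.
  by apply: divr_ge0; [apply: mulr_ge0; lra|exact: ltW].
pose B s := c0 + Z / rho ^+ 2 * (s - y) ^+ 2.
pose D s := z s - B s.
pose dD s := dz s - Z / rho ^+ 2 * (2 * (s - y)).
have dB (s : R) : is_derive s 1 B (Z / rho ^+ 2 * (2 * (s - y))).
  have h : is_derive s 1 (fun s : R => s - y) 1 by apply: is_derive_eq; rewrite subr0.
  have h2 := is_derive_pow 2 h.
  by rewrite /B; apply: is_derive_eq; rewrite /GRing.scale/=; ring.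
have dDE (s : R) : s \in `[y - rho, y + rho] -> is_derive s 1 D (dD s).
  by move=> /H[[h _ _ _ _] _]; have h' := dB s; apply: is_derive_eq.
have [c cI Dmax] := @evt_max D (y - rho) (y + rho) ltac:(lra)
  (fun x h => is_derive_continuous (dDE x h)).
have Dc : 0 < D c.
  apply: lt_le_trans (Dmax y yI); rewrite /D /B subrr expr0n mulr0 addr0; lra.
have [[zc dzc eqc th ec] Zc] := H c cI.
have zcB : B c < z c by move: Dc; rewrite /D subr_gt0.
have cin : c \in `](y - rho), (y + rho)[.
  move: cI; rewrite !in_itv/= => /andP[]; rewrite le_eqVlt => /predU1P[e1|->].
    move=> _; exfalso; move: zcB; rewrite /B -e1 (_ : (y - rho - y) ^+ 2 = rho ^+ 2); last by ring.
    rewrite divfK ?gt_eqF//; have := ler_norm (z (y - rho)); rewrite e1; lra.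
  rewrite le_eqVlt => /predU1P[e2|->] //; exfalso; move: zcB; rewrite /B e2 (_ : (y + rho - y) ^+ 2 = rho ^+ 2); last by ring.
    rewrite divfK ?gt_eqF//; have := ler_norm (z (y + rho)); rewrite -e2; lra.
have ddD : is_derive c 1 dD (ddz c - Z / rho ^+ 2 * 2).
  have h : is_derive c 1 (fun s : R => s - y) 1 by apply: is_derive_eq; rewrite subr0.
  by rewrite /dD; apply: is_derive_eq; rewrite /GRing.scale/=; ring.
have [_ le0] := interior_max cin (fun x h => dDE x (subset_itv_oo_cc h)) ddD
  (fun x h => Dmax x (subset_itv_oo_cc h)).
have ec' : - E <= e c by move: ec; rewrite ler_norml => /andP[].
have Bc : c0 <= B c by rewrite /B lerDl mulr_ge0 ?sqr_ge0// divr_ge0// ltW.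
have zc0 : 0 < z c by lra.
have h1 : z c / 2 <= theta c * z c by rewrite mulrC ler_pM2r//; lra.
have h2 : k2 * ddz c <= k2 * (Z / rho ^+ 2 * 2) by rewrite ler_pM2l//; lra.
have e4 : c0 = 2 * E + 2 * (k2 * (Z / rho ^+ 2 * 2)) by rewrite /c0; ring.
lra.
Qed.

(** In a singularly perturbed linear equation |z| has the size of the right-hand
    side at distance rho from the boundary, up to the boundary values multiplied
    by k2 / rho^2. *)
Lemma barrier (z dz ddz theta e : R -> R) (k2 y rho Z E : R) : 0 < k2 -> 0 < rho -> 0 <= E ->
  (forall s : R, s \in `[y - rho, y + rho] -> [/\ is_derive s 1 z (dz s), is_derive s 1 dz (ddz s),
     k2 * ddz s = theta s * z s + e s, 1 / 2 <= theta s & `|e s| <= E] /\ `|z s| <= Z) ->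
  `|z y| <= 2 * E + 4 * Z * k2 / rho ^+ 2.
Proof.
move=> k20 rho0 E0 H; rewrite ler_norml lerNl; apply/andP; split; last exact: barrier_upper H.
apply: (@barrier_upper (fun s => - z s) (fun s => - dz s) (fun s => - ddz s) theta
  (fun s => - e s)) => // s /H[[h1 h2 h3 h4 h5] h6]; split; last by rewrite normrN.
split; [exact: is_deriveN|exact: is_deriveN| |exact: h4|by rewrite normrN].
by rewrite mulrN h3; ring.
Qed.

End RealFunctions.

(** * The Hamiltonian and the exclusion of spikes *)

Section Plateau.
Context {R : realType}.
Implicit Types (a b c y K L : R).

Lemma itv_ccI a b y : a <= y -> y <= b -> y \in `[a, b].
Proof. by move=> h1 h2; rewrite in_itv/= h1. Qed.

Lemma sub_itv_cc a b (c d : R) y : a <= c -> d <= b -> y \in `[c, d] -> y \in `[a, b].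
Proof.
rewrite !in_itv/= => ac db /andP[cy yd].
by rewrite (le_trans ac cy) (le_trans yd db).
Qed.

(** The Euler-Lagrange equation of the blow-up as a first order system, with
    q = v', r = v'' and the multiplier p; g is the blown-up datum. *)
Definition ode (k2 bw : R) (v q r p g g1 : R -> R) (y : R) : Prop :=
  [/\ is_derive y 1 v (q y), is_derive y 1 q (r y),
      is_derive y 1 r ((q y / (1 + q y ^+ 2) + p y) / k2),
      is_derive y 1 p (- (bw * (v y - g y))) & is_derive y 1 g (g1 y)].

(** The conserved quantity of the autonomous system: its derivative only sees the
    variation g' of the datum. *)
Definition ham (k2 bw : R) (v q r p g : R -> R) (y : R) : R :=
  2 * (q y * p y) - k2 * r y ^+ 2 + ln (1 + q y ^+ 2) + bw * (v y - g y) ^+ 2.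

Lemma is_derive_ln1Dsqr (q : R -> R) (y d : R) : is_derive y 1 q d ->
  is_derive y 1 (fun y => ln (1 + q y ^+ 2)) (2 * q y * d / (1 + q y ^+ 2)).
Proof.
move=> h; have h2 := is_derive_pow 2 h.
have h3 : is_derive y 1 (fun y => 1 + q y ^+ 2) (2 * q y * d).
  by apply: is_derive_eq; rewrite add0r /=; ring.
have hl := @is_derive1_ln R _ (den_gt0 (q y)).
have := @is_derive1_comp _ _ (fun y => 1 + q y ^+ 2) y _ _ hl h3.
by rewrite mulrC.
Qed.

Lemma ham_derive k2 bw v q r p g g1 y : k2 != 0 -> ode k2 bw v q r p g g1 y ->
  is_derive y 1 (ham k2 bw v q r p g) (- (2 * bw * (v y - g y) * g1 y)).
Proof.
move=> k20 [dv dq dr dp dg]; have h1 := is_derive_ln1Dsqr dq.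
have h2 := is_derive_pow 2 dr.
have h3 : is_derive y 1 (fun y => v y - g y) (q y - g1 y) by exact: is_deriveB.
have h4 := is_derive_pow 2 h3.
rewrite /ham; apply: is_derive_eq; rewrite /GRing.scale/=; field.
by rewrite k20 gt_eqF ?den_gt0.
Qed.

(** The system is odd, so one-sided estimates give two-sided ones. *)
Lemma odeN k2 bw v q r p g g1 y : ode k2 bw v q r p g g1 y ->
  ode k2 bw (fun y => - v y) (fun y => - q y) (fun y => - r y) (fun y => - p y)
    (fun y => - g y) (fun y => - g1 y) y.
Proof.
move=> [dv dq dr dp dg]; split.
- exact: is_deriveN.
- exact: is_deriveN.
- have h := is_deriveN dr; apply: is_derive_eq; rewrite sqrrN mulNr -opprD mulNr; ring.
- have h := is_deriveN dp; apply: is_derive_eq; ring.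
- exact: is_deriveN.
Qed.

Lemma small_slope_point (v q : R -> R) a b (k : R) : a < b ->
  (forall y, y \in `[a, b] -> is_derive y 1 v (q y)) -> `|v b - v a| <= k * (b - a) ->
  exists2 c, c \in `]a, b[ & `|q c| <= k.
Proof.
move=> ab dv; have [c cab ->] := @mvt R v q a b ab dv => qk; exists c => //; move: qk.
by rewrite normrM (gtr0_norm (_ : 0 < b - a)) ?subr_gt0// ler_pM2r// subr_gt0.
Qed.

(** A slope Q that balances ln(1 + Q^2) against 2 Q P must be very large when P
    is small, because the logarithm is unbounded. *)
Lemma peak_height (Q P e : R) : 0 < P -> 0 < Q -> 1 <= 2 * Q * P ->
  ln (1 + Q ^+ 2) <= 2 * (Q * P) + e -> - ln (2 * P) - e / 2 <= Q * P.
Proof.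
move=> P0 Q0 QP H; have P2 : 0 < 2 * P by lra.
have lnQ : 2 * ln Q <= ln (1 + Q ^+ 2).
  have -> : 2 * ln Q = ln (Q ^+ 2) by rewrite lnXn ?mulr_natl.
  by rewrite ler_ln ?posrE ?exprn_gt0 ?den_gt0 ?lerDr.
have lnQ2 : - ln (2 * P) <= ln Q.
  rewrite -lnV ?posrE// ler_ln ?posrE ?invr_gt0//.
  rewrite -[_^-1]mul1r ler_pdivrMr//; lra.
lra.
Qed.

(** As long as q stays positive the equation gives r' >= - P/k2, so q cannot drop
    below one half of its maximum on an interval of length s. *)
Lemma peak_persists k2 (q r p : R -> R) (a s P : R) : 0 < k2 -> 0 < P -> 0 < s ->
  (forall y, y \in `[a, a + s] -> [/\ is_derive y 1 q (r y),
     is_derive y 1 r ((q y / (1 + q y ^+ 2) + p y) / k2) & `|p y| <= P]) ->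
  r a = 0 -> P / k2 * s ^+ 2 < q a / 2 ->
  forall y, y \in `[a, a + s] -> q a / 2 <= q y.
Proof.
move=> k20 P0 s0 H ra0 small y yI; rewrite leNgt; apply/negP => qy.
have [ay yas] : a <= y /\ y <= a + s by move: yI; rewrite in_itv/= => /andP[].
have Pk : 0 < P / k2 by rewrite divr_gt0.
have qa0 : 0 < q a / 2.
  by apply: le_lt_trans small; rewrite mulr_ge0 ?sqr_ge0// ltW.
have cq x : x \in `[a, y] -> continuous_at x (fun y => q y - q a / 2).
  move=> xI; apply: contB; last exact: cont_cst.
  by have [h _ _] := H x (sub_itv_cc (lexx a) yas xI); exact: (is_derive_continuous h).
have f1 : 0 < q a - q a / 2 by lra.
have f2 : q y - q a / 2 <= 0 by rewrite subr_le0 ltW.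
have [z [zI qz qpos]] := @first_zero R (fun y => q y - q a / 2) a y ay cq f1 f2.
have [az zy] : a <= z /\ z <= y by move: zI; rewrite in_itv/= => /andP[].
have zas := le_trans zy yas.
have rlow x : x \in `[a, z] -> - (P / k2 * s) <= r x.
  rewrite in_itv/= => /andP[ax xz].
  have sub3 t (h : t \in `[a, x]) := sub_itv_cc (lexx a) (le_trans xz zas) h.
  have dr t : t \in `[a, x] -> is_derive t 1 r ((q t / (1 + q t ^+ 2) + p t) / k2).
    by move=> h; have [_ h' _] := H t (sub3 t h).
  have drlow t : t \in `[a, x] -> - (P / k2) <= (q t / (1 + q t ^+ 2) + p t) / k2.
    move=> tI; have qt : 0 <= q t.
      have h := qpos t (sub_itv_cc (lexx a) xz tI).
      by apply: le_trans (ltW qa0) _; rewrite -subr_ge0.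
    have [_ _ pt] := H t (sub3 t tI).
    rewrite -mulNr ler_pM2r ?invr_gt0//.
    have := divr_ge0 qt (ltW (den_gt0 (q t))).
    by move: pt; rewrite ler_norml => /andP[p1 _] h; rewrite -[- P]add0r lerD.
  have := @mvt_ge R r _ a x (- (P / k2)) ax dr drlow.
  rewrite ra0 subr0; apply: le_trans; rewrite mulNr lerN2.
  by apply: ler_wpM2l; [exact: ltW|rewrite lerBlDl (le_trans xz)].
have dqz t : t \in `[a, z] -> is_derive t 1 q (r t).
  by move=> h; have [h' _ _] := H t (sub_itv_cc (lexx a) zas h).
have := @mvt_ge R q r a z (- (P / k2 * s)) az dqz rlow.
have : P / k2 * s * (z - a) <= P / k2 * s ^+ 2.
  rewrite expr2 mulrA; apply: ler_wpM2l; last by rewrite lerBlDl.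
  by rewrite mulr_ge0// ltW.
move: qz small; clear; lra.
Qed.

(** If q > 1 somewhere, take a maximum point of q between two points with slope at
    most 1/4, which exist because v oscillates little.  There r = 0 and r' <= 0,
    so Q/(1 + Q^2) <= P: as Q > 1 the slope is at least of order 1/P.  The
    Hamiltonian at the maximum, compared with its value at a point of small
    slope, improves this to Q P >= - ln(2P) - 1.  Such a slope persists over the
    length s0 and makes v rise by more than its oscillation eta. *)
Lemma no_positive_spike k2 bw v q r p g g1 (lo hi y1 eta P s0 : R) : 0 < k2 -> 0 < P -> P <= 1 / 4 ->
  0 < eta -> eta <= 1 / 8 -> 0 < s0 ->
  (forall y, y \in `[lo, hi] -> ode k2 bw v q r p g g1 y) ->
  (forall y, y \in `[lo, hi] -> [/\ `|p y| <= P, 0 <= bw * (v y - g y) ^+ 2 <= P &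
     `|2 * bw * (v y - g y) * g1 y| <= P]) ->
  (forall s t, s \in `[lo, hi] -> t \in `[lo, hi] -> `|v t - v s| <= eta) ->
  lo + 4 * eta <= y1 -> y1 + 4 * eta + s0 <= hi ->
  0 < - ln (2 * P) - 1 -> 2 * s0 ^+ 2 * P ^+ 2 < (- ln (2 * P) - 1) * k2 ->
  eta < s0 * (- ln (2 * P) - 1) / (2 * P) ->
  q y1 <= 1.
Proof.
move=> k20 P0 P4 eta0 eta8 s00 hode hP hosc lo1 hi1; set Lam := _ - 1 => Lam0 hs0 hbig.
rewrite leNgt; apply/negP => q1.
have dv y (h : y \in `[lo, hi]) : is_derive y 1 v (q y) by case: (hode y h).
have dq y (h : y \in `[lo, hi]) : is_derive y 1 q (r y) by case: (hode y h).
have slope a : lo <= a -> a + 4 * eta <= hi ->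
    exists2 c, c \in `]a, (a + 4 * eta)[ & `|q c| <= 1 / 4.
  move=> loa ahi; have aa : a < a + 4 * eta by rewrite ltrDl mulr_gt0.
  have dva y : y \in `[a, (a + 4 * eta)] -> is_derive y 1 v (q y).
    by move=> yI; exact: (dv y (sub_itv_cc loa ahi yI)).
  have inc : `|v (a + 4 * eta) - v a| <= 1 / 4 * (a + 4 * eta - a).
    rewrite (_ : 1 / 4 * _ = eta); last by field.
    by apply: hosc; apply: itv_ccI => //; [apply: le_trans ahi|apply: le_trans loa _]; exact: ltW.
  exact: (@small_slope_point v q a (a + 4 * eta) (1 / 4) aa dva inc).
have [c c_in qc4] : exists2 c, c \in `](y1 - 4 * eta), (y1 - 4 * eta + 4 * eta)[ & `|q c| <= 1 / 4.
  by apply: slope; lra.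
have [d d_in qd4] : exists2 d, d \in `]y1, (y1 + 4 * eta)[ & `|q d| <= 1 / 4.
  by apply: slope; lra.
move: c_in d_in; rewrite subrK !in_itv/= => /andP[c1 c2] /andP[d1 d2].
have loc : lo <= c by lra.
have dhi : d + s0 <= hi by lra.
have dc1 : d - c <= 1 by lra.
have cd : c <= d by lra.
clear slope lo1 hi1 eta8 eta0 d2 c1.
have dhi' : d <= hi by apply: le_trans dhi; rewrite lerDl ltW.
have sub y (h : y \in `[c, d]) : y \in `[lo, hi] := sub_itv_cc loc dhi' h.
have cqcd y : y \in `[c, d] -> continuous_at y q.
  by move=> h; exact: (is_derive_continuous (dq y (sub y h))).
have [ym ym_in qmax] := @evt_max R q c d cd cqcd.
set Q := q ym in qmax.
have Q1 : 1 < Q by apply: lt_le_trans q1 _; apply: qmax; apply: itv_ccI; exact: ltW.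
have [cym ymd] : c <= ym /\ ym <= d by move: ym_in; rewrite in_itv/= => /andP[].
have ym_oo : ym \in `]c, d[.
  rewrite in_itv/= !lt_neqAle cym ymd !andbT; apply/andP; split; apply/eqP => e.
    by move: Q1; rewrite /Q -e; move: (le_trans (ler_norm _) qc4); clear; lra.
  by move: Q1; rewrite /Q e; move: (le_trans (ler_norm _) qd4); clear; lra.
have ym_lohi := sub ym ym_in.
have dqcd y : y \in `]c, d[ -> is_derive y 1 q (r y).
  by move=> h; exact: (dq y (sub y (subset_itv_oo_cc h))).
have qmax' y : y \in `]c, d[ -> q y <= q ym.
  by move=> h; exact: (qmax y (subset_itv_oo_cc h)).
have drm : is_derive ym 1 r ((q ym / (1 + q ym ^+ 2) + p ym) / k2).
  by case: (hode ym ym_lohi).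
have [rm0 rm1] := @interior_max R q r _ c d ym ym_oo dqcd drm qmax'.
have [pm /andP[km _] _] := hP ym ym_lohi.
have pm' : - P <= p ym by move: pm; rewrite ler_norml => /andP[].
have QP : 1 <= 2 * Q * P.
  have h1 : Q / (1 + Q ^+ 2) <= P.
    move: rm1; rewrite pmulr_lle0 ?invr_gt0// -/Q; move: pm'; clear; lra.
  move: h1; rewrite ler_pdivrMr ?den_gt0//; move: Q1 P0; clear; nra.
have c_lohi : c \in `[lo, hi] by apply: itv_ccI => //; exact: le_trans dhi'.
have subcm y (h : y \in `[c, ym]) := sub y (sub_itv_cc (lexx c) ymd h).
have dham y : y \in `[c, ym] ->
    is_derive y 1 (ham k2 bw v q r p g) (- (2 * bw * (v y - g y) * g1 y)).
  move=> /subcm h; exact: (ham_derive (lt0r_neq0 k20) (hode y h)).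
have dhamP y : y \in `[c, ym] -> - (2 * bw * (v y - g y) * g1 y) <= P.
  by move=> /subcm h; have [_ _] := hP y h; rewrite -normrN; exact: le_trans (ler_norm _).
have hamle := @mvt_le R (ham k2 bw v q r p g) _ c ym P cym dham dhamP.
have [pc /andP[_ kc] _] := hP c c_lohi.
have lnc : ln (1 + q c ^+ 2) <= 1 / 16.
  apply: le_trans (ln1Dsqr_le _) _; rewrite -real_normK ?num_real//.
  move: (normr_ge0 (q c)) qc4; clear; nra.
have qpc : q c * p c <= 1 / 4 * P.
  by apply: le_trans (ler_norm _) _; rewrite normrM; apply: ler_pM.
have Q0 : 0 < Q by apply: lt_trans Q1.
have QPL : Lam <= Q * P.
  have Qpm : - (Q * P) <= Q * p ym by rewrite -mulrN ler_pM2l.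
  have k2rc : 0 <= k2 * r c ^+ 2 by rewrite mulr_ge0 ?sqr_ge0// ltW.
  have Pymc : P * (ym - c) <= P.
    by rewrite ler_piMr ?(ltW P0)//; move: dc1 ymd; clear; lra.
  have := @peak_height Q P 2 P0 Q0 QP; rewrite divff ?pnatr_eq0//; apply.
  move: hamle; rewrite /ham rm0 expr0n /= mulr0 -/Q.
  move: km kc lnc qpc Qpm k2rc Pymc P4; clear; lra.
have P2 : 0 < 2 * P by rewrite mulr_gt0.
have PkQ : P / k2 * s0 ^+ 2 < Q / 2.
  have : P / k2 * s0 ^+ 2 < Lam / (2 * P).
    rewrite ltr_pdivlMr//.
    rewrite (_ : P / k2 * s0 ^+ 2 * (2 * P) = 2 * s0 ^+ 2 * P ^+ 2 / k2); last by field; rewrite gt_eqF.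
    by rewrite ltr_pdivrMr.
  move=> /lt_le_trans; apply; rewrite ler_pdivrMr//.
  by move: QPL; clear; lra.
have ymhi : ym + s0 <= hi by apply: le_trans dhi; rewrite lerD2r.
have loym : lo <= ym by exact: le_trans cym.
have sub2 y (h : y \in `[ym, ym + s0]) : y \in `[lo, hi] := sub_itv_cc loym ymhi h.
have hsys y : y \in `[ym, ym + s0] -> [/\ is_derive y 1 q (r y),
     is_derive y 1 r ((q y / (1 + q y ^+ 2) + p y) / k2) & `|p y| <= P].
  by move=> /sub2 h; have [_ h1 h2 _ _] := hode y h; have [h3 _ _] := hP y h.
have qhalf := @peak_persists k2 q r p ym s0 P k20 P0 s00 hsys rm0 PkQ.
have ys : ym <= ym + s0 by rewrite lerDl ltW.
have dvs t : t \in `[ym, ym + s0] -> is_derive t 1 v (q t) by move=> /sub2; exact: dv.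
have vlow := @mvt_ge R v q ym (ym + s0) (Q / 2) ys dvs qhalf.
have : v (ym + s0) - v ym <= eta.
  apply: le_trans (ler_norm _) _; apply: hosc => //.
  by apply: sub2; apply: itv_ccI.
have : s0 * Lam / (2 * P) <= Q / 2 * s0.
  rewrite ler_pdivrMr//.
  rewrite mulrC (_ : Q / 2 * s0 * (2 * P) = Q * P * s0); last by field.
  by rewrite ler_pM2r.
move: hbig vlow; clear; lra.
Qed.

End Plateau.

(** * Boundary layers *)

Section Layer.
Context {R : realType}.
Implicit Types (al sg t : R).

Lemma posM (z : R) : z * pos z = pos z ^+ 2.
Proof.
have [z0|z0] := leP 0 z; first by rewrite pos_id.
by rewrite (pos_0 (ltW z0)) mulr0 expr0n.
Qed.

(** The polynomial (1 - t)^3 (al + (3 al + sg) t) for t <= 1, extended by zero: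
    value al and slope sg at t = 0, and contact of order two with 0 at t = 1. *)
Definition lay al sg t : R := (1 - t) * pos (1 - t) ^+ 2 * (al + (3 * al + sg) * t).
Definition lay1 al sg t : R := - 3 * pos (1 - t) ^+ 2 * (al + (3 * al + sg) * t) +
  (1 - t) * pos (1 - t) ^+ 2 * (3 * al + sg).
Definition lay2 al sg t : R := 6 * pos (1 - t) * (al + (3 * al + sg) * t) -
  6 * pos (1 - t) ^+ 2 * (3 * al + sg).

Let dpos t : is_derive t 1 (fun t : R => pos (1 - t) ^+ 2) (- (2 * pos (1 - t))).
Proof.
have h : is_derive t 1 (fun t : R => 1 - t) (-1) by apply: is_derive_eq; lra.
have := @is_derive1_comp R (fun y => pos y ^+ 2) (fun t => 1 - t) t _ _ (is_derive_pos2 _) h.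
by rewrite mulrN1.
Qed.

Lemma is_derive_lay al sg t : is_derive t 1 (lay al sg) (lay1 al sg t).
Proof.
have h1 := dpos t.
have h2 : is_derive t 1 (fun t : R => 1 - t) (-1) by apply: is_derive_eq; lra.
have h3 : is_derive t 1 (fun t : R => al + (3 * al + sg) * t) (3 * al + sg).
  by apply: is_derive_eq; rewrite /GRing.scale/=; ring.
rewrite /lay /lay1; apply: is_derive_eq; rewrite /GRing.scale/=.
have := posM (1 - t); set T := pos _ => E.
apply/eqP; rewrite -subr_eq0; apply/eqP.
transitivity (2 * (al + (3 * al + sg) * t) * (T ^+ 2 - (1 - t) * T)); first by ring.
by rewrite E subrr mulr0.
Qed.

Lemma is_derive_lay1 al sg t : is_derive t 1 (lay1 al sg) (lay2 al sg t).
Proof.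
have h1 := dpos t.
have h2 : is_derive t 1 (fun t : R => 1 - t) (-1) by apply: is_derive_eq; lra.
have h3 : is_derive t 1 (fun t : R => al + (3 * al + sg) * t) (3 * al + sg).
  by apply: is_derive_eq; rewrite /GRing.scale/=; ring.
rewrite /lay1 /lay2; apply: is_derive_eq; rewrite /GRing.scale/=.
have := posM (1 - t); set T := pos _ => E.
apply/eqP; rewrite -subr_eq0; apply/eqP.
transitivity (2 * (3 * al + sg) * (T ^+ 2 - (1 - t) * T)); first by ring.
by rewrite E subrr mulr0.
Qed.

Lemma lay2_cont al sg t : continuous_at t (lay2 al sg).
Proof.
have c1 : continuous_at t (fun t : R => pos (1 - t)).
  apply: (@cont_comp _ (fun t => 1 - t) pos); last exact: pos_continuous.
  by apply: contB; [exact: cont_cst|].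
have c2 : continuous_at t (fun t : R => t) by [].
apply: contB; apply: contM.
- by apply: contM; [exact: cont_cst|].
- by apply: contD; [exact: cont_cst|apply: contM => //; exact: cont_cst].
- by apply: contM; [exact: cont_cst|exact: contX].
- exact: cont_cst.
Qed.

Lemma lay_out al sg t : 1 <= t -> [/\ lay al sg t = 0, lay1 al sg t = 0 & lay2 al sg t = 0].
Proof.
move=> t1; rewrite /lay /lay1 /lay2 pos_0 ?subr_le0// expr0n/=.
by split; ring.
Qed.

Lemma lay_at0 al sg : lay al sg 0 = al /\ lay1 al sg 0 = sg.
Proof. by rewrite /lay /lay1 subr0 pos_id//; split; ring. Qed.

Lemma lay_bound A0 al sg t : 0 <= A0 -> `|al| <= A0 -> `|sg| <= 1 -> 0 <= t ->
  [/\ `|lay al sg t| <= 42 * A0 + 12, `|lay1 al sg t| <= 42 * A0 + 12 &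
      `|lay2 al sg t| <= 42 * A0 + 12].
Proof.
move=> A00 alA sg1 t0; have [t1|t1] := leP 1 t.
  have [-> -> ->] := lay_out al sg t1; rewrite normr0; split; lra.
rewrite /lay /lay1 /lay2 pos_id ?subr_ge0 ?(ltW t1)//.
set T := 1 - t; have [T0 T1] : 0 <= T /\ T <= 1 by rewrite /T; split; lra.
have b1 : `|3 * al + sg| <= 3 * A0 + 1.
  apply: le_trans (ler_normD _ _) _; apply: lerD => //.
  by rewrite normrM ger0_norm// ler_pM2l.
have b2 : `|al + (3 * al + sg) * t| <= 4 * A0 + 1.
  apply: le_trans (ler_normD _ _) _.
  have : `|(3 * al + sg) * t| <= (3 * A0 + 1) * 1.
    by rewrite normrM (ger0_norm t0); apply: ler_pM => //; exact: ltW.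
  move: alA; lra.
have T2 : T ^+ 2 <= 1 by rewrite exprn_ile1.
have T20 : 0 <= T ^+ 2 by rewrite sqr_ge0.
have T3 : T * T ^+ 2 <= 1 by rewrite mulr_ile1.
have T30 : 0 <= T * T ^+ 2 by rewrite mulr_ge0.
have N (s x B : R) : 0 <= s -> s <= 1 -> `|x| <= B -> `|s * x| <= B.
  move=> s0 s1 xB; rewrite normrM (ger0_norm s0); apply: le_trans xB.
  by rewrite ler_piMl.
have c1 := N _ _ _ T0 T1 b2; have c2 := N _ _ _ T20 T2 b2; have c3 := N _ _ _ T20 T2 b1.
have c4 := N _ _ _ T30 T3 b1; have c5 := N _ _ _ T30 T3 b2.
move: c1 c2 c3 c4 c5; rewrite !ler_norml => /andP[? ?] /andP[? ?] /andP[? ?] /andP[? ?] /andP[? ?].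
split; apply/andP; split; lra.
Qed.

End Layer.

(** * Energy and flux bounds by comparison *)

Section Energy.
Context {R : realType}.
Implicit Types (a b c y K L : R).

Lemma antiderivative (D : R -> R) a b : a < b -> (forall y, y \in `[a, b] -> continuous_at y D) ->
  exists G : R -> R, forall y, y \in `]a, b[ -> is_derive y 1 G (D y).
Proof.
move=> ab cD; exists (prim a D) => y yab.
by apply: (prim_derive (L1_cont cD) yab); apply: cD; exact: subset_itv_oo_cc.
Qed.

(** Minimality on [a, b] for fixed values and slopes at the end points, again in
    terms of an antiderivative G of the difference of the densities. *)
Definition beats (k2 bw : R) (v q r g : R -> R) a b : Prop :=
  forall (w w1 w2 G : R -> R),
  (forall y, y \in `[a, b] -> [/\ is_derive y 1 w (w1 y), is_derive y 1 w1 (w2 y) &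
     continuous_at y w2]) ->
  w a = v a -> w b = v b -> w1 a = q a -> w1 b = q b ->
  (forall y, y \in `[a, b] -> is_derive y 1 G
     (density k2 bw g v q r y - density k2 bw g w w1 w2 y)) ->
  G b <= G a.

Lemma three_pieces (Z X : R -> R) (a b l B0 B1 : R) : 0 <= l -> a + l <= b - l ->
  (forall y, y \in `[a, b] -> is_derive y 1 Z (X y)) ->
  (forall y, y \in `[a, b] -> X y <= B0) ->
  (forall y, y \in `[a + l, b - l] -> X y <= B1) ->
  Z b - Z a <= 2 * l * B0 + B1 * (b - a - 2 * l).
Proof.
move=> l0 ab dZ X0 X1.
have al : a <= a + l by rewrite lerDl.
have bl : b - l <= b by rewrite gerBl.
have s1 y (h : y \in `[a, a + l]) := sub_itv_cc (lexx a) (le_trans ab bl) h.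
have s2 y (h : y \in `[a + l, b - l]) := sub_itv_cc al bl h.
have s3 y (h : y \in `[b - l, b]) := sub_itv_cc (le_trans al ab) (lexx b) h.
have m1 := @mvt_le R Z X a (a + l) B0 al (fun y h => dZ y (s1 y h)) (fun y h => X0 y (s1 y h)).
have m2 := @mvt_le R Z X (a + l) (b - l) B1 ab (fun y h => dZ y (s2 y h)) X1.
have m3 := @mvt_le R Z X (b - l) b B0 bl (fun y h => dZ y (s3 y h)) (fun y h => X0 y (s3 y h)).
move: m1 m2 m3; clear; lra.
Qed.

(** The constant M corrected by one layer of width l at each end. *)
Lemma competitor (a b l M : R) (va vb qa qb A0 : R) : 0 < l -> l <= 1 -> a + l <= b - l ->
  0 <= A0 -> `|va - M| <= A0 -> `|vb - M| <= A0 -> `|qa| <= 1 -> `|qb| <= 1 ->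
  exists w w1 w2 : R -> R, [/\
    forall y : R, [/\ is_derive y 1 w (w1 y), is_derive y 1 w1 (w2 y) & continuous_at y w2],
    [/\ w a = va, w b = vb, w1 a = qa & w1 b = qb],
    forall y, y \in `[a, b] -> [/\ `|w y - M| <= 2 * (42 * A0 + 12),
      `|w1 y| <= 2 * (42 * A0 + 12) / l & `|w2 y| <= 2 * (42 * A0 + 12) / l ^+ 2] &
    forall y, y \in `[a + l, b - l] -> [/\ w y = M, w1 y = 0 & w2 y = 0]].
Proof.
move=> l0 l1 ab A00 va0 vb0 qa1 qb1.
have ln0 : l != 0 by rewrite gt_eqF.
pose ha := lay (va - M) (qa * l); pose ha1 := lay1 (va - M) (qa * l).
pose ha2 := lay2 (va - M) (qa * l).
pose hb := lay (vb - M) (- qb * l); pose hb1 := lay1 (vb - M) (- qb * l).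
pose hb2 := lay2 (vb - M) (- qb * l).
have da y : is_derive y 1 (fun y : R => (y - a) / l) l^-1.
  by apply: is_derive_eq; rewrite /GRing.scale/=; ring.
have db y : is_derive y 1 (fun y : R => (b - y) / l) (- l^-1).
  by apply: is_derive_eq; rewrite /GRing.scale/=; ring.
exists (fun y => M + ha ((y - a) / l) + hb ((b - y) / l)).
exists (fun y => ha1 ((y - a) / l) / l - hb1 ((b - y) / l) / l).
exists (fun y => ha2 ((y - a) / l) / l ^+ 2 + hb2 ((b - y) / l) / l ^+ 2).
have lbl y : y <= b - l -> 1 <= (b - y) / l.
  by move=> h; rewrite ler_pdivlMr// mul1r lerBrDr addrC -lerBrDr.
have lal y : a + l <= y -> 1 <= (y - a) / l.
  by move=> h; rewrite ler_pdivlMr// mul1r lerBrDr addrC.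
have ab0 : a <= b - l by apply: le_trans ab; rewrite lerDl ltW.
have ab1 : a + l <= b by apply: le_trans ab _; rewrite gerBl ltW.
split.
- move=> y; split.
  + have h1 := @is_derive1_comp R ha _ y _ _ (is_derive_lay _ _ _) (da y).
    have h2 := @is_derive1_comp R hb _ y _ _ (is_derive_lay _ _ _) (db y).
    rewrite /comp in h1 h2; apply: is_derive_eq; rewrite /ha1 /hb1; ring.
  + have h1 := @is_derive1_comp R ha1 _ y _ _ (is_derive_lay1 _ _ _) (da y).
    have h2 := @is_derive1_comp R hb1 _ y _ _ (is_derive_lay1 _ _ _) (db y).
    rewrite /comp in h1 h2; apply: is_derive_eq; rewrite /GRing.scale/= /ha2 /hb2; field.
    exact: ln0.
  + apply: contD; apply: contM; try exact: cont_cst.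
    * apply: (@cont_comp _ (fun y => (y - a) / l) ha2); last exact: lay2_cont.
      exact: (is_derive_continuous (da y)).
    * apply: (@cont_comp _ (fun y => (b - y) / l) hb2); last exact: lay2_cont.
      exact: (is_derive_continuous (db y)).
- have [oa oa1 _] := lay_out (vb - M) (- qb * l) (lbl a ab0).
  have [ob ob1 _] := lay_out (va - M) (qa * l) (lal b ab1).
  have [ea ea1] := lay_at0 (va - M) (qa * l); have [eb eb1] := lay_at0 (vb - M) (- qb * l).
  rewrite /ha /ha1 /hb /hb1 !subrr !mul0r oa oa1 ob ob1 ea ea1 eb eb1.
  by split; [ring|ring|field|field].
- move=> y; rewrite in_itv/= => /andP[ay yb].
  have ta : 0 <= (y - a) / l by rewrite divr_ge0 ?subr_ge0// ltW.
  have tb : 0 <= (b - y) / l by rewrite divr_ge0 ?subr_ge0// ltW.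
  have sa : `|qa * l| <= 1 by rewrite normrM (gtr0_norm l0) mulr_ile1// ltW.
  have sb : `|- qb * l| <= 1 by rewrite normrM normrN (gtr0_norm l0) mulr_ile1// ltW.
  have [a0 a1 a2] := lay_bound A00 va0 sa ta; have [b0 b1 b2] := lay_bound A00 vb0 sb tb.
  set m := 42 * A0 + 12 in a0 a1 a2 b0 b1 b2 *.
  split.
  + rewrite (_ : _ - M = ha ((y - a) / l) + hb ((b - y) / l)); last by ring.
    by apply: le_trans (ler_normD _ _) _; rewrite mulr_natl mulr2n lerD.
  + rewrite -mulrBl normrM (gtr0_norm (_ : 0 < l^-1)) ?invr_gt0// ler_pM2r ?invr_gt0//.
    by apply: le_trans (ler_normB _ _) _; rewrite mulr_natl mulr2n lerD.
  + have l20 : 0 < (l ^+ 2)^-1 by rewrite invr_gt0 exprn_gt0.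
    rewrite -mulrDl normrM (gtr0_norm l20) ler_pM2r//.
    by apply: le_trans (ler_normD _ _) _; rewrite mulr_natl mulr2n lerD.
- move=> y; rewrite in_itv/= => /andP[ay yb].
  have [oa oa1 oa2] := lay_out (vb - M) (- qb * l) (lbl y yb).
  have [ob ob1 ob2] := lay_out (va - M) (qa * l) (lal y ay).
  by rewrite /ha /ha1 /ha2 /hb /hb1 /hb2 oa oa1 oa2 ob ob1 ob2; split; ring.
Qed.

(** Compare v with the constant M = sgn(L) (K + 1) joined to v by two layers of
    width l.  M lies on the same side as L and beyond all values of v, so off the
    layers passing from v to M changes the squared distance to the datum by at
    most a constant minus 2 |L|.  The energy of v plus a multiple of |L| is thus
    paid for by the layers. *)
Lemma energy_bound k2 bw v q r p g g1 E (lo hi a b K L l m : R) :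
  0 < k2 -> 0 < bw -> 0 <= K -> lo < a -> b < hi -> 0 < l -> l <= 1 -> a + l <= b - l ->
  (forall y, y \in `]lo, hi[ -> ode k2 bw v q r p g g1 y) -> beats k2 bw v q r g a b ->
  (forall y, y \in `[a, b] -> `|v y| <= K /\ `|g y - L| <= K) ->
  `|q a| <= 1 -> `|q b| <= 1 ->
  (forall y, y \in `[a, b] -> is_derive y 1 E (k2 * r y ^+ 2 + ln (1 + q y ^+ 2))) ->
  m = 2 * (42 * (2 * K + 1) + 12) ->
  E b - E a <= 2 * l * (k2 * (m / l ^+ 2) ^+ 2 + ln (1 + (m / l) ^+ 2) +
      bw * ((4 * K + 2 + m) ^+ 2 * (1 + `|L|))) +
    bw * ((K + 1) ^+ 2 + 2 * K * (2 * K + 1) - 2 * `|L|) * (b - a - 2 * l).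
Proof.
move=> k20 bw0 K0 loa bhi l0 l1 abl hode hb hK qa qb dE mE.
have ab : a < b by move: abl l0; clear; lra.
pose s : R := if 0 <= L then 1 else -1.
have sL : s * L = `|L|.
  by rewrite /s; case: ger0P => _; rewrite ?mul1r ?mulN1r.
have s2 : s ^+ 2 = 1 by rewrite /s; case: ifP => _; rewrite ?sqrrN expr1n.
have sN (x : R) : `|s * x| = `|x|.
  by rewrite /s; case: ifP => _; rewrite ?mul1r ?mulN1r ?normrN.
(* M is at distance at least 1 from all values of v, on the side of L. *)
pose M := s * (K + 1).
have MN : `|M| = K + 1 by rewrite sN ger0_norm// addr_ge0.
have aI : a \in `[a, b] by apply: itv_ccI => //; exact: ltW.
have bI : b \in `[a, b] by apply: itv_ccI => //; exact: ltW.
have A00 : 0 <= 2 * K + 1 by move: K0; clear; lra.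
have vM y : `|v y| <= K -> `|v y - M| <= 2 * K + 1.
  move=> vK; apply: le_trans (ler_normB _ _) _; rewrite MN; move: vK; clear; lra.
have [w [w1 [w2 [dw [wa wb w1a w1b] wB wM]]]] :=
  competitor l0 l1 abl A00 (vM a (hK a aI).1) (vM b (hK b bI).1) qa qb.
rewrite -mE in wB.
have sub y (h : y \in `[a, b]) : y \in `]lo, hi[.
  by move: h; rewrite !in_itv/= => /andP[ay yb]; rewrite (lt_le_trans loa ay) (le_lt_trans yb bhi).
pose D y := density k2 bw g v q r y - density k2 bw g w w1 w2 y.
pose lo' := (lo + a) / 2; pose hi' := (b + hi) / 2.
have lo'a : lo' < a by move: loa; rewrite /lo'; clear; lra.
have lolo' : lo < lo' by move: loa; rewrite /lo'; clear; lra.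
have bhi' : b < hi' by move: bhi; rewrite /hi'; clear; lra.
have hi'hi : hi' < hi by move: bhi; rewrite /hi'; clear; lra.
have cD y : y \in `[lo', hi'] -> continuous_at y D.
  rewrite in_itv/= => /andP[y1 y2].
  have [e1 e2 e3 _ e5] : ode k2 bw v q r p g g1 y.
    by apply: hode; rewrite in_itv/= (lt_le_trans lolo' y1) (le_lt_trans y2 hi'hi).
  have [f1 f2 f3] := dw y.
  have c1 := is_derive_continuous e1; have c2 := is_derive_continuous e2.
  have c3 := is_derive_continuous e3; have c4 := is_derive_continuous e5.
  have c5 := is_derive_continuous f1; have c6 := is_derive_continuous f2.
  by apply: contB; exact: density_cont.
have [G dG'] := antiderivative (lt_trans lo'a (lt_trans ab bhi')) cD.
have dG y : y \in `[a, b] -> is_derive y 1 G (D y).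
  rewrite in_itv/= => /andP[ay yb].
  by apply: dG'; rewrite in_itv/= (lt_le_trans lo'a ay) (le_lt_trans yb bhi').
have GG := hb w w1 w2 G (fun y _ => dw y) wa wb w1a w1b dG.
pose X y := k2 * w2 y ^+ 2 + ln (1 + w1 y ^+ 2) + bw * ((w y - v y) * (w y + v y - 2 * g y)).
have dZ y : y \in `[a, b] -> is_derive y 1 (fun y => E y - G y) (X y).
  move=> yab; have h1 := dE y yab; have h2 := dG y yab.
  by apply: is_derive_eq; rewrite /X /D /density; ring.
have m0 : 0 <= m by rewrite mE; move: K0; clear; lra.
set B0 := k2 * (m / l ^+ 2) ^+ 2 + _ + _.
set B1 := bw * _.
have XB0 y : y \in `[a, b] -> X y <= B0.
  move=> yab; have [wy w1y w2y] := wB y yab; have [vy gy] := hK y yab.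
  have sqle (x B : R) : `|x| <= B -> x ^+ 2 <= B ^+ 2.
    by move=> xB; rewrite -real_normK ?num_real// lerXn2r ?nnegrE// (le_trans _ xB).
  apply: lerD; first apply: lerD.
  - by rewrite ler_pM2l//; exact: sqle.
  - by rewrite ler_ln ?posrE ?den_gt0// lerD2l; exact: sqle.
  rewrite ler_pM2l//; apply: le_trans (ler_norm _) _; rewrite normrM expr2 -mulrA.
  have wN : `|w y| <= K + 1 + m.
    rewrite -[w y](subrK M); apply: le_trans (ler_normD _ _) _; rewrite MN addrC lerD2l.
    exact: wy.
  apply: ler_pM => //.
    apply: le_trans (ler_normB _ _) _; move: wN vy K0; clear; lra.
  have gN : `|g y| <= K + `|L|.
    by rewrite -[g y](subrK L); apply: le_trans (ler_normD _ _) _; rewrite lerD2r.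
  apply: (@le_trans _ _ (4 * K + 2 + m + 2 * `|L|)).
    apply: le_trans (ler_normB _ _) _; rewrite normrM ger0_norm//.
    have := ler_normD (w y) (v y); move: wN vy gN; clear; lra.
  rewrite mulrDr mulr1 lerD2l; apply: ler_wpM2r => //; move: K0 m0; clear; lra.
have XB1 y : y \in `[a + l, b - l] -> X y <= B1.
  move=> yI; rewrite /X; have [-> -> ->] := wM y yI.
  have al : a <= a + l by rewrite lerDl ltW.
  have bl : b - l <= b by rewrite gerBl ltW.
  have [vy gy] := hK y (sub_itv_cc al bl yI).
  rewrite /B1 expr0n/= mulr0 add0r addr0 ln1 add0r ler_pM2l//.
  have vL : - (K * `|L|) <= - (L * v y).
    rewrite lerN2; apply: le_trans (ler_norm _) _; rewrite normrM mulrC.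
    by apply: ler_wpM2r.
  have gM : - (2 * (g y - L) * (M - v y)) <= 2 * K * (2 * K + 1).
    apply: le_trans (ler_norm _) _; rewrite normrN !normrM ger0_norm//.
    by apply: ler_pM; rewrite ?mulr_ge0// ?ler_pM2l// distrC; exact: vM.
  have M2 : M ^+ 2 = (K + 1) ^+ 2 by rewrite exprMn s2 mul1r.
  have LM : L * M = `|L| * (K + 1) by rewrite -sL /M; ring.
  have -> : (M - v y) * (M + v y - 2 * g y) =
    M ^+ 2 - v y ^+ 2 + - (2 * (g y - L) * (M - v y)) - 2 * (L * M) - 2 * - (L * v y) by ring.
  rewrite M2 LM; have := sqr_ge0 (v y); move: vL gM; clear; lra.
have := three_pieces (ltW l0) abl dZ XB0 XB1.
move: GG; clear; lra.
Qed.

(** The derivative of k2 q r - p v is k2 r^2 + q^2/(1 + q^2) - p' v, which the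
    energy density controls.  Integrated over an interval on which v jumps by V0,
    while p is nearly constant, it bounds |p| V0 by the energy. *)
Lemma p_bound k2 bw v q r p g g1 E (a b c d K e V0 Pd : R) : 0 < k2 -> a <= c -> c <= d -> d <= b ->
  (forall y, y \in `[a, b] -> ode k2 bw v q r p g g1 y) ->
  (forall y, y \in `[a, b] -> `|v y| <= K) ->
  (forall y, y \in `[a, b] -> `|bw * (v y - g y)| <= Pd) ->
  (forall y, y \in `[a, b] -> is_derive y 1 E (k2 * r y ^+ 2 + ln (1 + q y ^+ 2))) ->
  `|k2 * (q c * r c)| <= e -> `|k2 * (q d * r d)| <= e -> V0 <= `|v d - v c| ->
  `|p c| * V0 <= (E b - E a) + 2 * e + 2 * Pd * K * (d - c).
Proof.
move=> k20 ac cd db hode vK pd dE ec ed Vle.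
have sub y (h : y \in `[c, d]) := sub_itv_cc ac db h.
have lnD y : q y ^+ 2 / (1 + q y ^+ 2) <= ln (1 + q y ^+ 2).
  have d0 := den_gt0 (q y).
  rewrite -[ln _]opprK -lnV ?posrE// lerNr.
  have e1 : (1 + q y ^+ 2)^-1 = 1 + - (q y ^+ 2 / (1 + q y ^+ 2)).
    by field; rewrite gt_eqF.
  rewrite [X in ln X]e1; apply: le_ln1Dx; rewrite ltrN2 ltr_pdivrMr// mul1r ltrDr//.
have fl0 y : 0 <= q y ^+ 2 / (1 + q y ^+ 2) by rewrite divr_ge0 ?sqr_ge0// ltW// den_gt0.
(* k2 q r - p v up to constants, normalized at c so that only p(c) (v(d) - v(c)) is left. *)
pose Ph y := k2 * (q y * r y) - (p y - p c) * v y - p c * (v y - v c).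
have dPh y : y \in `[c, d] -> is_derive y 1 Ph
    (k2 * r y ^+ 2 + q y ^+ 2 / (1 + q y ^+ 2) + bw * (v y - g y) * v y).
  move=> /sub h; have [e1 e2 e3 e4 _] := hode y h.
  rewrite /Ph; apply: is_derive_eq; rewrite /GRing.scale/=; field.
  by rewrite (gt_eqF (den_gt0 _)) gt_eqF.
have pdv y : y \in `[c, d] -> `|bw * (v y - g y) * v y| <= Pd * K.
  by move=> /sub h; rewrite normrM; apply: ler_pM; [exact: normr_ge0|exact: normr_ge0|exact: pd|exact: vK].
have aE : 0 <= E c - E a.
  have := @mvt_ge R E _ a c 0 ac (fun y h => dE y (sub_itv_cc (lexx a) (le_trans cd db) h)).
  rewrite mul0r; apply => y _; apply: addr_ge0; last exact: ln1Dsqr_ge0.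
  by rewrite mulr_ge0 ?sqr_ge0// ltW.
have bE : 0 <= E b - E d.
  have := @mvt_ge R E _ d b 0 db (fun y h => dE y (sub_itv_cc (le_trans ac cd) (lexx b) h)).
  rewrite mul0r; apply => y _; apply: addr_ge0; last exact: ln1Dsqr_ge0.
  by rewrite mulr_ge0 ?sqr_ge0// ltW.
have cE : 0 <= E d - E c.
  have := @mvt_ge R E _ c d 0 cd (fun y h => dE y (sub y h)).
  rewrite mul0r; apply => y _; apply: addr_ge0; last exact: ln1Dsqr_ge0.
  by rewrite mulr_ge0 ?sqr_ge0// ltW.
have up : Ph d - Ph c <= E d - E c + Pd * K * (d - c).
  have dF y : y \in `[c, d] -> is_derive y 1 (fun y => Ph y - E y)
     (k2 * r y ^+ 2 + q y ^+ 2 / (1 + q y ^+ 2) + bw * (v y - g y) * v y -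
      (k2 * r y ^+ 2 + ln (1 + q y ^+ 2))).
    by move=> h; have h1 := dPh y h; have h2 := dE y (sub y h); exact: is_deriveB.
  have := @mvt_le R _ _ c d (Pd * K) cd dF.
  have H y : y \in `[c, d] -> k2 * r y ^+ 2 + q y ^+ 2 / (1 + q y ^+ 2) + bw * (v y - g y) * v y -
      (k2 * r y ^+ 2 + ln (1 + q y ^+ 2)) <= Pd * K.
    move=> h; have := lnD y; have := le_trans (ler_norm _) (pdv y h); clear; lra.
  move=> /(_ H); clear; lra.
have low : - (Pd * K) * (d - c) <= Ph d - Ph c.
  apply: (@mvt_ge R Ph _ c d (- (Pd * K)) cd dPh) => y h.
  have := pdv y h; rewrite ler_norml => /andP[h1 _].
  have : 0 <= k2 * r y ^+ 2 by rewrite mulr_ge0 ?sqr_ge0// ltW.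
  have := fl0 y; move: h1; clear; lra.
have pc0 : Ph c = k2 * (q c * r c) by rewrite /Ph !subrr !(mul0r, mulr0) !subr0.
have pp : `|(p d - p c) * v d| <= Pd * K * (d - c).
  have dp y : y \in `[c, d] -> is_derive y 1 p (- (bw * (v y - g y))).
    by move=> /sub h; case: (hode y h).
  have pdc := @mvt_norm R p _ c d Pd cd dp.
  have : `|p d - p c| <= Pd * (d - c).
    by apply: pdc => y /sub h; rewrite normrN; exact: pd.
  move=> h; rewrite normrM -mulrA (mulrC K) mulrA; apply: ler_pM => //.
  by apply: vK; apply: sub; apply: itv_ccI.
have : `|p c * (v d - v c)| <= (E b - E a) + 2 * e + 2 * Pd * K * (d - c).
  have E1 : p c * (v d - v c) = k2 * (q d * r d) - (p d - p c) * v d - Ph d.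
    by rewrite /Ph; ring.
  have Pdn : 0 <= Pd * K * (d - c) by apply: le_trans pp.
  have e0 : 0 <= e by apply: le_trans ec.
  move: ec ed pp; rewrite !ler_norml E1 -pc0 => /andP[e1 e2] /andP[e3 e4] /andP[e5 e6].
  by apply/andP; split; move: e1 e2 e3 e4 e5 e6 Pdn e0 aE bE cE up low; clear; lra.
rewrite normrM; apply: le_trans; exact: ler_wpM2l.
Qed.

End Energy.

(** * Estimates in the scaling of the functional *)

Section Scaled.
Context {R : realType}.
Implicit Types (a b c y K L : R).

Lemma no_spike k2 bw v q r p g g1 (lo hi y1 eta P s0 : R) : 0 < k2 -> 0 < P -> P <= 1 / 4 ->
  0 < eta -> eta <= 1 / 8 -> 0 < s0 ->
  (forall y, y \in `[lo, hi] -> ode k2 bw v q r p g g1 y) ->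
  (forall y, y \in `[lo, hi] -> [/\ `|p y| <= P, 0 <= bw * (v y - g y) ^+ 2 <= P &
     `|2 * bw * (v y - g y) * g1 y| <= P]) ->
  (forall s t, s \in `[lo, hi] -> t \in `[lo, hi] -> `|v t - v s| <= eta) ->
  lo + 4 * eta <= y1 -> y1 + 4 * eta + s0 <= hi ->
  0 < - ln (2 * P) - 1 -> 2 * s0 ^+ 2 * P ^+ 2 < (- ln (2 * P) - 1) * k2 ->
  eta < s0 * (- ln (2 * P) - 1) / (2 * P) ->
  `|q y1| <= 1.
Proof.
move=> k20 P0 P4 eta0 eta8 s00 hode hP hosc lo1 hi1 L0 hs0 hbig.
have up := no_positive_spike k20 P0 P4 eta0 eta8 s00 hode hP hosc lo1 hi1 L0 hs0 hbig.
rewrite ler_norml up andbT lerNl.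
apply: (no_positive_spike k20 P0 P4 eta0 eta8 s00 (fun y h => odeN (hode y h)) _ _ lo1 hi1 L0 hs0 hbig).
- move=> y h; have [h1 h2 h3] := hP y h; split; first by rewrite normrN.
    by rewrite -opprD sqrrN.
  by rewrite -opprD !(mulrN, mulNr) opprK.
- by move=> s t sI tI; rewrite -opprD normrN; exact: hosc.
Qed.

(** Where |q| <= 1 the factor 1/(1 + q^2) is at least 1/2, and the equation for q
    falls under the barrier lemma with right-hand side p. *)
Lemma plateau_slope k2 (q r p : R -> R) (y rho P : R) : 0 < k2 -> 0 < rho -> 0 <= P ->
  (forall s, s \in `[y - rho, y + rho] -> [/\ is_derive s 1 q (r s),
     is_derive s 1 r ((q s / (1 + q s ^+ 2) + p s) / k2), `|p s| <= P & `|q s| <= 1]) ->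
  `|q y| <= 2 * P + 4 * k2 / rho ^+ 2.
Proof.
move=> k20 rho0 P0 H; rewrite -[4 * k2](_ : 4 * 1 * k2 = _); last by rewrite mulr1.
apply: (@barrier R q r (fun s => (q s / (1 + q s ^+ 2) + p s) / k2)
  (fun s => (1 + q s ^+ 2)^-1) p k2 y rho 1 P k20 rho0 P0) => s sI.
have [h1 h2 h3 h4] := H s sI; split => //; split; [exact: h1|exact: h2| | |exact: h3].
- by rewrite mulrC divfK ?gt_eqF// mulrC.
- have : q s ^+ 2 <= 1 by rewrite -real_normK ?num_real// exprn_ile1.
  by move=> q21; rewrite -[X in _ <= X]mul1r ler_pdivlMr ?den_gt0//; move: q21; clear; lra.
Qed.

(** The sum z = q + p solves k2 z'' = z + e, where e is cubic in q up to a term of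
    order k2; the barrier lemma therefore makes q = - p to leading order. *)
Lemma flux_almost k2 bw v q r p g g1 (y rho P P2 S : R) : 0 < k2 -> 0 < rho -> 0 <= P2 ->
  0 <= S ->
  (forall s, s \in `[y - rho, y + rho] -> ode k2 bw v q r p g g1 s /\
     [/\ `|p s| <= P, `|q s| <= S & `|bw * (q s - g1 s)| <= P2]) ->
  `|q y + p y| <= 2 * (S ^+ 3 + k2 * P2) + 4 * (S + P) * k2 / rho ^+ 2.
Proof.
move=> k20 rho0 P20 S0 H.
have E0 : 0 <= S ^+ 3 + k2 * P2 by rewrite addr_ge0 ?exprn_ge0 ?mulr_ge0// ltW.
apply: (@barrier R (fun y => q y + p y) (fun y => r y - bw * (v y - g y))
  (fun s => (q s / (1 + q s ^+ 2) + p s) / k2 - bw * (q s - g1 s)) (fun=> 1)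
  (fun s => - (q s ^+ 3 / (1 + q s ^+ 2)) - k2 * (bw * (q s - g1 s))) k2 y rho (S + P)
  _ k20 rho0 E0) => s sI.
have [[dv dq dr dp dg] [h1 h2 h3]] := H s sI; split; last first.
  by apply: le_trans (ler_normD _ _) _; exact: lerD.
split.
- exact: is_deriveD.
- by apply: is_derive_eq; rewrite /GRing.scale/=; ring.
- by field; rewrite (gt_eqF (den_gt0 _)) gt_eqF.
- by lra.
- apply: le_trans (ler_normB _ _) _; rewrite normrN; apply: lerD.
    rewrite normrM normrX normfV (gtr0_norm (den_gt0 _)) ler_pdivrMr ?den_gt0//.
    apply: (@le_trans _ _ (S ^+ 3)); first by rewrite lerXn2r ?nnegrE.
    by rewrite ler_peMr ?exprn_ge0// lerDl sqr_ge0.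
  by rewrite normrM (gtr0_norm k20) ler_pM2l.
Qed.

(** A function with small oscillation has points with slope at most 1 in every
    subinterval; the mean value theorem for q^2 between two of them gives a point
    where q q' is controlled. *)
Lemma good_points (v q r : R -> R) (s h : R) : 0 < h ->
  (forall y, y \in `[s, s + 3 * h] -> is_derive y 1 v (q y) /\ is_derive y 1 q (r y)) ->
  (forall y z, y \in `[s, s + 3 * h] -> z \in `[s, s + 3 * h] -> `|v z - v y| <= h) ->
  exists a c b, [/\ s < a < s + h, s + 2 * h < b < s + 3 * h, a < c < b,
    `|q a| <= 1 /\ `|q b| <= 1 & `|q c * r c| <= 1 / (2 * h)].
Proof.
move=> h0 H osc.
have h2 : s + h <= s + 3 * h by move: h0; clear; lra.
have sh : s <= s + 2 * h by move: h0; clear; lra.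
have slope t : s <= t -> t + h <= s + 3 * h -> exists2 c, c \in `]t, (t + h)[ & `|q c| <= 1.
  move=> st th; have tth : t < t + h by rewrite ltrDl.
  have dv y : y \in `[t, (t + h)] -> is_derive y 1 v (q y).
    by move=> yI; have [] := H y (sub_itv_cc st th yI).
  apply: (@small_slope_point R v q t (t + h) 1 tth dv).
  rewrite addrAC subrr add0r mul1r; apply: osc; apply: itv_ccI => //.
    exact: le_trans (ltW tth) th.
  exact: le_trans st (ltW tth).
have [a aI qa] := slope s (lexx s) h2.
have [b bI qb] : exists2 c, c \in `](s + 2 * h), (s + 2 * h + h)[ & `|q c| <= 1.
  by apply: slope => //; clear; lra.
move: aI bI; rewrite !in_itv/= => /andP[sa ah] /andP[hb bh].
have bh' : b < s + 3 * h by move: bh; clear; lra.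
have ab : a < b by move: ah hb h0; clear; lra.
have dq2 y : y \in `[a, b] -> is_derive y 1 (fun y => q y ^+ 2) (2 * (q y * r y)).
  move=> yI; have [_ dq] := H y (sub_itv_cc (ltW sa) (ltW bh') yI).
  have := is_derive_pow 2 dq; rewrite expr1 (_ : 2%:R * q y * r y = 2 * (q y * r y))//.
  by rewrite mulrA.
have [c cI qc] := @mvt R _ _ a b ab dq2.
exists a, c, b; split; [by rewrite sa|by rewrite hb|by move: cI; rewrite in_itv|by []|].
have ba : h <= b - a by move: ah hb; clear; lra.
have q2 : `|q b ^+ 2 - q a ^+ 2| <= 1.
  have qa2 : q a ^+ 2 <= 1 by rewrite -real_normK ?num_real// exprn_ile1.
  have qb2 : q b ^+ 2 <= 1 by rewrite -real_normK ?num_real// exprn_ile1.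
  have := sqr_ge0 (q a); have := sqr_ge0 (q b).
  by rewrite ler_norml; move: qa2 qb2; clear=> ? ? ? ?; apply/andP; split; lra.
rewrite ler_pdivlMr ?mulr_gt0//; apply: le_trans q2; rewrite qc !normrM.
rewrite (ger0_norm (ler0n _ 2)) (gtr0_norm (_ : 0 < b - a)) ?subr_gt0//.
by rewrite mulrCA mulrA; apply: ler_wpM2l => //; rewrite !mulr_ge0.
Qed.

(** The scaling of the functional makes s0 = e^2/(2C) admissible: with
    w2 = e^2 |ln e| and k2 = e^6 w2 a spike would have height at least
    |ln e| / (C w2), hence area bounded below by 1/(4 C^2). *)
Lemma spike_scaled bw v q r p g g1 (e w2 k2 lo hi y1 eta C : R) :
  0 < e -> e < 1 -> w2 = e ^+ 2 * (- ln e) -> k2 = e ^+ 6 * w2 -> 1 <= C ->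
  2 * C * (e * (- ln e)) * expR 1 <= 1 -> C * w2 <= 1 / 4 ->
  0 < eta -> eta <= 1 / 8 -> 8 * C ^+ 2 * eta <= 1 ->
  (forall y, y \in `[lo, hi] -> ode k2 bw v q r p g g1 y) ->
  (forall y, y \in `[lo, hi] -> [/\ `|p y| <= C * w2, 0 <= bw * (v y - g y) ^+ 2 <= C * w2 &
     `|2 * bw * (v y - g y) * g1 y| <= C * w2]) ->
  (forall s t, s \in `[lo, hi] -> t \in `[lo, hi] -> `|v t - v s| <= eta) ->
  lo + 4 * eta <= y1 -> y1 + 4 * eta + e ^+ 2 <= hi ->
  `|q y1| <= 1.
Proof.
move=> e0 e1 w2E k2E C1 small P4 eta0 eta8 etaC hode hP hosc lo1 hi1.
have lam0 : 0 < - ln e by rewrite oppr_gt0 ln_lt0// e0.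
have w20 : 0 < w2 by rewrite w2E mulr_gt0// exprn_gt0.
have k20 : 0 < k2 by rewrite k2E mulr_gt0// exprn_gt0.
have C0 : 0 < C by apply: lt_le_trans C1.
have P0 : 0 < C * w2 by rewrite mulr_gt0.
have e20 : 0 < e ^+ 2 by rewrite exprn_gt0.
have Lam : - ln e <= - ln (2 * (C * w2)) - 1.
  have P2 : 0 < 2 * (C * w2) by rewrite mulr_gt0.
  suff : ln (2 * (C * w2)) + 1 <= ln e by clear; lra.
  rewrite -[X in _ + X]expRK -lnM ?posrE ?expR_gt0// ler_ln ?posrE ?mulr_gt0 ?expR_gt0//.
  rewrite w2E (_ : 2 * (C * (e ^+ 2 * - ln e)) * expR 1 = e * (2 * C * (e * - ln e) * expR 1)).
    by rewrite ler_piMr// ltW.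
  by ring.
have Lam0 := lt_le_trans lam0 Lam.
(* The longest interval over which a spike is guaranteed to persist. *)
have s00 : 0 < e ^+ 2 / (2 * C) by rewrite divr_gt0// mulr_gt0.
have s0e : e ^+ 2 / (2 * C) <= e ^+ 2.
  by rewrite ler_pdivrMr ?mulr_gt0// ler_peMr ?(ltW e20)//; move: C1; clear; lra.
apply: (no_spike k20 P0 P4 eta0 eta8 s00 hode hP hosc lo1 _ Lam0).
- by apply: le_trans hi1; rewrite lerD2l.
- apply: (@lt_le_trans _ _ ((- ln e) * k2)); last by rewrite ler_pM2r.
  rewrite (_ : 2 * _ ^+ 2 * _ = (- ln e) * k2 / 2); last first.
    by rewrite k2E w2E; field; rewrite gt_eqF.
  have : 0 < - ln e * k2 by rewrite mulr_gt0.
  clear; lra.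
- apply: (@lt_le_trans _ _ (e ^+ 2 / (2 * C) * (- ln e) / (2 * (C * w2)))); last first.
    by rewrite ler_pM2r ?invr_gt0 ?mulr_gt0// ler_pM2l.
  rewrite (_ : _ / _ = 1 / (4 * C ^+ 2)); last first.
    by rewrite w2E; move: lam0; move: (- ln e) => lm lm0; field; rewrite !gt_eqF.
  rewrite ltr_pdivlMr ?mulr_gt0 ?exprn_gt0//.
  have : 0 < C ^+ 2 * eta by rewrite mulr_gt0 ?exprn_gt0.
  move: etaC; clear; lra.
Qed.

(** With layers of width e^2 the curvature term k2 l^-3 and the logarithmic term
    l |ln l| are both of order e^2 |ln e| = w2.  This is the balance behind the
    choice of the exponents in the functional. *)
Lemma energy_scaled beta v q r p g g1 E (e w2 k2 lo hi a b K L m H0 : R) :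
  0 < e -> e < 1 -> 1 <= - ln e -> w2 = e ^+ 2 * (- ln e) -> k2 = e ^+ 6 * w2 -> 0 < beta ->
  0 <= K -> lo < a -> b < hi -> 0 < H0 -> H0 <= b - a -> b - a <= 2 * H0 ->
  m = 2 * (42 * (2 * K + 1) + 12) -> (2 * (4 * K + 2 + m) ^+ 2 + 4) * e ^+ 2 <= H0 ->
  (forall y, y \in `]lo, hi[ -> ode k2 (beta * w2) v q r p g g1 y) ->
  beats k2 (beta * w2) v q r g a b ->
  (forall y, y \in `[a, b] -> `|v y| <= K /\ `|g y - L| <= K) ->
  `|q a| <= 1 -> `|q b| <= 1 ->
  (forall y, y \in `[a, b] -> is_derive y 1 E (k2 * r y ^+ 2 + ln (1 + q y ^+ 2))) ->
  let C := 2 * m ^+ 2 + 2 * (ln (1 + m ^+ 2) + 4) +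
    beta * (H0 + ((K + 1) ^+ 2 + 2 * K * (2 * K + 1)) * (2 * H0)) in
  `|L| <= C / (beta * H0) /\ E b - E a <= C * w2.
Proof.
move=> e0 e1 lam1 w2E k2E beta0 K0 loa bhi H00 ba ba2 mE small hode hb hK qa qb dE C.
have lam0 : 0 < - ln e by exact: lt_le_trans lam1.
have w20 : 0 < w2 by rewrite w2E mulr_gt0// exprn_gt0.
have k20 : 0 < k2 by rewrite k2E mulr_gt0// exprn_gt0.
have bw0 : 0 < beta * w2 by rewrite mulr_gt0.
have e20 : 0 < e ^+ 2 by rewrite exprn_gt0.
have e21 : e ^+ 2 <= 1 by rewrite exprn_ile1// ltW.
set D := (4 * K + 2 + m) ^+ 2 in small.
have D0 : 0 <= D by rewrite sqr_ge0.
have De : 0 <= D * e ^+ 2 by rewrite mulr_ge0// ltW.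
have abl : a + e ^+ 2 <= b - e ^+ 2 by move: small De ba e20; clear; lra.
have := energy_bound k20 bw0 K0 loa bhi e20 e21 abl hode hb hK qa qb dE mE.
rewrite -/D; set C0 := _ + 2 * K * (2 * K + 1) => Ele.
have C00 : 0 <= C0 by rewrite /C0 addr_ge0 ?sqr_ge0// !mulr_ge0//; move: K0; clear; lra.
have m1 : 1 <= 1 + m ^+ 2 by rewrite lerDl sqr_ge0.
have t1 : k2 * (m / (e ^+ 2) ^+ 2) ^+ 2 * e ^+ 2 = m ^+ 2 * w2.
  by rewrite k2E; field; rewrite gt_eqF.
have t2 : ln (1 + (m / e ^+ 2) ^+ 2) * e ^+ 2 <= (ln (1 + m ^+ 2) + 4) * w2.
  have -> : (ln (1 + m ^+ 2) + 4) * w2 = (ln (1 + m ^+ 2) * - ln e + 4 * - ln e) * e ^+ 2.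
    by rewrite w2E; ring.
  rewrite ler_pM2r//; apply: (@le_trans _ _ (ln (1 + m ^+ 2) + 4 * - ln e)); last first.
    by rewrite lerD2r ler_peMr// ln_ge0.
  have -> : 4 * - ln e = ln ((e ^+ 4)^-1).
    by rewrite lnV ?posrE ?exprn_gt0// lnXn// mulrN mulr_natl.
  rewrite -lnM ?posrE ?invr_gt0 ?exprn_gt0 ?den_gt0// ler_ln ?posrE ?den_gt0//; last first.
    by rewrite divr_gt0 ?den_gt0// exprn_gt0.
  rewrite expr_div_n -exprM mulrDl mul1r lerD2r -[X in X <= _]invr1 lef_pV2 ?posrE ?exprn_gt0//.
  by rewrite exprn_ile1// ltW.
have Ln : 0 <= `|L| by [].
have w2C : beta * w2 * (2 * e ^+ 2 * (D * (1 + `|L|)) + (C0 - 2 * `|L|) * (b - a - 2 * e ^+ 2)) <=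
   beta * w2 * (H0 + C0 * (2 * H0) - H0 * `|L|).
  rewrite ler_pM2l//.
  have x1 : 2 * e ^+ 2 * D <= H0 by move: small e20; clear; lra.
  have x2 : (2 * e ^+ 2 * D - 2 * (b - a) + 4 * e ^+ 2) * `|L| <= - H0 * `|L|.
    by apply: ler_wpM2r => //; move: small ba; clear; lra.
  have x3 : C0 * (b - a - 2 * e ^+ 2) <= C0 * (2 * H0).
    by apply: ler_wpM2l => //; move: ba2 e20; clear; lra.
  move: x1 x2 x3; clear; lra.
have final : E b - E a <= (C - beta * H0 * `|L|) * w2.
  apply: le_trans Ele _.
  have t1' : 2 * (k2 * (m / (e ^+ 2) ^+ 2) ^+ 2 * e ^+ 2) = 2 * (m ^+ 2 * w2) by rewrite t1.
  apply: (@le_trans _ _ (2 * (k2 * (m / (e ^+ 2) ^+ 2) ^+ 2 * e ^+ 2) +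
    2 * (ln (1 + (m / e ^+ 2) ^+ 2) * e ^+ 2) +
    beta * w2 * (2 * e ^+ 2 * (D * (1 + `|L|)) + (C0 - 2 * `|L|) * (b - a - 2 * e ^+ 2)))).
    by apply: eq_leR; ring.
  by rewrite t1' /C -/C0; move: t2 w2C; clear; lra.
have E0 : 0 <= E b - E a.
  have ab : a <= b by move: ba H00; clear; lra.
  have := @mvt_ge R E _ a b 0 ab dE; rewrite mul0r; apply => y _.
  by apply: addr_ge0; [rewrite mulr_ge0 ?sqr_ge0// ltW|exact: ln1Dsqr_ge0].
have bH : 0 < beta * H0 by rewrite mulr_gt0.
split.
  have := le_trans E0 final; rewrite pmulr_lge0// subr_ge0.
  by rewrite ler_pdivlMr// mulrC.
by apply: le_trans final _; rewrite ler_pM2r// gerBl mulr_ge0// ltW.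
Qed.

End Scaled.

(** * The blow-up of a minimizer *)

Section BlowUp.
Context {R : realType}.
Notation mu := (@lebesgue_measure R).

Lemma C1_data (a b : R) (f : R -> R) : Defs.C1 a b f -> L2 a b f /\
  exists2 f1 : R -> R, (forall x, x \in `]a, b[ -> is_derive x 1 f (f1 x)) &
    (forall x, x \in `]a, b[ -> continuous_at x f1).
Proof.
move=> [f1 [cf cf1 df]].
have inner (h : R -> R) : {within `[a, b], continuous h} ->
    forall x, x \in `]a, b[ -> continuous_at x h.
  move=> ch x xab; have ab : a < b by move: xab; rewrite in_itv/= => /andP[/lt_trans]; exact.
  exact: (within_continuous_continuous ab ch xab).
split; last by exists f1; [exact: df|exact: inner].
have [M [_ hM]] := compact_bounded (continuous_compact cf (@segment_compact _ a b)).
apply: (L2_bounded (M := M + 1)); first by apply: cont_measurable; exact: inner.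
move=> x /subset_itv_oo_cc xab; apply: (hM (M + 1)); first by rewrite ltrDl.
by exists x.
Qed.

Lemma omega_gt0 (eps : R) : 0 < eps -> eps < 1 -> 0 < omega eps.
Proof.
move=> e0 e1; rewrite /omega mulr_gt0// sqrtr_gt0 normr_gt0 lt_eqF// ln_lt0//.
by rewrite e0.
Qed.

Lemma omega_sqr (eps : R) : 0 < eps -> eps < 1 -> omega eps ^+ 2 = eps ^+ 2 * (- ln eps).
Proof.
move=> e0 e1; rewrite /omega exprMn sqr_sqrtr// ltr0_norm// ln_lt0//.
by rewrite e0.
Qed.

Lemma minimizer_system (eps beta : R) (f u : R -> R) : 0 < eps -> eps < 1 ->
  Defs.C1 0 1 f -> is_minimizer_PMF eps beta f u ->
  let A := eps ^+ 6 * omega eps ^+ 4 in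
  exists u1 u2 p : R -> R,
    (forall x : R, x \in `]0, 1[ -> [/\ is_derive x 1 u (u1 x), is_derive x 1 u1 (u2 x),
      is_derive x 1 u2 ((u1 x / (1 + u1 x ^+ 2) + p x) / A) &
      is_derive x 1 p (- (beta * (u x - f x)))]) /\
    forall (c d : R) (w w1 w2 E : R -> R), 0 < c -> c < d -> d < 1 ->
      (forall x, x \in `[c, d] -> [/\ is_derive x 1 w (w1 x), is_derive x 1 w1 (w2 x) &
         continuous_at x w2]) ->
      w c = u c -> w d = u d -> w1 c = u1 c -> w1 d = u1 d ->
      (forall x, x \in `[c, d] -> is_derive x 1 E
         (density A beta f u u1 u2 x - density A beta f w w1 w2 x)) ->
      E d <= E c.
Proof.
move=> e0 e1 hf [hu cu umin] A.
have [lf [f1 df cf1]] := C1_data hf.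
have A0 : 0 < A by rewrite mulr_gt0// exprn_gt0// omega_gt0.
have le (w w1 w2 v v1 v2 : R -> R) : weak2 0 1 w w1 w2 -> weak2 0 1 v v1 v2 ->
    (PMF eps beta f 0 1 w <= PMF eps beta f 0 1 v)%E ->
    \int[mu]_(x in `]0, 1[) density A beta f w w1 w2 x <=
    \int[mu]_(x in `]0, 1[) density A beta f v v1 v2 x.
  by move=> hw hv; rewrite (PMF_weak2 eps beta lf hw) (PMF_weak2 eps beta lf hv) lee_fin.
have huw := H2_weak2 hu.
have cu' (x : R) : x \in `]0, 1[ -> continuous_at x u by move=> h; exact: cu.
have cf (x : R) : x \in `]0, 1[ -> continuous_at x f by move=> h; exact: (is_derive_continuous (df x h)).
have umin1 (w w1 w2 : R -> R) : weak2 0 1 w w1 w2 ->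
    \int[mu]_(x in `]0, 1[) density A beta f u (wderiv 0 1 u) (wderiv 0 1 (wderiv 0 1 u)) x <=
    \int[mu]_(x in `]0, 1[) density A beta f w w1 w2 x.
  by move=> hw; apply: le => //; apply: umin; have [] := weak2_H2 hw.
have [u1 [u2 [p [hu1 H]]]] := minimizer_regular ltr01 A0 lf huw umin1 cu' cf.
exists u1, u2, p; split=> //.
have umin2 (w w1 w2 : R -> R) : weak2 0 1 w w1 w2 ->
    \int[mu]_(x in `]0, 1[) density A beta f u u1 u2 x <=
    \int[mu]_(x in `]0, 1[) density A beta f w w1 w2 x.
  by move=> hw; apply: le => //; apply: umin; have [] := weak2_H2 hw.
apply: (local_comparison ltr01 lf hu1 umin2) => x h.
have [h1 h2 h3 _] := H x h; split; [exact: h1|exact: h2| |exact: cf].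
exact: (is_derive_continuous h3).
Qed.

Lemma is_derive_affine (h : R -> R) (c s y d : R) : is_derive (c + s * y) 1 h d ->
  is_derive y 1 (fun y => h (c + s * y)) (s * d).
Proof.
move=> dh; have da : is_derive y 1 (fun y : R => c + s * y) s.
  by apply: is_derive_eq; rewrite /GRing.scale/=; ring.
by have := @is_derive1_comp R h _ y _ _ dh da; rewrite mulrC.
Qed.

(** Under x = x_e + omega y the system and the minimality keep their form, with
    k2 = eps^6 omega^2 and bw = beta omega^2.  A competitor for the blow-up is
    transported back by the same change of variables. *)
Lemma blowup_system (beta : R) (f f1 : R -> R) (u : R -> R -> R) (x : R -> R) (eps W : R) :
  0 < eps -> eps < 1 -> Defs.C1 0 1 f -> is_minimizer_PMF eps beta f (u eps) ->
  (forall z : R, z \in `]0, 1[ -> is_derive z 1 f (f1 z)) ->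
  (forall y : R, y \in `](- W), W[ -> x eps + omega eps * y \in `]0, 1[) ->
  let w2 := omega eps ^+ 2 in
  let v := blow_up u x eps in
  let g (y : R) := (f (x eps + omega eps * y) - u eps (x eps)) / omega eps in
  let g1 (y : R) := f1 (x eps + omega eps * y) in
  exists q r p : R -> R,
    (forall y : R, y \in `](- W), W[ -> ode (eps ^+ 6 * w2) (beta * w2) v q r p g g1 y) /\
    forall a b : R, - W < a -> a < b -> b < W -> beats (eps ^+ 6 * w2) (beta * w2) v q r g a b.
Proof.
move=> e0 e1 hf hmin df win w2 v g g1.
have [u1 [u2 [p [H Hcmp]]]] := minimizer_system e0 e1 hf hmin.
have w0 := omega_gt0 e0 e1; set w := omega eps in w0 win w2 g g1 H Hcmp *.
have wn0 : w != 0 by rewrite gt_eqF.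
have en0 : eps != 0 by rewrite gt_eqF.
pose q (y : R) := u1 (x eps + w * y); pose r (y : R) := w * u2 (x eps + w * y).
pose P (y : R) := p (x eps + w * y).
have vE (y : R) : u eps (x eps + w * y) = u eps (x eps) + w * v y.
  by rewrite /v /blow_up -/w; field.
have gE (y : R) : f (x eps + w * y) = u eps (x eps) + w * g y.
  by rewrite /g; field.
exists q, r, P; split.
  move=> y yW; have xy := win y yW; have [h1 h2 h3 h4] := H _ xy; split.
  - have h := is_derive_affine h1; rewrite /v /blow_up -/w.
    by apply: is_derive_eq; rewrite /GRing.scale/= /q; field.
  - exact: is_derive_affine h2.
  - have h := is_derive_affine h3; rewrite /r.
    apply: is_derive_eq; rewrite /GRing.scale/= /q /P /w2; field.
    by rewrite wn0 en0 gt_eqF ?den_gt0.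
  - have := is_derive_affine h4; rewrite vE gE => h.
    by apply: is_derive_eq; rewrite /w2; ring.
  - have h := is_derive_affine (df _ xy); rewrite /g.
    by apply: is_derive_eq; rewrite /GRing.scale/= /g1; field.
move=> a b Wa ab bW W0 W1 W2 G dW Wa0 Wb0 Wa1 Wb1 dG.
pose c := x eps + w * a; pose d := x eps + w * b.
have cd : c < d by rewrite ltrD2l ltr_pM2l.
have aW : a \in `](- W), W[ by rewrite in_itv/= Wa (lt_trans ab).
have bW' : b \in `](- W), W[ by rewrite in_itv/= bW (lt_trans Wa).
have c0 : 0 < c by have := win a aW; rewrite in_itv/= => /andP[].
have d1 : d < 1 by have := win b bW'; rewrite in_itv/= => /andP[].
pose Y (z : R) : R := (z - x eps) / w.
have YE (y : R) : Y (x eps + w * y) = y by rewrite /Y; field.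
have YI (z : R) : z \in `[c, d] -> Y z \in `[a, b].
  rewrite !in_itv/= => /andP[cz zd]; rewrite ler_pdivlMr// ler_pdivrMr//.
  by rewrite lerBrDl lerBlDl !(mulrC _ w) cz zd.
have dY (h : R -> R) (z e : R) : is_derive (Y z) 1 h e -> is_derive z 1 (fun z => h (Y z)) (e / w).
  move=> dh; have dYz : is_derive z 1 Y w^-1.
    by rewrite /Y; apply: is_derive_eq; rewrite /GRing.scale/=; ring.
  exact: (@is_derive1_comp R h Y z _ _ dh dYz).
pose ww (z : R) : R := u eps (x eps) + w * W0 (Y z).
pose ww1 (z : R) : R := W1 (Y z); pose ww2 (z : R) : R := W2 (Y z) / w.
have zE (z : R) : x eps + w * Y z = z by rewrite /Y; field.
have Yc : Y c = a by exact: YE.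
have Yd : Y d = b by exact: YE.
have dww z : z \in `[c, d] -> [/\ is_derive z 1 ww (ww1 z), is_derive z 1 ww1 (ww2 z) &
    continuous_at z ww2].
  move=> /YI h; have [h1 h2 h3] := dW _ h.
  have k1 := dY _ _ _ h1; have k2 := dY _ _ _ h2; split.
  + rewrite /ww; apply: is_derive_eq; rewrite /GRing.scale/= /ww1; field.
    exact: wn0.
  + exact: k2.
  + apply: contM; last exact: cont_cst.
    apply: (@cont_comp _ Y W2); last exact: h3.
    by apply: contM; [apply: contB; [|exact: cont_cst]|exact: cont_cst].
have dGG z : z \in `[c, d] -> is_derive z 1 (fun z => w * G (Y z))
    (density (eps ^+ 6 * w ^+ 4) beta f (u eps) u1 u2 z -
     density (eps ^+ 6 * w ^+ 4) beta f ww ww1 ww2 z).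
  move=> zI; have k := dY _ _ _ (dG _ (YI z zI)).
  apply: is_derive_eq; rewrite /GRing.scale/= /density /q /r /ww /ww1 /ww2 zE.
  have fz := gE (Y z); have uz := vE (Y z); rewrite zE in fz uz.
  rewrite fz uz /w2; field.
  exact: wn0.
have b1 : ww c = u eps c by rewrite /ww Yc Wa0 -vE.
have b2 : ww d = u eps d by rewrite /ww Yd Wb0 -vE.
have b3 : ww1 c = u1 c by rewrite /ww1 Yc Wa1.
have b4 : ww1 d = u1 d by rewrite /ww1 Yd Wb1.
have := Hcmp c d ww ww1 ww2 (fun z => w * G (Y z)) c0 cd d1 dww b1 b2 b3 b4 dGG.
by rewrite Yc Yd ler_pM2l.
Qed.

End BlowUp.

(** * Vanishing quantities and values of the staircase *)

Section Small.
Context {R : realType}.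
Implicit Types (e d : R).

Lemma near_small d : 0 < d -> \forall e \near (0 : R)^'+, e <= d.
Proof. by move=> d0; near=> e; rewrite ltW//; near: e; exact: nbhs_right_lt. Unshelve. all: by end_near. Qed.

Lemma near_unit : \forall e \near (0 : R)^'+, [/\ 0 < e, e < 1 & 1 <= - ln e].
Proof.
near=> e; have e0 : 0 < e by near: e; exact: nbhs_right_gt.
split; [exact: e0|by near: e; exact: (nbhs_right_lt ltr01)|].
rewrite lerNr -(expRK (-1)) ler_ln ?posrE ?expR_gt0//.
by near: e; apply: near_small; exact: expR_gt0.
Unshelve. all: by end_near. Qed.

(** From ln(1/s) <= 1/s with s = sqrt e. *)
Lemma near_elog d : 0 < d -> \forall e \near (0 : R)^'+, e * (- ln e) <= d.
Proof.
move=> d0; near=> e; have e0 : 0 < e by near: e; exact: nbhs_right_gt.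
have s0 : 0 < Num.sqrt e by rewrite sqrtr_gt0.
have eE : e = Num.sqrt e ^+ 2 by rewrite sqr_sqrtr// ltW.
have h : - ln (Num.sqrt e) <= (Num.sqrt e)^-1.
  by rewrite -lnV ?posrE//; apply/ltW/ln_sublinear; rewrite invr_gt0.
have lnE : - ln e = 2 * - ln (Num.sqrt e) by rewrite {1}eE lnXn// mulrN mulr_natl.
have sd : Num.sqrt e <= d / 2.
  have e2 : e <= (d / 2) ^+ 2.
    by near: e; apply: near_small; rewrite exprn_gt0// divr_gt0.
  have d2 : 0 <= d / 2 by rewrite ltW// divr_gt0.
  by rewrite -(@ler_pXn2r _ 2) ?nnegrE ?(ltW s0)// -eE.
rewrite lnE [X in X * _]eE.
apply: (@le_trans _ _ (Num.sqrt e ^+ 2 * (2 * (Num.sqrt e)^-1))).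
  by rewrite ler_pM2l ?exprn_gt0// ler_pM2l.
rewrite (_ : _ * _ = 2 * Num.sqrt e); last by field; rewrite gt_eqF.
by move: sd; clear; lra.
Unshelve. all: by end_near. Qed.

Lemma near_omega2 d : 0 < d -> \forall e \near (0 : R)^'+, omega e ^+ 2 <= d.
Proof.
move=> d0; near=> e; have [e0 e1 l1] : [/\ 0 < e, e < 1 & 1 <= - ln e] by near: e; exact: near_unit.
rewrite omega_sqr// expr2 -mulrA; apply: (@le_trans _ _ (e * (- ln e))).
  by rewrite ler_piMl ?(ltW e1)// mulr_ge0// ltW// (lt_le_trans ltr01).
by near: e; exact: near_elog.
Unshelve. all: by end_near. Qed.

Lemma near_omega d : 0 < d -> \forall e \near (0 : R)^'+, omega e <= d.
Proof.
move=> d0; near=> e; have [e0 e1 l1] : [/\ 0 < e, e < 1 & 1 <= - ln e] by near: e; exact: near_unit.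
have e2 : omega e ^+ 2 <= d ^+ 2 by near: e; apply: near_omega2; rewrite exprn_gt0.
by rewrite -(@ler_pXn2r _ 2) ?nnegrE ?(ltW d0) ?(ltW (omega_gt0 e0 e1)).
Unshelve. all: by end_near. Qed.

Lemma near_window (x : R -> R) (x0 W rad : R) : 0 < W -> 0 < rad -> x e @[e --> 0^'+] --> x0 ->
  \forall e \near (0 : R)^'+, forall y, y \in `](- W), W[ -> `|x e + omega e * y - x0| < rad.
Proof.
move=> W0 r0 xx; near=> e.
have [e0 e1 l1] : [/\ 0 < e, e < 1 & 1 <= - ln e] by near: e; exact: near_unit.
have xe : `|x e - x0| < rad / 2.
  near: e; have r2 : 0 < rad / 2 by exact: divr_gt0.
  by move/cvgrPdistC_lt : xx; exact.
have w : omega e <= rad / (2 * W) by near: e; apply: near_omega; rewrite divr_gt0// mulr_gt0.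
move=> y; rewrite in_itv/= => /andP[y1 y2].
have wy : `|omega e * y| <= rad / 2.
  rewrite normrM (gtr0_norm (omega_gt0 e0 e1)).
  apply: (@le_trans _ _ (rad / (2 * W) * W)); last first.
    by apply: eq_leR; field; rewrite gt_eqF.
  apply: ler_pM => //; first exact/ltW/omega_gt0.
  by rewrite ler_norml !ltW// ?ltrNl.
rewrite addrAC; apply: le_lt_trans (ler_normD _ _) _; move: xe wy; clear; lra.
Unshelve. all: by end_near. Qed.

End Small.

Section Staircase.
Context {R : realType}.
Implicit Types (H V a b c y : R).

(** The k-th step of the canonical staircase is the interval of length 2H centred
    at 2kH. *)
Lemma staircase_val H V y (k : int) : 0 < H ->
  y \in `](H * (2 * k%:~R - 1)), (H * (2 * k%:~R + 1))[ -> staircase H V y = V * (2 * k%:~R).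
Proof.
move=> H0; rewrite in_itv/= => /andP[y1 y2]; rewrite /staircase /canonical_staircase.
suff -> : Num.floor ((y / H + 1) / 2) = k by [].
apply: floor_def; rewrite intrD1.
have : 2 * k%:~R - 1 < y / H by rewrite ltr_pdivlMr// mulrC.
have : y / H < 2 * k%:~R + 1 by rewrite ltr_pdivrMr// mulrC.
by move=> h1 h2; apply/andP; split; lra.
Qed.

Lemma not_jump (v : R -> R) a b c y : y \in `]a, b[ -> (forall z, z \in `]a, b[ -> v z = c) ->
  ~ jump_point v y.
Proof.
move=> yab vc [l [r [vl vr /eqP]]]; apply.
have nv : \forall z \near y, v z = c.
  by near=> z; apply: vc; near: z; exact: near_in_itvoo.
have lc : v z @[z --> y^'-] --> c.
  by apply: cvg_near_cst; rewrite near_withinE; apply: filterS nv => z h _.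
have rc : v z @[z --> y^'+] --> c.
  by apply: cvg_near_cst; rewrite near_withinE; apply: filterS nv => z h _.
by rewrite (cvg_unique (@Rhausdorff R) vl lc) (cvg_unique (@Rhausdorff R) vr rc).
Unshelve. all: by end_near. Qed.

End Staircase.

(** * Energy of the blow-up family *)

Section Family.
Context {R : realType}.
Implicit Types (beta H m V e d : R) (v q r p g : R -> R -> R) (L : R -> R).

Definition minimal_system beta H e (v q r p g g1 : R -> R) : Prop :=
  (forall y, y \in `](- (2 * H)), (2 * H)[ ->
     ode (e ^+ 6 * omega e ^+ 2) (beta * omega e ^+ 2) v q r p g g1 y) /\
  forall a b, - (2 * H) < a -> a < b -> b < 2 * H ->
    beats (e ^+ 6 * omega e ^+ 2) (beta * omega e ^+ 2) v q r g a b.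

Definition uniform_step v (l lo hi : R) : Prop :=
  forall a b eta, lo < a -> a < b -> b < hi -> 0 < eta ->
    \forall e \near (0 : R)^'+, forall y : R, y \in `[a, b] -> `|v e y - l| <= eta.

(** Everything that the asymptotic analysis uses about the blow-ups v_e: the
    system and the minimality on ]-2H, 2H[, uniform convergence to 0 and to 2V on
    the two steps around 0 and 2H, and g_e(y) = L_e + m y + o(1) for the datum.
    Here m is the derivative of f at x0 and L_e is still uncontrolled. *)
Record blowup_family beta H m V v q r p g (g1 : R -> R -> R) L : Prop := BlowupFamily {
  family_signs : [/\ 0 < beta, 0 < H, m != 0 & V = m * H];
  family_system : \forall e \near (0 : R)^'+,
    minimal_system beta H e (v e) (q e) (r e) (p e) (g e) (g1 e);
  family_bounded : exists K, \forall e \near (0 : R)^'+,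
    forall y : R, y \in `](- (2 * H)), (2 * H)[ -> `|v e y| <= K;
  family_low_step : uniform_step v 0 (- H) H;
  family_high_step : uniform_step v (2 * V) H (2 * H);
  family_datum : forall d, 0 < d -> \forall e \near (0 : R)^'+,
    forall y : R, y \in `](- (2 * H)), (2 * H)[ ->
      `|g e y - L e - m * y| <= d /\ `|g1 e y - m| <= d }.

Lemma sub_window H c d (y : R) : - (2 * H) < c -> d < 2 * H -> y \in `[c, d] ->
  y \in `](- (2 * H)), (2 * H)[.
Proof.
by move=> hc hd; rewrite !in_itv/= => /andP[cy yd]; rewrite (lt_le_trans hc cy) (le_lt_trans yd hd).
Qed.

Lemma expr6_le e : 0 < e -> e < 1 -> 0 <= e ^+ 6 <= e.
Proof.
move=> e0 e1; rewrite exprn_ge0 ?(ltW e0)//= exprS ler_piMr ?(ltW e0)//.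
by rewrite exprn_ile1// ltW.
Qed.

Lemma low_step beta H m V v q r p g (g1 : R -> R -> R) L a b eta :
  blowup_family beta H m V v q r p g g1 L -> - H < a -> a < b -> b < H -> 0 < eta ->
  \forall e \near (0 : R)^'+, forall y : R, y \in `[a, b] -> `|v e y| <= eta.
Proof.
move=> F ha ab hb eta0; apply: filterS (family_low_step F ha ab hb eta0) => e he y /he.
by rewrite subr0.
Qed.

Lemma crude_bounds beta H m V v q r p g (g1 : R -> R -> R) L : blowup_family beta H m V v q r p g g1 L ->
  exists2 K, 0 <= K & \forall e \near (0 : R)^'+,
  forall y : R, y \in `](- (2 * H)), (2 * H)[ ->
    [/\ `|v e y| <= K, `|g e y - L e| <= K & `|g1 e y| <= K].
Proof.
move=> F; have [beta0 H0 m0 VE] := family_signs F.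
have [K hK] := family_bounded F.
exists (`|K| + `|m| * (2 * H) + 1 + `|m|).
  by rewrite !addr_ge0// mulr_ge0// mulr_ge0// ltW.
near=> e.
have vKe : forall y : R, y \in `](- (2 * H)), (2 * H)[ -> `|v e y| <= K by near: e.
have gd1 : forall y : R, y \in `](- (2 * H)), (2 * H)[ ->
    `|g e y - L e - m * y| <= 1 /\ `|g1 e y - m| <= 1 by near: e; exact: (family_datum F).
move=> y yI; have vK := vKe y yI; have [gd g1d] := gd1 y yI.
have y2 : `|m * y| <= `|m| * (2 * H).
  rewrite normrM ler_wpM2l// ler_norml; move: yI; rewrite in_itv/= => /andP[y1 y2].
  by rewrite !ltW.
have KK := ler_norm K; have mm := normr_ge0 m; have K0 := normr_ge0 K.
have mH : 0 <= `|m| * (2 * H) by rewrite mulr_ge0// mulr_ge0// ltW.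
split; first by move: vK KK mm mH; clear; lra.
- have := ler_normD (g e y - L e - m * y) (m * y); rewrite subrK.
  by move: gd y2 K0 mm; clear; lra.
- have := ler_normD (g1 e y - m) m; rewrite subrK.
  by move: g1d K0 mm mH; clear; lra.
Unshelve. all: by end_near. Qed.

(** Choose on the steps around 0 and 2H points where the slope is moderate and
    compare between them.  The energy bound also controls L_e, and the jump of v
    across H turns it into a bound for p at one point. *)
Lemma energy_estimate beta H m V v q r p g (g1 : R -> R -> R) L : blowup_family beta H m V v q r p g g1 L ->
  exists2 C, 0 <= C & \forall e \near (0 : R)^'+,
  `|L e| <= C /\ exists2 c : R, c \in `[(- (7 / 4 * H)), (7 / 4 * H)] & `|p e c| <= C * omega e ^+ 2.
Proof.
move=> F; have [beta0 H0 m0 VE] := family_signs F.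
have [K K0 crude] := crude_bounds F.
pose M : R := 2 * (42 * (2 * K + 1) + 12).
pose CE := 2 * M ^+ 2 + 2 * (ln (1 + M ^+ 2) + 4) +
    beta * (H + ((K + 1) ^+ 2 + 2 * K * (2 * K + 1)) * (2 * H)).
pose CL := CE / (beta * H).
pose D := 2 * K + CL.
pose CP := (CE + 2 * (4 / H) + 2 * (beta * D) * K * (2 * H)) / `|V|.
exists (`|CL| + `|CP|); first by rewrite addr_ge0.
have Q0 : 0 < (2 * (4 * K + 2 + M) ^+ 2 + 4) by rewrite ltr_wpDl// mulr_ge0// sqr_ge0.
have V0 : 0 < `|V| by rewrite normr_gt0 VE mulf_neq0// gt_eqF.
have low (t : R) : 0 < t -> \forall e \near (0 : R)^'+, forall y, y \in `[(H / 4), (H / 4 + 3 * (H / 8))] -> `|v e y| <= t.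
  by move=> t0; apply: (low_step F) => //; move: (H0); clear; lra.
have high (t : R) : 0 < t -> \forall e \near (0 : R)^'+, forall y, y \in `[(5 * H / 4), (5 * H / 4 + 3 * (H / 8))] -> `|v e y - 2 * V| <= t.
  by move=> t0; apply: (family_high_step F) => //; move: (H0); clear; lra.
(* H/16 for the oscillation over windows of length 3H/8; |V|/4 so that v jumps by at least |V|. *)
have t0 : 0 < Num.min (H / 16) (`|V| / 4).
  by rewrite lt_min !divr_gt0.
near=> e.
have [e0 e1 l1] : [/\ 0 < e, e < 1 & 1 <= - ln e] by near: e; exact: near_unit.
have es : e <= H / (2 * (4 * K + 2 + M) ^+ 2 + 4) by near: e; apply: near_small; exact: divr_gt0.
have [hode hb] : minimal_system beta H e (v e) (q e) (r e) (p e) (g e) (g1 e).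
  by near: e; exact: (family_system F).
have hc : forall y : R, y \in `](- (2 * H)), (2 * H)[ ->
    [/\ `|v e y| <= K, `|g e y - L e| <= K & `|g1 e y| <= K] by near: e.
have lowe : forall y, y \in `[(H / 4), (H / 4 + 3 * (H / 8))] -> `|v e y| <= Num.min (H / 16) (`|V| / 4).
  by near: e; exact: low.
have highe : forall y, y \in `[(5 * H / 4), (5 * H / 4 + 3 * (H / 8))] -> `|v e y - 2 * V| <= Num.min (H / 16) (`|V| / 4).
  by near: e; exact: high.
have w2E := omega_sqr e0 e1; set w2 := omega e ^+ 2 in w2E hode hb *.
have w20 : 0 < w2 by rewrite exprn_gt0// omega_gt0.
have bw0 : 0 < beta * w2 by exact: mulr_gt0.
have e6 := expr6_le e0 e1.
have h80 : 0 < H / 8 by rewrite divr_gt0.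
have good (s : R) (V' : R) : 0 < s -> s + 3 * (H / 8) < 2 * H ->
    (forall y, y \in `[s, (s + 3 * (H / 8))] -> `|v e y - V'| <= Num.min (H / 16) (`|V| / 4)) ->
    exists a c b, [/\ s < a < s + H / 8, s + 2 * (H / 8) < b < s + 3 * (H / 8), a < c < b,
      `|q e a| <= 1 /\ `|q e b| <= 1 & `|q e c * r e c| <= 1 / (2 * (H / 8))].
  move=> s0 s2 hs; apply: (@good_points R (v e) (q e) (r e) s (H / 8) h80).
    have s1 : - (2 * H) < s by move: s0 (H0); clear; lra.
    by move=> y yI; have [h1 h2 _ _ _] := hode y (sub_window s1 s2 yI).
  move=> y z /hs + /hs; rewrite !le_min => /andP[h1 _] /andP[h2 _].
  have := ler_distD V' (v e z) (v e y); rewrite [`|V' - _|]distrC.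
  by move: h1 h2; clear; lra.
have [a1 [c1 [b1 [/andP[sa1 a1h] /andP[_ b1s] /andP[ac1 cb1] [qa1 _] qc1]]]] : exists a c b, [/\ H / 4 < a < H / 4 + H / 8, H / 4 + 2 * (H / 8) < b < H / 4 + 3 * (H / 8), a < c < b,
      `|q e a| <= 1 /\ `|q e b| <= 1 & `|q e c * r e c| <= 1 / (2 * (H / 8))].
  apply: (good _ 0); [by move: (H0); clear; lra..|].
  by move=> y yI; rewrite subr0; exact: lowe.
have [a2 [c2 [b2 [/andP[sa2 _] /andP[sb2 b2s] /andP[ac2 cb2] [_ qb2] qc2]]]] : exists a c b, [/\ 5 * H / 4 < a < 5 * H / 4 + H / 8, 5 * H / 4 + 2 * (H / 8) < b < 5 * H / 4 + 3 * (H / 8), a < c < b,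
      `|q e a| <= 1 /\ `|q e b| <= 1 & `|q e c * r e c| <= 1 / (2 * (H / 8))].
  by apply: (good _ (2 * V)); [by move: (H0); clear; lra..|].
have vc1 : `|v e c1| <= `|V| / 4.
  have : c1 \in `[(H / 4), (H / 4 + 3 * (H / 8))].
    by apply: itv_ccI; move: sa1 b1s ac1 cb1; clear; lra.
  by move/lowe; rewrite le_min => /andP[].
have vc2 : `|v e c2 - 2 * V| <= `|V| / 4.
  have : c2 \in `[(5 * H / 4), (5 * H / 4 + 3 * (H / 8))].
    by apply: itv_ccI; move: sa2 b2s ac2 cb2; clear; lra.
  by move/highe; rewrite le_min => /andP[].
have sub (y : R) : y \in `[a1, b2] -> y \in `](- (2 * H)), (2 * H)[.
  by apply: sub_window; move: sa1 b2s (H0); clear; lra.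
have w4 : - (7 / 4 * H) < 7 / 4 * H by move: (H0); clear; lra.
have [E dE] : exists E : R -> R, forall y, y \in `](- (7 / 4 * H)), (7 / 4 * H)[ ->
    is_derive y 1 E (e ^+ 6 * w2 * r e y ^+ 2 + ln (1 + q e y ^+ 2)).
  apply: (@antiderivative R _ _ _ w4) => y yI.
  have yI' : y \in `](- (2 * H)), (2 * H)[ by apply: sub_window yI; move: (H0); clear; lra.
  have [_ dq dr _ _] := hode y yI'.
  apply: contD; first by apply: contM; [exact: cont_cst|apply/contX/(is_derive_continuous dr)].
  exact: (is_derive_continuous (is_derive_ln1Dsqr dq)).
have dE' (y : R) : y \in `[a1, b2] -> is_derive y 1 E (e ^+ 6 * w2 * r e y ^+ 2 + ln (1 + q e y ^+ 2)).
  move=> yI; apply: dE; move: yI; rewrite !in_itv/= => /andP[y1 y2].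
  by apply/andP; split; move: y1 y2 sa1 b2s (H0); clear; lra.
have [LC EC] : `|L e| <= CL /\ E b2 - E a1 <= CE * w2.
  apply: (@energy_scaled R beta (v e) (q e) (r e) (p e) (g e) (g1 e) E e w2 (e ^+ 6 * w2)
    (- (2 * H)) (2 * H) a1 b2 K (L e) M H e0 e1 l1 w2E erefl beta0 K0 _ _ H0 _ _ erefl _ hode _ _
    qa1 qb2 dE').
  - by move: sa1 (H0); clear; lra.
  - by move: b2s (H0); clear; lra.
  - by move: a1h sb2 (H0); clear; lra.
  - by move: sa1 b2s (H0); clear; lra.
  - apply: (@le_trans _ _ ((2 * (4 * K + 2 + M) ^+ 2 + 4) * e)).
      by rewrite ler_pM2l// expr2 ler_piMl ?(ltW e0) ?(ltW e1).
    by rewrite mulrC -ler_pdivlMr.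
  - by apply: hb; move: sa1 b2s sb2 ac1 cb1 b1s (H0); clear; lra.
  - by move=> y /sub/hc[].
have CL0 : 0 <= CL by exact: le_trans (normr_ge0 (L e)) LC.
have D0 : 0 <= D by rewrite addr_ge0// mulr_ge0.
have slice (c : R) : `|q e c * r e c| <= 1 / (2 * (H / 8)) ->
    `|e ^+ 6 * w2 * (q e c * r e c)| <= 4 / H * w2.
  move=> qc; rewrite normrM mulrC [X in _ * X]ger0_norm; last by rewrite mulr_ge0 ?(ltW w20); case/andP: e6.
  apply: ler_pM => //; first by rewrite mulr_ge0 ?(ltW w20); case/andP: e6.
    by apply: le_trans qc _; apply: eq_leR; field; rewrite gt_eqF.
  rewrite ler_piMl ?(ltW w20)//; case/andP: e6 => _ h; exact: le_trans h (ltW e1).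
have pb : `|p e c1| * `|V| <= (E b2 - E a1) + 2 * (4 / H * w2) + 2 * (beta * w2 * D) * K * (c2 - c1).
  apply: (@p_bound R (e ^+ 6 * w2) (beta * w2) (v e) (q e) (r e) (p e) (g e) (g1 e) E a1 b2 c1 c2
    K (4 / H * w2) `|V| (beta * w2 * D) _ _ _ _ _ _ _ dE').
  - by rewrite mulr_gt0// exprn_gt0.
  - exact: ltW.
  - by move: cb1 b1s sa2 ac2 (H0); clear; lra.
  - exact: ltW.
  - by move=> y /sub/hode.
  - by move=> y /sub/hc[].
  - move=> y /sub/hc[h1 h2 _]; rewrite normrM (gtr0_norm bw0); apply: (ler_wpM2l (ltW bw0)).
    have -> : v e y - g e y = v e y - (g e y - L e) - L e by ring.
    apply: le_trans (ler_normB _ _) _; rewrite lerD//; apply: le_trans (ler_normB _ _) _.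
    by move: h1 h2; clear; lra.
  - exact: slice.
  - exact: slice.
  - have V2 : `|2 * V| = 2 * `|V| by rewrite normrM (@ger0_norm _ 2).
    have h1 : `|2 * V| <= `|v e c2| + `|v e c2 - 2 * V|.
      by rewrite -[X in `|X| <= _](subKr (v e c2)); exact: ler_normB.
    have h2 : `|v e c2| <= `|v e c2 - v e c1| + `|v e c1|.
      by rewrite -[X in `|X| <= _](subrK (v e c1)); exact: ler_normD.
    by rewrite V2 in h1; move: vc1 vc2 h1 h2 V0; clear; lra.
split; first by rewrite (le_trans LC)// (le_trans (ler_norm CL))// lerDl.
exists c1.
  by apply: itv_ccI; move: sa1 ac1 cb1 b1s (H0); clear; lra.
apply: (@le_trans _ _ (CP * w2)); last first.
  by rewrite ler_pM2r// (le_trans (ler_norm CP))// lerDr.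
rewrite -(ler_pM2r V0) /CP; apply: le_trans pb _.
rewrite [X in _ <= X](_ : _ = CE * w2 + 2 * (4 / H * w2) + 2 * (beta * w2 * D) * K * (2 * H)); last first.
  by field; rewrite !gt_eqF//.
apply: lerD; first by rewrite lerD2r.
rewrite ler_wpM2l//; last by move: sa1 ac1 cb2 b2s (H0); clear; lra.
apply: mulr_ge0 K0; apply: mulr_ge0 => //; exact: (mulr_ge0 (ltW bw0) D0).
Unshelve. all: by end_near. Qed.

End Family.

(** * The slope on a plateau *)

Section Asymptotics.
Context {R : realType}.
Implicit Types (beta H m V e d C : R) (v q r p g : R -> R -> R) (L : R -> R).

Definition window_bounds H C e (v p g g1 : R -> R) (L : R) : Prop := `|L| <= C /\
  forall y, y \in `[(- (7 / 4 * H)), (7 / 4 * H)] ->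
    [/\ `|v y| <= C, `|v y - g y| <= C, `|g1 y| <= C & `|p y| <= C * omega e ^+ 2].

(** The bound for p at one point spreads because p' = - beta w2 (v - g) is of
    order w2. *)
Lemma flux_bound beta H m V v q r p g (g1 : R -> R -> R) L :
  blowup_family beta H m V v q r p g g1 L ->
  exists2 C, 1 <= C & \forall e \near (0 : R)^'+, window_bounds H C e (v e) (p e) (g e) (g1 e) (L e).
Proof.
move=> F; have [beta0 H0 m0 VE] := family_signs F.
have [K K0 crude] := crude_bounds F; have [C C0 hC] := energy_estimate F.
pose D := 2 * K + C; have D0 : 0 <= D by rewrite addr_ge0// mulr_ge0.
have bDH : 0 <= beta * D * (4 * H) by apply: mulr_ge0; [apply: mulr_ge0 => //; exact: ltW|rewrite mulr_ge0// ltW].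
exists (1 + D + beta * D * (4 * H)); first by move: D0 bDH; clear; lra.
near=> e.
have [LC [c cJ pc]] : `|L e| <= C /\ exists2 c : R, c \in `[(- (7 / 4 * H)), (7 / 4 * H)] & `|p e c| <= C * omega e ^+ 2.
  by near: e.
have [e0 e1 l1] : [/\ 0 < e, e < 1 & 1 <= - ln e] by near: e; exact: near_unit.
have [hode _] : minimal_system beta H e (v e) (q e) (r e) (p e) (g e) (g1 e).
  by near: e; exact: (family_system F).
have hc : forall y : R, y \in `](- (2 * H)), (2 * H)[ ->
    [/\ `|v e y| <= K, `|g e y - L e| <= K & `|g1 e y| <= K] by near: e.
set w2 := omega e ^+ 2 in hode pc *.
have w20 : 0 < w2 by rewrite exprn_gt0// omega_gt0.
have bw0 : 0 < beta * w2 by exact: mulr_gt0.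
have s1 : - (2 * H) < - (7 / 4 * H) by move: (H0); clear; lra.
have s2 : 7 / 4 * H < 2 * H by move: (H0); clear; lra.
have vg (y : R) : y \in `[(- (7 / 4 * H)), (7 / 4 * H)] -> `|v e y - g e y| <= D.
  move=> /(sub_window s1 s2)/hc[h1 h2 _].
  have -> : v e y - g e y = v e y - (g e y - L e) - L e by ring.
  apply: le_trans (ler_normB _ _) _; rewrite lerD//; apply: le_trans (ler_normB _ _) _.
  by move: h1 h2; clear; lra.
have dp (y z : R) : y \in `[(- (7 / 4 * H)), (7 / 4 * H)] -> z \in `[(- (7 / 4 * H)), (7 / 4 * H)] -> y <= z ->
    `|p e z - p e y| <= beta * D * (4 * H) * w2.
  move=> yJ zJ yz; have [y1 y2] : - (7 / 4 * H) <= y /\ z <= 7 / 4 * H.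
    by move: yJ zJ; rewrite !in_itv/= => /andP[-> _] /andP[_ ->].
  have sub (s : R) (h : s \in `[y, z]) := sub_itv_cc y1 y2 h.
  have dps s : s \in `[y, z] -> is_derive s 1 (p e) (- (beta * w2 * (v e s - g e s))).
    by move=> /sub/(sub_window s1 s2)/hode[].
  have dpl s : s \in `[y, z] -> `|- (beta * w2 * (v e s - g e s))| <= beta * w2 * D.
    by move=> /sub/vg h; rewrite normrN normrM (gtr0_norm bw0); exact: (ler_wpM2l (ltW bw0)).
  apply: le_trans (mvt_norm yz dps dpl) _.
  rewrite [X in _ <= X](_ : _ = beta * w2 * D * (4 * H)); last by ring.
  apply: ler_wpM2l; first exact: (mulr_ge0 (ltW bw0) D0).
  by move: y1 y2 (H0); clear; lra.
have K2 : K <= D by rewrite /D; move: K0 C0; clear; lra.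
have CD : C <= D by rewrite /D; move: K0; clear; lra.
split; first by move: LC CD bDH; clear; lra.
move=> y yJ; have [h1 h2 h3] := hc y (sub_window s1 s2 yJ).
split; [by move: h1 K2 bDH; clear; lra|by have h4 := vg y yJ; move: h4 bDH; clear; lra|
  by move: h3 K2 bDH; clear; lra|].
have pyc : `|p e y - p e c| <= beta * D * (4 * H) * w2.
  by have [/(dp _ _ yJ cJ)|/ltW/(dp _ _ cJ yJ)] := leP y c; rewrite // distrC.
rewrite -[X in `|X|](subrK (p e c)); apply: le_trans (ler_normD _ _) _.
rewrite mulrDl addrC; apply: lerD => //; apply: le_trans pc _; rewrite ler_pM2r//.
by move: CD; clear; lra.
Unshelve. all: by end_near. Qed.

(** An interval on a neighbourhood of which the oscillation of v_e tends to 0; the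
    margin rho leaves room for the local estimates. *)
Definition plateau v (H c d : R) := exists rho : R, [/\ 0 < rho,
  - (7 / 4 * H) <= c - rho, d + rho <= 7 / 4 * H &
  forall eta, 0 < eta -> \forall e \near (0 : R)^'+, forall s t : R,
    s \in `[c - rho, d + rho] -> t \in `[c - rho, d + rho] -> `|v e t - v e s| <= eta].

Lemma step_plateau H (v : R -> R -> R) (l lo hi c d : R) : uniform_step v l lo hi ->
  - (7 / 4 * H) <= lo -> hi <= 7 / 4 * H -> lo < c -> c <= d -> d < hi -> plateau v H c d.
Proof.
move=> hv Hlo Hhi hc cd hd.
have [c' [hc1 hc2]] : exists c', lo < c' /\ c' < c.
  by exists ((c + lo) / 2); move: hc; clear; split; lra.
have [d' [hd1 hd2]] : exists d', d < d' /\ d' < hi.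
  by exists ((d + hi) / 2); move: hd; clear; split; lra.
have rho0 : 0 < Num.min (c - c') (d' - d) by rewrite lt_min !subr_gt0 hc2.
have [l1 l2] : Num.min (c - c') (d' - d) <= c - c' /\ Num.min (c - c') (d' - d) <= d' - d.
  by rewrite !ge_min !lexx orbT.
exists (Num.min (c - c') (d' - d)); split => //.
- by move: l1 hc1 Hlo; clear; lra.
- by move: l2 hd2 Hhi; clear; lra.
have cd' : c' < d' by move: hc2 cd hd1; clear; lra.
move=> eta eta0; have eta2 : 0 < eta / 2 by rewrite divr_gt0.
apply: filterS (hv c' d' (eta / 2) hc1 cd' hd2 eta2) => e he s t sI tI.
have sub y : y \in `[c - Num.min (c - c') (d' - d), d + Num.min (c - c') (d' - d)] -> y \in `[c', d'].
  by apply: sub_itv_cc; move: l1 l2; clear; lra.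
have -> : v e t - v e s = (v e t - l) - (v e s - l) by ring.
apply: le_trans (ler_normB _ _) _.
by move: (he s (sub s sI)) (he t (sub t tI)); clear; lra.
Qed.

Lemma low_plateau beta H m V v q r p g (g1 : R -> R -> R) L (c d : R) :
  blowup_family beta H m V v q r p g g1 L -> - H < c -> c <= d -> d < H -> plateau v H c d.
Proof.
move=> F; have [_ H0 _ _] := family_signs F.
by apply: step_plateau (family_low_step F) _ _; move: H0; clear; lra.
Qed.

Lemma high_plateau beta H m V v q r p g (g1 : R -> R -> R) L (c d : R) :
  blowup_family beta H m V v q r p g g1 L -> H < c -> c <= d -> d < 7 / 4 * H -> plateau v H c d.
Proof.
move=> F; have [_ H0 _ _] := family_signs F.
apply: (@step_plateau _ _ (2 * V) H (7 / 4 * H)) => //; last by move: H0; clear; lra.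
move=> a b eta ha ab hb eta0; apply: (family_high_step F ha ab _ eta0).
by apply: lt_trans hb _; move: H0; clear; lra.
Qed.

(** First |q| <= 1 since spikes are excluded, then the barrier lemma gives
    q = O(w2).  The constant does not depend on the plateau, which matters for
    plateaus approaching the jump point H. *)
Lemma slope_bound beta H m V v q r p g (g1 : R -> R -> R) L :
  blowup_family beta H m V v q r p g g1 L ->
  exists2 C, 1 <= C & forall c d : R, plateau v H c d ->
    \forall e \near (0 : R)^'+, forall y : R, y \in `[c, d] -> `|q e y| <= C * omega e ^+ 2.
Proof.
move=> F; have [beta0 H0 m0 VE] := family_signs F.
have [C0 C01 hC] := flux_bound F.
have C00 : 0 <= C0 by exact: le_trans ler01 C01.
pose C := 1 + C0 + 3 * beta * C0 ^+ 2.
have bC : 0 <= beta * C0 ^+ 2 by rewrite mulr_ge0 ?sqr_ge0// ltW.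
have C1 : 1 <= C by rewrite /C; move: C00 bC; clear; lra.
have Cp : 0 < C by exact: lt_le_trans C1.
exists (2 * C + 1) => [|c d [rho [rho0 hlo hhi hosc]]]; first by move: C1; clear; lra.
(* Half of the area 1/(4 C^2) that a spike must carry, and small against the margin rho. *)
pose eta := Num.min (1 / 8) (Num.min (1 / (8 * C ^+ 2)) (rho / 16)).
have C20 : 0 < 8 * C ^+ 2 by rewrite mulr_gt0// exprn_gt0.
have eta0 : 0 < eta by rewrite !lt_min !divr_gt0.
have [eta1 [eta2 eta3]] : eta <= 1 / 8 /\ eta <= 1 / (8 * C ^+ 2) /\ eta <= rho / 16.
  by rewrite /eta !ge_min !lexx !orbT.
near=> e.
have [e0 e1 l1] : [/\ 0 < e, e < 1 & 1 <= - ln e] by near: e; exact: near_unit.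
have [LC hJ] : window_bounds H C0 e (v e) (p e) (g e) (g1 e) (L e).
  by near: e.
have [hode _] : minimal_system beta H e (v e) (q e) (r e) (p e) (g e) (g1 e).
  by near: e; exact: (family_system F).
have osc : forall s t : R, s \in `[c - rho, d + rho] -> t \in `[c - rho, d + rho] ->
    `|v e t - v e s| <= eta by near: e; exact: hosc.
have small1 : e * (- ln e) <= 1 / (2 * C * expR 1).
  by near: e; apply: near_elog; rewrite divr_gt0// mulr_gt0 ?expR_gt0// mulr_gt0.
have small2 : omega e ^+ 2 <= 1 / (4 * C).
  by near: e; apply: near_omega2; rewrite divr_gt0// mulr_gt0.
have small3 : e <= rho / 4 by near: e; apply: near_small; rewrite divr_gt0.
have small4 : e <= rho ^+ 2 / 16 by near: e; apply: near_small; rewrite divr_gt0// exprn_gt0.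
have w2E := omega_sqr e0 e1; set w2 := omega e ^+ 2 in w2E hode hJ small2 *.
have w20 : 0 < w2 by rewrite exprn_gt0// omega_gt0.
have k20 : 0 < e ^+ 6 * w2 by rewrite mulr_gt0// exprn_gt0.
have [e60 e61] : 0 <= e ^+ 6 /\ e ^+ 6 <= e by have /andP[] := expr6_le e0 e1.
have sub (y : R) (h : y \in `[c - rho, d + rho]) : y \in `[(- (7 / 4 * H)), (7 / 4 * H)].
  exact: (sub_itv_cc hlo hhi h).
have win (y : R) (h : y \in `[c - rho, d + rho]) : y \in `](- (2 * H)), (2 * H)[.
  by apply: sub_window (sub y h); move: (H0); clear; lra.
have hP (y : R) : y \in `[c - rho, d + rho] -> [/\ `|p e y| <= C * w2,
     0 <= beta * w2 * (v e y - g e y) ^+ 2 <= C * w2 &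
     `|2 * (beta * w2) * (v e y - g e y) * g1 e y| <= C * w2].
  move=> /sub/hJ[_ h2 h3 h4]; have bw0 : 0 <= beta * w2 by rewrite mulr_ge0// ltW.
  have vg2 : (v e y - g e y) ^+ 2 <= C0 ^+ 2.
    by rewrite -real_normK ?num_real// ler_pXn2r ?nnegrE.
  split.
  - apply: le_trans h4 _; rewrite ler_pM2r// /C; move: bC; clear; lra.
  - rewrite mulr_ge0 ?sqr_ge0//=; apply: (@le_trans _ _ (beta * w2 * C0 ^+ 2)).
      exact: ler_wpM2l.
    rewrite -mulrA [w2 * _]mulrC mulrA ler_pM2r// /C; move: bC C00; clear; lra.
  - have X0 : 0 < 2 * beta * w2 by rewrite mulr_gt0// mulr_gt0.
    rewrite (_ : _ * _ * _ * _ = 2 * beta * w2 * ((v e y - g e y) * g1 e y)); last by ring.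
    have hh : `|(v e y - g e y) * g1 e y| <= C0 ^+ 2 by rewrite normrM expr2; exact: ler_pM.
    rewrite normrM (gtr0_norm X0); apply: (@le_trans _ _ (2 * beta * w2 * C0 ^+ 2)).
      by rewrite ler_pM2l.
    rewrite (_ : _ * C0 ^+ 2 = 2 * (beta * C0 ^+ 2) * w2); last by ring.
    by rewrite ler_pM2r//; move: bC C00; rewrite /C; clear; lra.
have e2 : e ^+ 2 <= e by rewrite expr2 ler_piMl ?(ltW e0) ?(ltW e1).
have q1 (y : R) : y \in `[c - rho / 2, d + rho / 2] -> `|q e y| <= 1.
  rewrite in_itv/= => /andP[y1 y2].
  apply: (@spike_scaled R (beta * w2) (v e) (q e) (r e) (p e) (g e) (g1 e) e w2 (e ^+ 6 * w2)
    (c - rho) (d + rho) y eta C e0 e1 w2E erefl C1 _ _ eta0 eta1 _ _ hP osc).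
  - have X0 : 0 < 2 * C * expR 1 by rewrite mulr_gt0 ?expR_gt0// mulr_gt0.
    by move: small1; rewrite ler_pdivlMr//; apply: le_trans; apply: eq_leR; ring.
  - move: small2; rewrite ler_pdivlMr; last by rewrite mulr_gt0.
    by clear; lra.
  - by move: eta2; rewrite ler_pdivlMr// mulrC.
  - by move=> z /win/hode.
  - by move: y1 eta3 (rho0); clear; lra.
  - by move: y2 eta3 small3 e2 (rho0); clear; lra.
move=> y yI.
have rho2 : 0 < rho / 2 by rewrite divr_gt0.
have Cw : 0 <= C * w2 by rewrite mulr_ge0// ltW.
have [y1 y2] : c <= y /\ y <= d by move: yI; rewrite in_itv/= => /andP[].
have loc s : s \in `[y - rho / 2, y + rho / 2] -> [/\ is_derive s 1 (q e) (r e s),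
     is_derive s 1 (r e) ((q e s / (1 + q e s ^+ 2) + p e s) / (e ^+ 6 * w2)),
     `|p e s| <= C * w2 & `|q e s| <= 1].
  move=> sI; have sI' : s \in `[c - rho, d + rho].
    by apply: sub_itv_cc sI; move: y1 y2 (rho0); clear; lra.
  have [_ dq dr _ _] := hode s (win s sI'); have [hp _ _] := hP s sI'.
  split; [exact: dq|exact: dr|exact: hp|apply: q1].
  by apply: sub_itv_cc sI; move: y1 y2 (rho0); clear; lra.
apply: le_trans (@plateau_slope R (e ^+ 6 * w2) (q e) (r e) (p e) y (rho / 2) (C * w2) k20 rho2 Cw loc) _.
have r20 : 0 < rho ^+ 2 by rewrite exprn_gt0.
have -> : 4 * (e ^+ 6 * w2) / (rho / 2) ^+ 2 = 16 * e ^+ 6 / rho ^+ 2 * w2.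
  by field; rewrite gt_eqF.
have le1 : 16 * e ^+ 6 / rho ^+ 2 <= 1.
  by rewrite ler_pdivrMr//; move: small4 e61; clear; lra.
have : 16 * e ^+ 6 / rho ^+ 2 * w2 <= w2 by rewrite ler_piMl ?(ltW w20).
by clear; lra.
Unshelve. all: by end_near. Qed.

End Asymptotics.

(** * The mean datum and the limiting slope *)

Section Profile.
Context {R : realType}.
Implicit Types (beta H m V e d : R) (v q r p g : R -> R -> R) (L : R -> R).

(** On a plateau of length delta the mean value theorem for q yields a point with
    |r| = O(w2/delta), where each of the three terms of the Hamiltonian other
    than the distance to the datum is at most delta w2. *)
Lemma hamiltonian_slice k2 bw (v q r p g g1 : R -> R) (s delta w2 C : R) : 0 < delta -> 0 < w2 ->
  0 < k2 -> 1 <= C -> 2 * C ^+ 2 * w2 <= delta -> k2 * (2 * C / delta) ^+ 2 * w2 <= delta ->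
  (forall y, y \in `[s, s + delta] -> [/\ is_derive y 1 q (r y), `|q y| <= C * w2 & `|p y| <= C * w2]) ->
  exists2 y, y \in `]s, (s + delta)[ &
    `|ham k2 bw v q r p g y - bw * (v y - g y) ^+ 2| <= 3 * delta * w2.
Proof.
move=> d0 w20 k20 C1 small1 small2 hs.
have C0 : 0 < C by exact: lt_le_trans C1.
have sd : s < s + delta by rewrite ltrDl.
have dq y : y \in `[s, s + delta] -> is_derive y 1 q (r y) by move=> /hs[].
have [I1 I2] : s \in `[s, s + delta] /\ s + delta \in `[s, s + delta].
  by split; apply: itv_ccI; rewrite // ltW.
have qd : `|q (s + delta) - q s| <= 2 * C * w2 / delta * (s + delta - s).
  rewrite addrAC subrr add0r divfK ?gt_eqF//; apply: le_trans (ler_normB _ _) _.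
  by have [_ h1 _] := hs _ I1; have [_ h2 _] := hs _ I2; move: h1 h2; clear; lra.
have [y yI ry] := @small_slope_point R q r s (s + delta) (2 * C * w2 / delta) sd dq qd.
exists y => //; have [_ qy py] := hs y (subset_itv_oo_cc yI).
have Cw0 : 0 <= C * w2 := mulr_ge0 (ltW C0) (ltW w20).
have qp : `|q y * p y| <= (C * w2) ^+ 2 by rewrite normrM expr2; exact: ler_pM.
have q2 : q y ^+ 2 <= (C * w2) ^+ 2 by rewrite -real_normK ?num_real// ler_pXn2r ?nnegrE.
have r2 : r y ^+ 2 <= (2 * C * w2 / delta) ^+ 2.
  rewrite -real_normK ?num_real// ler_pXn2r ?nnegrE//.
  by rewrite divr_ge0 ?(ltW d0)// -mulrA mulr_ge0.
have kr : k2 * r y ^+ 2 <= delta * w2.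
  apply: (@le_trans _ _ (k2 * (2 * C * w2 / delta) ^+ 2)); first by rewrite ler_pM2l.
  rewrite (_ : _ * _ = k2 * (2 * C / delta) ^+ 2 * w2 * w2); last by field; rewrite gt_eqF.
  by rewrite ler_pM2r.
have Cw2 : 2 * (C * w2) ^+ 2 <= delta * w2.
  by rewrite (_ : _ * _ = 2 * C ^+ 2 * w2 * w2); [rewrite ler_pM2r|ring].
have kr0 : 0 <= k2 * r y ^+ 2 by rewrite mulr_ge0 ?sqr_ge0// ltW.
have ln0 := ln1Dsqr_ge0 (q y); have ln1 := ln1Dsqr_le (q y).
have Q0 := sqr_ge0 (q y).
have := ler_norm (q y * p y); have := ler_norm (- (q y * p y)); rewrite normrN.
rewrite /ham addrK ler_norml; move: qp q2 kr Cw2 kr0 ln0 ln1 Q0; clear => *.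
by apply/andP; split; lra.
Qed.

(** (V - L)^2 - (V + L)^2 = - 4 V L, up to perturbations of size delta. *)
Lemma square_difference (V L ra rb c delta C : R) : `|L| <= C -> 0 <= delta -> delta <= 1 ->
  `|ra| <= c * delta -> `|rb| <= c * delta -> 0 <= c ->
  4 * (`|V| * `|L|) <= `|(V - L + rb) ^+ 2 - (- (L + V) + ra) ^+ 2| +
    2 * (c * delta) * (2 * (`|V| + C) + c).
Proof.
move=> LC d0 d1 ha hb c0.
have cd : c * delta <= c by rewrite ler_piMr.
have err (x s : R) : `|x| <= `|V| + C -> `|s| <= c * delta ->
    `|s * (2 * x + s)| <= c * delta * (2 * (`|V| + C) + c).
  move=> hx hs; rewrite normrM; apply: ler_pM => //.
  apply: le_trans (ler_normD _ _) _; rewrite normrM (@ger0_norm _ 2)//.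
  by move: hx hs cd; clear; lra.
have x1 : `|V - L| <= `|V| + C by apply: le_trans (ler_normB _ _) _; rewrite lerD2l.
have x2 : `|- (L + V)| <= `|V| + C.
  by rewrite normrN addrC; apply: le_trans (ler_normD _ _) _; rewrite lerD2l.
have := err _ _ x1 hb; have := err _ _ x2 ha; set A := `|_| => hA; set B := `|_| => hB.
have -> : 4 * (`|V| * `|L|) = `|(V - L + rb) ^+ 2 - (- (L + V) + ra) ^+ 2
    - (rb * (2 * (V - L) + rb) - ra * (2 * - (L + V) + ra))|.
  rewrite -normrM -(@ger0_norm _ 4)// -normrM -normrN; congr `|_|; ring.
apply: le_trans (ler_normB _ _) _; apply: lerD => //; apply: le_trans (ler_normB _ _) _.
by rewrite -/A -/B; move: hA hB; clear; lra.
Qed.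

(** The Hamiltonian varies by O(delta w2) from H - delta to H + delta, so the
    distances of the two steps to the datum at H balance: (2V - g)^2 = g^2 in the
    limit, with g = L_e + m H = L_e + V.  As V is nonzero this forces L_e -> 0. *)
Lemma mean_datum_vanishes beta H m V v q r p g (g1 : R -> R -> R) L d :
  blowup_family beta H m V v q r p g g1 L -> 0 < d -> \forall e \near (0 : R)^'+, `|L e| <= d.
Proof.
move=> F d0; have [beta0 H0 m0 VE] := family_signs F.
have [C1 C11 hC1] := flux_bound F; have [C2 C21 hC2] := slope_bound F.
pose C := C1 + C2.
have CC1 : 1 <= C by rewrite /C; move: C11 C21; clear; lra.
have C0 : 0 < C by exact: lt_le_trans CC1.
have V0 : 0 < `|V| by rewrite normr_gt0 VE mulf_neq0// gt_eqF.
have mm := normr_ge0 m.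
pose c := 2 + 2 * `|m|; have c0 : 0 <= c by rewrite /c; move: mm; clear; lra.
pose A := 8 * beta * C ^+ 2 + 6 + beta * (2 * c * (2 * (`|V| + C) + c)).
have A0 : 0 < A.
  have h1 : 0 <= 8 * beta * C ^+ 2 by rewrite mulr_ge0 ?sqr_ge0// mulr_ge0// ltW.
  have h2 : 0 <= beta * (2 * c * (2 * (`|V| + C) + c)).
    rewrite mulr_ge0 ?(ltW beta0)// mulr_ge0//; first by rewrite mulr_ge0.
    by move: V0 C0 c0; clear; lra.
  by rewrite /A; move: h1 h2; clear; lra.
(* The estimate below reads 4 beta |V| |L| <= A delta with A independent of delta. *)
pose delta := Num.min 1 (Num.min (H / 8) (d * (4 * beta * `|V|) / A)).
have bV0 : 0 < 4 * beta * `|V| by rewrite mulr_gt0// mulr_gt0.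
have dl0 : 0 < delta by rewrite !lt_min ltr01 !divr_gt0// mulr_gt0.
have [dl1 [dlH dlA]] : delta <= 1 /\ delta <= H / 8 /\ delta <= d * (4 * beta * `|V|) / A.
  by rewrite /delta !ge_min !lexx !orbT.
have pl1 : plateau v H (H - 2 * delta) (H - delta).
  by apply: (low_plateau F); move: dl0 dlH (H0); clear; lra.
have pl2 : plateau v H (H + delta) (H + 2 * delta).
  by apply: (high_plateau F); move: dl0 dlH (H0); clear; lra.
have Cd0 : 0 < (2 * C / delta) ^+ 2 by rewrite exprn_gt0// divr_gt0// mulr_gt0.
near=> e.
have [e0 e1 l1] : [/\ 0 < e, e < 1 & 1 <= - ln e] by near: e; exact: near_unit.
have [LC hJ] : window_bounds H C1 e (v e) (p e) (g e) (g1 e) (L e).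
  by near: e.
have [hode _] : minimal_system beta H e (v e) (q e) (r e) (p e) (g e) (g1 e).
  by near: e; exact: (family_system F).
have hq1 : forall y : R, y \in `[(H - 2 * delta), (H - delta)] -> `|q e y| <= C2 * omega e ^+ 2.
  by near: e; exact: hC2.
have hq2 : forall y : R, y \in `[(H + delta), (H + 2 * delta)] -> `|q e y| <= C2 * omega e ^+ 2.
  by near: e; exact: hC2.
have hv1 : forall y : R, y \in `[(H - 2 * delta), (H - delta)] -> `|v e y| <= delta.
  by near: e; apply: (low_step F) => //; move: (dl0) (dlH) (H0); clear; lra.
have hv2 : forall y : R, y \in `[(H + delta), (H + 2 * delta)] -> `|v e y - 2 * V| <= delta.
  by near: e; apply: (family_high_step F) => //; move: (dl0) (dlH) (H0); clear; lra.
have hg : forall y : R, y \in `](- (2 * H)), (2 * H)[ ->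
    `|g e y - L e - m * y| <= delta /\ `|g1 e y - m| <= delta.
  by near: e; exact: (family_datum F).
have small1 : omega e ^+ 2 <= delta / (2 * C ^+ 2).
  by near: e; apply: near_omega2; rewrite divr_gt0// mulr_gt0// exprn_gt0.
have small2 : omega e ^+ 2 <= 1 by near: e; apply: near_omega2.
have small3 : e <= delta / (2 * C / delta) ^+ 2 by near: e; apply: near_small; exact: (divr_gt0 dl0 Cd0).
set w2 := omega e ^+ 2 in hode hJ small1 small2 hq1 hq2 *.
have w20 : 0 < w2 by rewrite exprn_gt0// omega_gt0.
have bw0 : 0 < beta * w2 by exact: mulr_gt0.
have k20 : 0 < e ^+ 6 * w2 by rewrite mulr_gt0// exprn_gt0.
have [e60 e61] : 0 <= e ^+ 6 /\ e ^+ 6 <= e by have /andP[] := expr6_le e0 e1.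
have s1' : 2 * C ^+ 2 * w2 <= delta.
  by move: small1; rewrite ler_pdivlMr ?mulr_gt0 ?exprn_gt0// mulrC.
have s2' : e ^+ 6 * w2 * (2 * C / delta) ^+ 2 * w2 <= delta.
  have h1 : e ^+ 6 * (2 * C / delta) ^+ 2 <= delta.
    by rewrite -ler_pdivlMr//; exact: le_trans e61 small3.
  have h2 : w2 * w2 <= 1 by rewrite -(mulr1 1); apply: ler_pM => //; exact: ltW.
  rewrite (_ : _ * _ = e ^+ 6 * (2 * C / delta) ^+ 2 * (w2 * w2)); last by ring.
  rewrite -[X in _ <= X]mulr1; apply: ler_pM => //; first exact: (mulr_ge0 e60 (ltW Cd0)).
  by rewrite mulr_ge0// ltW.
have sub (y : R) : H - 2 * delta <= y -> y <= H + 2 * delta -> y \in `[(- (7 / 4 * H)), (7 / 4 * H)].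
  by move=> h1 h2; apply: itv_ccI; move: h1 h2 (dlH) (H0); clear; lra.
have win (y : R) : y \in `[(- (7 / 4 * H)), (7 / 4 * H)] -> y \in `](- (2 * H)), (2 * H)[.
  by apply: sub_window; move: (H0); clear; lra.
have [CC C2C] : C1 <= C /\ C2 <= C by rewrite /C; move: C11 C21; clear; split; lra.
have slice (s : R) : H - 2 * delta <= s -> s + delta <= H + 2 * delta ->
    (forall y, y \in `[s, s + delta] -> `|q e y| <= C2 * w2) ->
    exists2 y, y \in `]s, (s + delta)[ &
    `|ham (e ^+ 6 * w2) (beta * w2) (v e) (q e) (r e) (p e) (g e) y - beta * w2 * (v e y - g e y) ^+ 2|
      <= 3 * delta * w2.
  move=> h1 h2 hq; apply: (@hamiltonian_slice _ _ (v e) (q e) (r e) (p e) (g e) (g1 e) s delta w2 C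
    dl0 w20 k20 CC1 s1' s2') => y yI.
  have [ys sy] : s <= y /\ y <= s + delta by move: yI; rewrite in_itv/= => /andP[].
  have yJ := sub y (le_trans h1 ys) (le_trans sy h2).
  have [_ dq _ _ _] := hode y (win y yJ); have [_ _ _ hp] := hJ y yJ.
  split; [exact: dq|apply: le_trans (hq y yI) _; rewrite ler_pM2r//|apply: le_trans hp _; rewrite ler_pM2r//].
have a1 : H - 2 * delta + delta = H - delta by ring.
have a2 : H + delta + delta = H + 2 * delta by ring.
have [ya yaI hya] : exists2 y, y \in `](H - 2 * delta), (H - delta)[ &
    `|ham (e ^+ 6 * w2) (beta * w2) (v e) (q e) (r e) (p e) (g e) y - beta * w2 * (v e y - g e y) ^+ 2|
      <= 3 * delta * w2.
  by rewrite -a1; apply: slice; rewrite ?a1 ?lexx//; move: (dl0); clear; lra.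
have [yb ybI hyb] : exists2 y, y \in `](H + delta), (H + 2 * delta)[ &
    `|ham (e ^+ 6 * w2) (beta * w2) (v e) (q e) (r e) (p e) (g e) y - beta * w2 * (v e y - g e y) ^+ 2|
      <= 3 * delta * w2.
  by rewrite -a2; apply: slice; rewrite ?a2 ?lexx//; move: (dl0); clear; lra.
have va := hv1 ya (subset_itv_oo_cc yaI); have vb := hv2 yb (subset_itv_oo_cc ybI).
have [ya1 ya2] : H - 2 * delta < ya /\ ya < H - delta by move: yaI; rewrite in_itv/= => /andP[].
have [yb1 yb2] : H + delta < yb /\ yb < H + 2 * delta by move: ybI; rewrite in_itv/= => /andP[].
have yab : ya <= yb by move: ya2 yb1 (dl0); clear; lra.
have sub' s (h : s \in `[ya, yb]) : s \in `[(- (7 / 4 * H)), (7 / 4 * H)].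
  move: h; rewrite in_itv/= => /andP[h1 h2]; apply: sub; [exact: le_trans (ltW ya1) h1|].
  exact: le_trans h2 (ltW yb2).
have dh s : s \in `[ya, yb] -> is_derive s 1 (ham (e ^+ 6 * w2) (beta * w2) (v e) (q e) (r e) (p e) (g e))
    (- (2 * (beta * w2) * (v e s - g e s) * g1 e s)).
  by move=> /sub'/win/hode; apply: ham_derive; rewrite gt_eqF.
have dhl s : s \in `[ya, yb] -> `|- (2 * (beta * w2) * (v e s - g e s) * g1 e s)| <= 2 * (beta * w2) * C ^+ 2.
  move=> /sub'/hJ[_ h2 h3 _]; have X0 : 0 < 2 * (beta * w2) by rewrite mulr_gt0.
  rewrite normrN -mulrA normrM (gtr0_norm X0) ler_pM2l// normrM expr2.
  by apply: ler_pM => //; [exact: le_trans h2 CC|exact: le_trans h3 CC].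
have hdiff := mvt_norm yab dh dhl.
have ba : yb - ya <= 4 * delta by move: ya1 yb2; clear; lra.
have hd2 : 2 * (beta * w2) * C ^+ 2 * (yb - ya) <= 8 * beta * C ^+ 2 * delta * w2.
  rewrite (_ : 8 * _ * _ * _ * _ = 2 * (beta * w2) * C ^+ 2 * (4 * delta)); last by ring.
  by apply: ler_wpM2l => //; rewrite mulr_ge0 ?sqr_ge0// mulr_ge0// ltW.
set ha := ham _ _ _ _ _ _ _ ya in hya hdiff; set hb := ham _ _ _ _ _ _ _ yb in hyb hdiff.
pose ra := v e ya - (g e ya - L e - m * ya) - m * (ya - H).
pose rb := (v e yb - 2 * V) - (g e yb - L e - m * yb) - m * (yb - H).
have lin (x y z : R) : `|x| <= delta -> `|y| <= delta -> `|z - H| <= 2 * delta ->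
    `|x - y - m * (z - H)| <= c * delta.
  move=> hx hy hz; have hmz : `|m * (z - H)| <= `|m| * (2 * delta) by rewrite normrM ler_wpM2l.
  have := ler_normB (x - y) (m * (z - H)); have := ler_normB x y.
  by rewrite /c; move: hx hy hmz; clear; lra.
have [ga _] := hg ya (win _ (sub' ya (itv_ccI (lexx _) yab))).
have [gb _] := hg yb (win _ (sub' yb (itv_ccI yab (lexx _)))).
have hra : `|ra| <= c * delta.
  by apply: lin => //; rewrite ler_norml; move: ya1 ya2 (dl0); clear => *; apply/andP; split; lra.
have hrb : `|rb| <= c * delta.
  by apply: lin => //; rewrite ler_norml; move: yb1 yb2 (dl0); clear => *; apply/andP; split; lra.
have raE : v e ya - g e ya = - (L e + V) + ra by rewrite /ra VE; ring.
have rbE : v e yb - g e yb = V - L e + rb by rewrite /rb VE; ring.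
have := square_difference V (le_trans LC CC) (ltW dl0) dl1 hra hrb c0.
rewrite -raE -rbE; set S := `|_ ^+ 2 - _| => hS.
have bS : beta * S <= (8 * beta * C ^+ 2 + 6) * delta.
  have SE : beta * S * w2 = `|beta * w2 * ((v e yb - g e yb) ^+ 2 - (v e ya - g e ya) ^+ 2)|.
    by rewrite normrM (gtr0_norm bw0) /S; ring.
  rewrite -(ler_pM2r w20) SE.
  rewrite (_ : beta * w2 * _ = (hb - ha) - (hb - beta * w2 * (v e yb - g e yb) ^+ 2)
    + (ha - beta * w2 * (v e ya - g e ya) ^+ 2)); last by ring.
  apply: le_trans (ler_normD _ _) _.
  have := ler_normB (hb - ha) (hb - beta * w2 * (v e yb - g e yb) ^+ 2).
  by move: hya hyb hdiff hd2; clear; lra.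
have Aest : 4 * beta * `|V| * `|L e| <= A * delta.
  have := ler_wpM2l (ltW beta0) hS; rewrite mulrDr.
  by move: bS; rewrite /A; clear; lra.
rewrite -(ler_pM2l bV0); apply: le_trans Aest _.
by move: dlA; rewrite ler_pdivlMr//; clear; lra.
Unshelve. all: by end_near. Qed.

(** On the step around 0 the slope is q = - p + o(w2), and there
    p' = - beta w2 (v - g) = beta w2 (m y + o(1)) because v and L_e tend to zero.
    Integrating from 0, q/w2 is a constant minus beta m y^2/2 up to o(1). *)
Lemma flux_profile beta H m V v q r p g (g1 : R -> R -> R) L (b d : R) :
  blowup_family beta H m V v q r p g g1 L -> 0 < b -> b < H -> 0 < d ->
  \forall e \near (0 : R)^'+, forall y : R, y \in `[(- b), b] ->
    `|q e y / omega e ^+ 2 - (q e 0 / omega e ^+ 2 - beta * m / 2 * y ^+ 2)| <= d.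
Proof.
move=> F b0 bH d0; have [beta0 H0 m0 VE] := family_signs F.
have [C1 C11 hC1] := flux_bound F; have [C2 C21 hC2] := slope_bound F.
pose C := C1 + C2.
have [CC C2C] : C1 <= C /\ C2 <= C by rewrite /C; move: C11 C21; clear; split; lra.
have C0 : 0 < C by move: C11 CC; clear; lra.
pose rho := (H - b) / 2; have rho0 : 0 < rho by rewrite divr_gt0// subr_gt0.
have brho : b + rho < H by rewrite /rho; move: bH; clear; lra.
have pl : plateau v H (- (b + rho)) (b + rho).
  by apply: (low_plateau F); move: brho rho0 b0; clear; lra.
pose eta := d / (2 + 3 * beta * H).
have D0 : 0 < 2 + 3 * beta * H by rewrite ltr_wpDr// mulr_ge0 ?mulr_ge0 ?(ltW beta0) ?(ltW H0).
have eta0 : 0 < eta by exact: divr_gt0.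
pose M := 2 * C ^+ 3 + 4 * beta * C + 8 * C / rho ^+ 2.
have r20 : 0 < rho ^+ 2 by rewrite exprn_gt0.
have M0 : 0 < M.
  have h1 : 0 < C ^+ 3 by rewrite exprn_gt0.
  have h2 : 0 < 4 * beta * C by rewrite mulr_gt0// mulr_gt0.
  have h3 : 0 < 8 * C / rho ^+ 2 by rewrite divr_gt0// mulr_gt0.
  by rewrite /M; move: h1 h2 h3; clear; lra.
near=> e.
have [e0 e1 l1] : [/\ 0 < e, e < 1 & 1 <= - ln e] by near: e; exact: near_unit.
have [LC hJ] : window_bounds H C1 e (v e) (p e) (g e) (g1 e) (L e).
  by near: e.
have [hode _] : minimal_system beta H e (v e) (q e) (r e) (p e) (g e) (g1 e).
  by near: e; exact: (family_system F).
have hq : forall y : R, y \in `[(- (b + rho)), (b + rho)] -> `|q e y| <= C2 * omega e ^+ 2.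
  by near: e; exact: hC2.
have hv : forall y : R, y \in `[(- b), b] -> `|v e y| <= eta.
  by near: e; apply: (low_step F) => //; move: (b0) (bH); clear; lra.
have hg : forall y : R, y \in `](- (2 * H)), (2 * H)[ ->
    `|g e y - L e - m * y| <= eta /\ `|g1 e y - m| <= eta.
  by near: e; exact: (family_datum F).
have hL : `|L e| <= eta by near: e; exact: (mean_datum_vanishes F).
have small1 : omega e ^+ 2 <= 1 by near: e; apply: near_omega2.
have small2 : omega e ^+ 2 <= eta / M by near: e; apply: near_omega2; exact: (divr_gt0 eta0 M0).
have small3 : e <= eta / M by near: e; apply: near_small; exact: (divr_gt0 eta0 M0).
set w2 := omega e ^+ 2 in hode hJ small1 small2 hq *.
have w20 : 0 < w2 by rewrite exprn_gt0// omega_gt0.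
have bw0 : 0 < beta * w2 by exact: mulr_gt0.
have k20 : 0 < e ^+ 6 * w2 by rewrite mulr_gt0// exprn_gt0.
have [e60 e61] : 0 <= e ^+ 6 /\ e ^+ 6 <= e by have /andP[] := expr6_le e0 e1.
have win (y : R) : y \in `[(- (7 / 4 * H)), (7 / 4 * H)] -> y \in `](- (2 * H)), (2 * H)[.
  by apply: sub_window; move: (H0); clear; lra.
have sub (y : R) : y \in `[(- (b + rho)), (b + rho)] -> y \in `[(- (7 / 4 * H)), (7 / 4 * H)].
  by apply: sub_itv_cc; move: brho (H0); clear; lra.
have subb (y : R) : y \in `[(- b), b] -> y \in `[(- (b + rho)), (b + rho)].
  by apply: sub_itv_cc; move: (rho0); clear; lra.
have CW : C * w2 <= C by rewrite ler_piMr// ltW.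
have fl (y : R) : y \in `[(- b), b] -> `|q e y + p e y| <= eta * w2.
  move=> yI; have [y1 y2] : - b <= y /\ y <= b by move: yI; rewrite in_itv/= => /andP[].
  have loc s : s \in `[y - rho, y + rho] ->
      ode (e ^+ 6 * w2) (beta * w2) (v e) (q e) (r e) (p e) (g e) (g1 e) s /\
      [/\ `|p e s| <= C * w2, `|q e s| <= C * w2 & `|beta * w2 * (q e s - g1 e s)| <= beta * w2 * (2 * C)].
    move=> sI; have sI' : s \in `[(- (b + rho)), (b + rho)].
      by apply: sub_itv_cc sI; move: y1 y2; clear; lra.
    have [_ _ hg1 hp] := hJ s (sub s sI'); have hqs := hq s sI'.
    have hqC : `|q e s| <= C * w2 by apply: le_trans hqs _; rewrite ler_pM2r.
    split; first exact: hode (win s (sub s sI')).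
    split; [by apply: le_trans hp _; rewrite ler_pM2r|exact: hqC|].
    rewrite normrM (gtr0_norm bw0) ler_pM2l//; apply: le_trans (ler_normB _ _) _.
    by move: hqC CW hg1 CC; clear; lra.
  have P20 : 0 <= beta * w2 * (2 * C) by apply: mulr_ge0; [exact: ltW|rewrite mulr_ge0// ltW].
  have S0 : 0 <= C * w2 by rewrite mulr_ge0 ?(ltW C0) ?(ltW w20).
  apply: le_trans (flux_almost k20 rho0 P20 S0 loc) _.
  rewrite (_ : _ + _ = (2 * C ^+ 3 * w2 ^+ 2 + 4 * beta * C * (e ^+ 6 * w2)
    + 8 * C / rho ^+ 2 * (e ^+ 6 * w2)) * w2); last by field; rewrite gt_eqF.
  rewrite ler_pM2r//.
  have e6M : e ^+ 6 * w2 <= eta / M.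
    apply: le_trans (le_trans e61 small3); rewrite ler_piMr//.
  have w2M : w2 ^+ 2 <= eta / M by apply: le_trans small2; rewrite expr2 ler_piMr// ltW.
  have -> : eta = M * (eta / M) by field; rewrite gt_eqF.
  set X := eta / M in e6M w2M *; rewrite /M ![(_ + _) * X]mulrDl.
  apply: lerD; first apply: lerD.
  - by apply: ler_wpM2l => //; rewrite mulr_ge0// exprn_ge0// ltW.
  - by apply: ler_wpM2l => //; rewrite mulr_ge0 ?(ltW C0)// mulr_ge0 ?(ltW beta0).
  - by apply: ler_wpM2l => //; rewrite divr_ge0 ?(ltW r20)// mulr_ge0 ?(ltW C0).
pose S (y : R) := p e y / w2 - beta * m / 2 * y ^+ 2.
have dS y : y \in `[(- b), b] -> is_derive y 1 S (- (beta * (v e y - (g e y - L e - m * y) - L e))).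
  move=> yI; have [_ _ _ dp _] := hode y (win y (sub y (subb y yI))).
  have di : is_derive y 1 (id : R -> R) 1 by exact: is_derive_id.
  have d2 := is_derive_pow 2 di.
  have h1 : is_derive y 1 (fun y => w2^-1 * p e y) (w2^-1 * - (beta * w2 * (v e y - g e y))).
    by apply: is_derive_eq; rewrite /GRing.scale/=; ring.
  have h2 : is_derive y 1 (fun y : R => beta * m / 2 * y ^+ 2) (beta * m / 2 * (2 * y)).
    by apply: is_derive_eq; rewrite /GRing.scale/=; ring.
  have -> : S = (fun y => w2^-1 * p e y - beta * m / 2 * y ^+ 2).
    by apply/funext => z; rewrite /S mulrC.
  have h3 := is_deriveB h1 h2.
  by apply: is_derive_eq; field; rewrite gt_eqF.
have dSl y : y \in `[(- b), b] -> `|- (beta * (v e y - (g e y - L e - m * y) - L e))| <= beta * (3 * eta).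
  move=> yI; rewrite normrN normrM (gtr0_norm beta0) ler_pM2l//.
  have h1 := hv y yI; have [h2 _] := hg y (win y (sub y (subb y yI))).
  have := ler_normB (v e y - (g e y - L e - m * y)) (L e).
  have := ler_normB (v e y) (g e y - L e - m * y).
  by move: h1 h2 hL; clear; lra.
have I0 : 0 \in `[(- b), b] by apply: itv_ccI; move: (b0); clear; lra.
have hS (y : R) : y \in `[(- b), b] -> `|S y - S 0| <= beta * (3 * eta) * H.
  move=> yI; have [y1 y2] : - b <= y /\ y <= b by move: yI; rewrite in_itv/= => /andP[].
  have be0 : 0 <= beta * (3 * eta) by rewrite mulr_ge0 ?(ltW beta0)// mulr_ge0 ?(ltW eta0).
  have [h|h] := leP 0 y.
  - have s1 s (hs : s \in `[0, y]) : s \in `[(- b), b] by apply: sub_itv_cc hs; move: (b0) y2; clear; lra.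
    apply: le_trans (mvt_norm h (fun s hs => dS s (s1 s hs)) (fun s hs => dSl s (s1 s hs))) _.
    by apply: ler_wpM2l => //; move: y2 (bH); clear; lra.
  - have s1 s (hs : s \in `[y, 0]) : s \in `[(- b), b] by apply: sub_itv_cc hs; move: (b0) y1; clear; lra.
    rewrite distrC.
    apply: le_trans (mvt_norm (ltW h) (fun s hs => dS s (s1 s hs)) (fun s hs => dSl s (s1 s hs))) _.
    by apply: ler_wpM2l => //; move: y1 (bH); clear; lra.
move=> y yI; have f1 := fl y yI; have f0 := fl 0 I0; have hs := hS y yI.
rewrite (_ : _ - _ = (q e y + p e y) / w2 - (q e 0 + p e 0) / w2 - (S y - S 0)); last first.
  by rewrite /S; field; rewrite gt_eqF.
have div (z : R) : `|z| <= eta * w2 -> `|z / w2| <= eta.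
  by rewrite normrM normfV (gtr0_norm w20) ler_pdivrMr.
apply: le_trans (ler_normB _ _) _.
have hh := ler_normB ((q e y + p e y) / w2) ((q e 0 + p e 0) / w2).
have -> : d = eta * (2 + 3 * beta * H) by rewrite /eta divfK// gt_eqF.
by move: hh (div _ f1) (div _ f0) hs; clear; lra.
Unshelve. all: by end_near. Qed.

End Profile.

(** * From minimizers to a blow-up family *)

Section BlowUp.
Context {R : realType}.
Implicit Types (beta H V e : R) (f : R -> R) (u : R -> R -> R) (x v : R -> R).

Lemma staircase_window H V (k : int) (y : R) (a b : R) : 0 < H ->
  H * (2 * k%:~R - 1) < a -> b < H * (2 * k%:~R + 1) -> y \in `[a, b] ->
  staircase H V y = V * (2 * k%:~R) /\ ~ jump_point (staircase H V) y.
Proof.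
move=> H0 ha hb; rewrite in_itv/= => /andP[y1 y2].
have yI : y \in `](H * (2 * k%:~R - 1)), (H * (2 * k%:~R + 1))[.
  by rewrite in_itv/= (lt_le_trans ha y1) (le_lt_trans y2 hb).
split; first exact: staircase_val.
by apply: (not_jump yI) => z; exact: staircase_val.
Qed.

(** Strict convergence holds on slightly larger intervals inside the step, whose
    end points are not jump points, and is uniform there. *)
Lemma staircase_step H V (k : int) (v : R -> R -> R) (a b eta : R) : 0 < H ->
  locally_strict_cvg v (staircase H V) ->
  (\forall e \near 0^'+, C1oo (- (2 * H)) (2 * H) (v e)) ->
  - (2 * H) < a -> b < 2 * H ->
  H * (2 * k%:~R - 1) < a -> a < b -> b < H * (2 * k%:~R + 1) -> 0 < eta ->
  \forall e \near (0 : R)^'+, forall y : R, y \in `[a, b] -> `|v e y - V * (2 * k%:~R)| <= eta.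
Proof.
move=> H0 hv hC haW hbW ha ab hb eta0.
have [a' [a1 a2 a3]] : exists a', [/\ H * (2 * k%:~R - 1) < a', - (2 * H) < a' & a' < a].
  exists ((Num.max (H * (2 * k%:~R - 1)) (- (2 * H)) + a) / 2).
  have m1 : Num.max (H * (2 * k%:~R - 1)) (- (2 * H)) < a by rewrite gt_max ha.
  have [m2 m3] : H * (2 * k%:~R - 1) <= Num.max (H * (2 * k%:~R - 1)) (- (2 * H)) /\
      - (2 * H) <= Num.max (H * (2 * k%:~R - 1)) (- (2 * H)) by rewrite !le_max !lexx orbT.
  by split; move: m1 m2 m3; clear; lra.
have [b' [b1 b2 b3]] : exists b', [/\ b' < H * (2 * k%:~R + 1), b' < 2 * H & b < b'].
  exists ((Num.min (H * (2 * k%:~R + 1)) (2 * H) + b) / 2).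
  have m1 : b < Num.min (H * (2 * k%:~R + 1)) (2 * H) by rewrite lt_min hb.
  have [m2 m3] : Num.min (H * (2 * k%:~R + 1)) (2 * H) <= H * (2 * k%:~R + 1) /\
      Num.min (H * (2 * k%:~R + 1)) (2 * H) <= 2 * H by rewrite !ge_min !lexx orbT.
  by split; move: m1 m2 m3; clear; lra.
have ab' : a' < b' by exact: lt_trans a3 (lt_trans ab b3).
have st (y : R) : y \in `[a', b'] -> staircase H V y = V * (2 * k%:~R) /\ ~ jump_point (staircase H V) y.
  by move=> yI; exact: staircase_window a1 b1 yI.
have [_ ja] := st a' (itv_ccI (lexx _) (ltW ab')).
have [_ jb] := st b' (itv_ccI (ltW ab') (lexx _)).
have hC' : \forall e \near 0^'+, C1oo a' b' (v e).
  apply: filterS hC => e [v1 dv]; exists v1 => y; rewrite in_itv/= => /andP[y1 y2].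
  by apply: dv; rewrite in_itv/= (lt_trans a2 y1) (lt_trans y2 b2).
have sv (y : R) : y \in `]a', b'[ -> staircase H V y = V * (2 * k%:~R).
  by move=> /subset_itv_oo_cc/st[].
have := strict_cvg_uniform ab' (hv a' b' ab' ja jb) hC' sv eta0.
apply: filterS => e he y; rewrite in_itv/= => /andP[y1 y2].
by apply: he; rewrite in_itv/= (lt_le_trans a3 y1) (le_lt_trans y2 b3).
Qed.

(** The functions q, r, p are chosen for each small parameter; near 0 they are
    those of the blown-up Euler-Lagrange system.  The expansion of the datum is
    the mean value theorem for f(z) - f'(x0) z near x0. *)
Lemma blow_up_family beta H V f u x (x0 : R) : 0 < beta -> 0 < H -> Defs.C1 0 1 f ->
  (forall e, e \in `]0, 1[ -> is_minimizer_PMF e beta f (u e)) ->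
  x0 \in `]0, 1[ -> x e @[e --> 0^'+] --> x0 -> derive1 f x0 != 0 -> V = derive1 f x0 * H ->
  locally_strict_cvg (blow_up u x) (staircase H V) ->
  exists (q r p g g1 : R -> R -> R) (L : R -> R),
    blowup_family beta H (derive1 f x0) V (blow_up u x) q r p g g1 L.
Proof.
move=> beta0 H0 hf hmin x0I xcvg df0 VE hv.
have [_ [f1 df cf1]] := C1_data hf.
have mE : derive1 f x0 = f1 x0 by have [_ h] := df x0 x0I; rewrite derive1E h.
rewrite mE in df0 VE *.
pose g e (y : R) := (f (x e + omega e * y) - u e (x e)) / omega e.
pose g1 e (y : R) := f1 (x e + omega e * y).
pose L e := (f (x e) - u e (x e)) / omega e.
have H20 : 0 < 2 * H by rewrite mulr_gt0.
(* x0 is interior, so the whole window ]-2H, 2H[ is mapped into ]0, 1[ for small parameters. *)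
pose rad0 := Num.min x0 (1 - x0).
have [x01 x02] : 0 < x0 /\ x0 < 1 by move: x0I; rewrite in_itv/= => /andP[].
have rad00 : 0 < rad0 by rewrite lt_min x01 subr_gt0.
have ball01 (z : R) : `|z - x0| < rad0 -> z \in `]0, 1[.
  rewrite lt_min !ltr_norml => /andP[/andP[h1 _] /andP[_ h2]]; rewrite in_itv/=.
  by apply/andP; split; move: h1 h2; clear; lra.
have win := near_window H20 rad00 xcvg.
pose good e := [/\ 0 < e, e < 1 & forall y : R, y \in `](- (2 * H)), (2 * H)[ -> x e + omega e * y \in `]0, 1[].
have hgood : \forall e \near (0 : R)^'+, good e.
  near=> e; have [e0 e1 _] : [/\ 0 < e, e < 1 & 1 <= - ln e] by near: e; exact: near_unit.
  split => // y yI; apply: ball01; move: y yI; near: e; exact: win.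
pose Sys e (qrp : (R -> R) * (R -> R) * (R -> R)) :=
  minimal_system beta H e (blow_up u x e) qrp.1.1 qrp.1.2 qrp.2 (g e) (g1 e).
have [qrp hqrp] : {qrp & forall e, good e -> Sys e (qrp e)}.
  apply: (@choice _ _ (fun e qrp => good e -> Sys e qrp)) => e.
  have [[e0 e1 he]|] := pselect (good e); last by exists (id, id, id).
  have eI : e \in `]0, 1[ by rewrite in_itv/= e0.
  have [q [r [p [h1 h2]]]] := blowup_system e0 e1 hf (hmin e eI) df he.
  by exists (q, r, p) => _; split.
have hsys : \forall e \near (0 : R)^'+, Sys e (qrp e) by apply: filterS hgood => e /hqrp.
have hC : \forall e \near 0^'+, C1oo (- (2 * H)) (2 * H) (blow_up u x e).
  apply: filterS hsys => e [hode _]; exists (qrp e).1.1 => y /hode[dv dq _ _ _].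
  by split => //; exact: (is_derive_continuous dq).
exists (fun e => (qrp e).1.1), (fun e => (qrp e).1.2), (fun e => (qrp e).2), g, g1, L; split.
- by split.
- exact: hsys.
- have W : - (2 * H) < 2 * H by move: (H0); clear; lra.
  have [_ j1] : staircase H V (- (2 * H)) = V * (2 * (-1)%:~R) /\ ~ jump_point (staircase H V) (- (2 * H)).
    apply: (@staircase_window H V (-1) (- (2 * H)) (- (2 * H)) (- (2 * H)) H0).
    + by rewrite mulrN1z; move: (H0); clear; lra.
    + by rewrite mulrN1z; move: (H0); clear; lra.
    + by rewrite in_itv/= lexx.
  have [_ j2] : staircase H V (2 * H) = V * (2 * (1)%:~R) /\ ~ jump_point (staircase H V) (2 * H).
    apply: (@staircase_window H V 1 (2 * H) (2 * H) (2 * H) H0).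
    + by rewrite mulr1z; move: (H0); clear; lra.
    + by rewrite mulr1z; move: (H0); clear; lra.
    + by rewrite in_itv/= lexx.
  have [K hK] := strict_cvg_bounded_increment W (hv _ _ W j1 j2) hC.
  exists K; apply: filterS hK => e he y yI.
  have I0 : 0 \in `](- (2 * H)), (2 * H)[ by rewrite in_itv/= oppr_lt0 H20.
  have := he 0 y I0 yI.
  by rewrite /blow_up mulr0 addr0 subrr mul0r subr0.
- move=> a b eta ha ab hb eta0.
  have := @staircase_step H V 0 _ a b eta H0 hv hC.
  rewrite mulr0z !mulr0 sub0r add0r mulr1 mulrN1.
  by apply => //; move: ha hb (H0); clear; lra.
- move=> a b eta ha ab hb eta0.
  have := @staircase_step H V 1 _ a b eta H0 hv hC.
  rewrite mulr1z mulr1 [V * 2]mulrC.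
  by apply => //; move: ha hb (H0); clear; lra.
- move=> d d0.
  pose d' := d / (1 + 2 * H).
  have D0 : 0 < 1 + 2 * H by rewrite ltr_wpDr// ltW.
  have d'0 : 0 < d' by exact: divr_gt0.
  have dE : d = d' * (1 + 2 * H) by rewrite /d' divfK// gt_eqF.
  have [rad [rad1 hrad]] : exists rad, 0 < rad /\ forall z : R, `|z - x0| < rad -> `|f1 z - f1 x0| <= d'.
    have /cvgrPdist_le/(_ _ d'0) := cf1 x0 x0I.
    move=> /nbhs_ballP[rad /= rad1 hr]; exists rad; split => // z hz.
    by rewrite distrC; apply: hr; rewrite /ball/= distrC.
  have radm : 0 < Num.min rad rad0 by rewrite lt_min rad1.
  have winm := near_window H20 radm xcvg.
  near=> e.
  have [e0 e1 _] : [/\ 0 < e, e < 1 & 1 <= - ln e] by near: e; exact: near_unit.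
  have hw : forall y, y \in `](- (2 * H)), (2 * H)[ -> `|x e + omega e * y - x0| < Num.min rad rad0.
    by near: e; exact: winm.
  have om0 := omega_gt0 e0 e1.
  have I0 : 0 \in `](- (2 * H)), (2 * H)[ by rewrite in_itv/= oppr_lt0 H20.
  have hx : `|x e - x0| < Num.min rad rad0 by have := hw 0 I0; rewrite mulr0 addr0.
  have inc (s t : R) : `|s - x0| < Num.min rad rad0 -> `|t - x0| < Num.min rad rad0 -> s <= t ->
      `|(f t - f1 x0 * t) - (f s - f1 x0 * s)| <= d' * (t - s).
    move=> hs ht st.
    have inb z : z \in `[s, t] -> `|z - x0| < Num.min rad rad0.
      move: hs ht; rewrite !ltr_norml in_itv/= => /andP[h1 h2] /andP[h3 h4] /andP[h5 h6].
      by apply/andP; split; move: h1 h2 h3 h4 h5 h6; clear; lra.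
    have dF z : z \in `[s, t] -> is_derive z 1 (fun z => f z - f1 x0 * z) (f1 z - f1 x0).
      move=> /inb zb; have dfz : is_derive z 1 f (f1 z).
        by apply: df; apply: ball01; move: zb; rewrite lt_min => /andP[].
      have di : is_derive z 1 (id : R -> R) 1 by exact: is_derive_id.
      have dl : is_derive z 1 (fun z : R => f1 x0 * z) (f1 x0).
        by apply: is_derive_eq; rewrite /GRing.scale/=; ring.
      exact: (is_deriveB dfz dl).
    have dFl z : z \in `[s, t] -> `|f1 z - f1 x0| <= d'.
      by move=> /inb; rewrite lt_min => /andP[zb _]; exact: hrad.
    exact: (mvt_norm st dF dFl).
  move=> y yI; have hy := hw y yI.
  have dd : d' <= d by rewrite dE ler_peMr ?(ltW d'0)// lerDl ltW.
  split; last first.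
    apply: le_trans dd; apply: hrad; move: hy; rewrite lt_min => /andP[h _]; exact: h.
  have absy : `|y| <= 2 * H.
    by rewrite ler_norml; move: yI; rewrite in_itv/= => /andP[h1 h2]; rewrite !ltW.
  have step : `|(f (x e + omega e * y) - f1 x0 * (x e + omega e * y)) - (f (x e) - f1 x0 * x e)|
      <= d' * (omega e * `|y|).
    have [y0|y0] := leP 0 y.
      apply: le_trans (inc _ _ hx hy _) _; first by rewrite lerDl mulr_ge0// ltW.
      by rewrite addrAC subrr add0r ger0_norm.
    rewrite distrC; apply: le_trans (inc _ _ hy hx _) _.
      by rewrite gerDl pmulr_rle0// ltW.
    by rewrite opprD addrA subrr sub0r -mulrN (ltr0_norm y0).
  rewrite (_ : _ - _ = ((f (x e + omega e * y) - f1 x0 * (x e + omega e * y)) - (f (x e) - f1 x0 * x e)) / omega e).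
    rewrite normrM normfV (gtr0_norm om0) ler_pdivrMr//; apply: le_trans step _.
    rewrite dE mulrCA mulrC ler_pM2r//; apply: ler_wpM2l; first exact: ltW.
    by apply: le_trans absy _; rewrite lerDr.
  by rewrite /g /L; field; rewrite gt_eqF.
Unshelve. all: by end_near. Qed.

(** Integration of the slope profile; v_e(0) = 0 fixes the constant. *)
Lemma rescaled_profile beta H V f u x (x0 : R) : 0 < beta -> 0 < H -> Defs.C1 0 1 f ->
  (forall e, e \in `]0, 1[ -> is_minimizer_PMF e beta f (u e)) ->
  x0 \in `]0, 1[ -> x e @[e --> 0^'+] --> x0 -> derive1 f x0 != 0 -> V = derive1 f x0 * H ->
  locally_strict_cvg (blow_up u x) (staircase H V) ->
  exists (zeta : R -> R) (Q : R -> R -> R) (C : R),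
    (\forall e \near (0 : R)^'+, `|zeta e| <= C) /\
    forall b d : R, 0 < b -> b < H -> 0 < d -> \forall e \near (0 : R)^'+, forall y : R, y \in `[(- b), b] ->
      [/\ is_derive y 1 (rescaled_blow_up u x e) (Q e y), continuous_at y (Q e),
          `|Q e y - (zeta e - beta * derive1 f x0 / 2 * y ^+ 2)| <= d &
          `|rescaled_blow_up u x e y - (zeta e * y - beta * derive1 f x0 / 6 * y ^+ 3)| <= d].
Proof.
move=> beta0 H0 hf hmin x0I xcvg df0 VE hv.
have [q [r [p [g [g1 [L F]]]]]] := blow_up_family beta0 H0 hf hmin x0I xcvg df0 VE hv.
set m := derive1 f x0 in F *.
have [C _ hC] := slope_bound F.
exists (fun e => q e 0 / omega e ^+ 2), (fun e y => q e y / omega e ^+ 2), C; split.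
  have pl : plateau (blow_up u x) H 0 0 by apply: (low_plateau F); move: (H0); clear; lra.
  near=> e; have [e0 e1 _] : [/\ 0 < e, e < 1 & 1 <= - ln e] by near: e; exact: near_unit.
  have om0 : 0 < omega e ^+ 2 by rewrite exprn_gt0// omega_gt0.
  rewrite normrM normfV (gtr0_norm om0) ler_pdivrMr//.
  suff : forall y : R, y \in `[0, 0] -> `|q e y| <= C * omega e ^+ 2.
    by apply; rewrite in_itv/= lexx.
  by near: e; exact: hC.
move=> b d b0 bH d0.
pose d' := d / (1 + H).
have D0 : 0 < 1 + H by rewrite ltr_wpDr// ltW.
have d'0 : 0 < d' by exact: divr_gt0.
have dE : d = d' * (1 + H) by rewrite /d' divfK// gt_eqF.
near=> e.
have [e0 e1 _] : [/\ 0 < e, e < 1 & 1 <= - ln e] by near: e; exact: near_unit.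
have [hode _] : minimal_system beta H e (blow_up u x e) (q e) (r e) (p e) (g e) (g1 e).
  by near: e; exact: (family_system F).
have hfl : forall y : R, y \in `[(- b), b] ->
    `|q e y / omega e ^+ 2 - (q e 0 / omega e ^+ 2 - beta * m / 2 * y ^+ 2)| <= d'.
  by near: e; exact: (flux_profile F).
have om0 : 0 < omega e ^+ 2 by rewrite exprn_gt0// omega_gt0.
set w2 := omega e ^+ 2 in hode hfl om0 *.
have win (y : R) : y \in `[(- b), b] -> y \in `](- (2 * H)), (2 * H)[.
  by apply: sub_window; move: (bH) (b0) (H0); clear; lra.
have dw (y : R) : y \in `[(- b), b] -> is_derive y 1 (rescaled_blow_up u x e) (q e y / w2).
  move=> /win/hode[dv _ _ _ _].
  have h1 : is_derive y 1 (fun y => w2^-1 * blow_up u x e y) (w2^-1 * q e y).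
    by apply: is_derive_eq; rewrite /GRing.scale/=; ring.
  have -> : rescaled_blow_up u x e = (fun y => w2^-1 * blow_up u x e y).
    by apply/funext => z; rewrite /rescaled_blow_up mulrC.
  by rewrite mulrC.
have cq (y : R) : y \in `[(- b), b] -> continuous_at y (fun y => q e y / w2).
  by move=> /win/hode[_ dq _ _ _]; apply: contM; [exact: (is_derive_continuous dq)|exact: cont_cst].
pose S (y : R) := rescaled_blow_up u x e y - (q e 0 / w2 * y - beta * m / 6 * y ^+ 3).
have dS (y : R) : y \in `[(- b), b] ->
    is_derive y 1 S (q e y / w2 - (q e 0 / w2 - beta * m / 2 * y ^+ 2)).
  move=> yI; have di : is_derive y 1 (id : R -> R) 1 by exact: is_derive_id.
  have d3 := is_derive_pow 3 di.
  have h2 : is_derive y 1 (fun y : R => q e 0 / w2 * y - beta * m / 6 * y ^+ 3)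
      (q e 0 / w2 - beta * m / 2 * y ^+ 2).
    by apply: is_derive_eq; rewrite /GRing.scale/=; field; rewrite gt_eqF.
  exact: is_deriveB (dw y yI) h2.
have S0 : S 0 = 0.
  by rewrite /S /rescaled_blow_up /blow_up expr0n/= !(mulr0, addr0, subrr, mul0r).
move=> y yI; have [y1 y2] : - b <= y /\ y <= b by move: yI; rewrite in_itv/= => /andP[].
have dd : d' <= d by rewrite dE ler_peMr ?(ltW d'0)// lerDl ltW.
split; [exact: dw|exact: cq|exact: le_trans (hfl y yI) dd|].
rewrite -/(S y) -[S y]subr0 -S0; apply: (@le_trans _ _ (d' * H)); last first.
  by rewrite dE ler_pM2l// lerDr.
have [y0|y0] := leP 0 y.
- have s1 s (hs : s \in `[0, y]) : s \in `[(- b), b] by apply: sub_itv_cc hs; move: (b0) y2; clear; lra.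
  apply: le_trans (mvt_norm y0 (fun s hs => dS s (s1 s hs)) (fun s hs => hfl s (s1 s hs))) _.
  by rewrite ler_pM2l//; move: y2 (bH); clear; lra.
- have s1 s (hs : s \in `[y, 0]) : s \in `[(- b), b] by apply: sub_itv_cc hs; move: (b0) y1; clear; lra.
  rewrite distrC.
  apply: le_trans (mvt_norm (ltW y0) (fun s hs => dS s (s1 s hs)) (fun s hs => hfl s (s1 s hs))) _.
  by rewrite ler_pM2l//; move: y1 (bH); clear; lra.
Unshelve. all: by end_near. Qed.

End BlowUp.

(** * Subsequences and limit points *)

Section Limits.
Context {R : realType}.

Lemma vanishing_near (e : nat -> R) (P : R -> Prop) : vanishing_parameters e ->
  (\forall t \near (0 : R)^'+, P t) -> \forall n \near \oo, P (e n).
Proof.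
move=> [eI e0]; rewrite near_withinE => /e0 he.
have : \forall n \near \oo, 0 < e n -> P (e n) by exact: he.
apply: filterS => n; apply; by have := eI n; rewrite in_itv/= => /andP[].
Qed.

Lemma subsequence_near (k : nat -> nat) (P : nat -> Prop) : {homo k : m n / (m < n)%N} ->
  (\forall n \near \oo, P n) -> \forall n \near \oo, P (k n).
Proof.
move=> kinc [N _ hN]; exists N => // n /= Nn; apply: hN => /=; apply: leq_trans Nn _.
elim: {N}n => // n IH; exact: leq_ltn_trans IH (kinc _ _ (ltnSn n)).
Qed.

Lemma bounded_subsequence (z : nat -> R) (C : R) : (\forall n \near \oo, `|z n| <= C) ->
  exists (k : nat -> nat) (l : R), {homo k : m n / (m < n)%N} /\ z \o k @ \oo --> l.
Proof.
move=> zC.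
have zI : (z @ \oo) [set` `[(- C), C]].
  have : \forall n \near \oo, z n \in `[(- C), C] by apply: filterS zC => n; rewrite ler_norml in_itv.
  by [].
have [l [_ cl]] := @segment_compact R (- C) C (z @ \oo) _ zI.
have [k kinc kl] := (cluster_eventually_cvg z l).1 cl.
exists k, l; split => // m n mn.
by rewrite (leqW_mono kinc).
Qed.

Lemma uniform_cvg_intro (a b : R) (u_ : nat -> R -> R) (w : R -> R) :
  (forall d : R, 0 < d -> \forall n \near \oo, forall y : R, y \in `[a, b] -> `|u_ n y - w y| <= d) ->
  {uniform `[a, b], u_ @ \oo --> w}.
Proof.
move=> H P /uniform_nbhs[E [entE EP]].
move: entE; rewrite -entourage_ballE => -[d /= d0 dE].
have d20 : 0 < d / 2 by rewrite divr_gt0.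
apply: filterS (H _ d20) => n hn; apply: EP => y yI; apply: dE => /=.
rewrite /ball/= distrC; apply: le_lt_trans (hn y yI) _.
by move: d0; clear; lra.
Qed.

Lemma uniform_cvg_point (a b y : R) (u_ : nat -> R -> R) (w : R -> R) : y \in `[a, b] ->
  {uniform `[a, b], u_ @ \oo --> w} -> u_ n y @[n --> \oo] --> w y.
Proof.
move=> yI H; apply/cvgrPdist_lt => d d0.
apply: (H [set h : R -> R | `|w y - h y| < d]); apply/uniform_nbhs.
exists [set p | ball p.1 d p.2]; split.
  by rewrite -entourage_ballE; exists d.
by move=> h hh /=; exact: hh.
Qed.

(** The profiles depend on the parameter only through zeta, so the convergence of
    these numbers gives the convergence of the functions and their slopes. *)
Lemma profile_cvg (a b zeta0 K : R) (w Q : nat -> R -> R) (zeta : nat -> R) : zeta @ \oo --> zeta0 ->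
  (forall d : R, 0 < d -> \forall n \near \oo, forall y : R, y \in `[a, b] ->
     [/\ is_derive y 1 (w n) (Q n y), continuous_at y (Q n),
         `|Q n y - (zeta n - 3 * K * y ^+ 2)| <= d & `|w n y - (zeta n * y - K * y ^+ 3)| <= d]) ->
  cvg_C1 a b w (fun y => zeta0 * y - K * y ^+ 3).
Proof.
move=> hz H; exists Q, (fun y => zeta0 - 3 * K * y ^+ 2).
have dpoly (y : R) : is_derive y 1 (fun y : R => zeta0 * y - K * y ^+ 3) (zeta0 - 3 * K * y ^+ 2).
  have di : is_derive y 1 (id : R -> R) 1 by exact: is_derive_id.
  have d3 := is_derive_pow 3 di.
  by apply: is_derive_eq; rewrite /GRing.scale/=; ring.
have dpoly2 (y : R) : is_derive y 1 (fun y : R => zeta0 - 3 * K * y ^+ 2) (- (3 * K * (2 * y))).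
  have di : is_derive y 1 (id : R -> R) 1 by exact: is_derive_id.
  have d3 := is_derive_pow 2 di.
  by apply: is_derive_eq; rewrite /GRing.scale/=; ring.
pose D := 1 + `|a| + `|b|.
have D1 : 1 <= D by rewrite /D -addrA lerDl addr_ge0.
have D0 : 0 < D by exact: lt_le_trans D1.
have hD (y : R) : y \in `[a, b] -> `|y| <= D.
  rewrite in_itv/= => /andP[h1 h2]; rewrite /D ler_norml.
  have := ler_norm b; have := ler_norm (- a); rewrite normrN.
  have := normr_ge0 a; have := normr_ge0 b.
  by move: h1 h2; clear => *; apply/andP; split; lra.
have hzd (d : R) : 0 < d -> \forall n \near \oo, `|zeta n - zeta0| <= d.
  by move=> d0; move/cvgrPdistC_le : hz; exact.
split.
- have := H 1 ltr01; apply: filterS => n hn; split.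
  + by apply: within_cont => y /hn[dw _ _ _]; exact: (is_derive_continuous dw).
  + by apply: within_cont => y /hn[].
  + by move=> y /subset_itv_oo_cc/hn[].
- split.
  + by apply: within_cont => y _; exact: (is_derive_continuous (dpoly y)).
  + by apply: within_cont => y _; exact: (is_derive_continuous (dpoly2 y)).
  + by move=> y _; exact: dpoly.
- apply: uniform_cvg_intro => d d0; have d20 : 0 < d / 2 by rewrite divr_gt0.
  have dD0 : 0 < d / 2 / D by rewrite divr_gt0.
  near=> n => y yI.
  have [_ _ _ h1] : [/\ is_derive y 1 (w n) (Q n y), continuous_at y (Q n),
         `|Q n y - (zeta n - 3 * K * y ^+ 2)| <= d / 2 & `|w n y - (zeta n * y - K * y ^+ 3)| <= d / 2].
    by move: y yI; near: n; exact: H.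
  have h2 : `|zeta n - zeta0| <= d / 2 / D by near: n; exact: hzd.
  have -> : w n y - (zeta0 * y - K * y ^+ 3) = (w n y - (zeta n * y - K * y ^+ 3)) + (zeta n - zeta0) * y.
    by ring.
  have h3 : `|(zeta n - zeta0) * y| <= d / 2 / D * D by rewrite normrM ler_pM// hD.
  apply: le_trans (ler_normD _ _) _; move: h3; rewrite divfK ?gt_eqF// => h3.
  by move: h1 h3; clear; lra.
- apply: uniform_cvg_intro => d d0; have d20 : 0 < d / 2 by rewrite divr_gt0.
  near=> n => y yI.
  have [_ _ h1 _] : [/\ is_derive y 1 (w n) (Q n y), continuous_at y (Q n),
         `|Q n y - (zeta n - 3 * K * y ^+ 2)| <= d / 2 & `|w n y - (zeta n * y - K * y ^+ 3)| <= d / 2].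
    by move: y yI; near: n; exact: H.
  have h2 : `|zeta n - zeta0| <= d / 2 by near: n; exact: hzd.
  have -> : Q n y - (zeta0 - 3 * K * y ^+ 2) = (Q n y - (zeta n - 3 * K * y ^+ 2)) + (zeta n - zeta0).
    by ring.
  apply: le_trans (ler_normD _ _) _.
  by move: h1 h2; clear; lra.
Unshelve. all: by end_near. Qed.

(** The value of the limit at the single point H/2 determines the limit of the
    slopes zeta at the origin, hence the whole limit. *)
Lemma profile_limit (H K : R) (w : nat -> R -> R) (zeta : nat -> R) (w0 : R -> R) : 0 < H ->
  (forall y : R, y \in `]- H, H[ -> w n y @[n --> \oo] --> w0 y) ->
  (forall y : R, y \in `]- H, H[ -> w n y - (zeta n * y - K * y ^+ 3) @[n --> \oo] --> 0) ->
  exists zeta0 : R, forall y : R, y \in `]- H, H[ -> w0 y = - K * y ^+ 3 + zeta0 * y.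
Proof.
(* Any nonzero point of ]-H, H[ would do. *)
move=> H0 hw hr; pose y0 := H / 2.
have y00 : y0 != 0 by rewrite gt_eqF// divr_gt0.
have I0 : y0 \in `]- H, H[ by rewrite in_itv/= /y0; apply/andP; split; move: H0; clear; lra.
have hz : zeta @ \oo --> (w0 y0 - 0 + K * y0 ^+ 3) / y0.
  have -> : zeta = fun n => (w n y0 - (w n y0 - (zeta n * y0 - K * y0 ^+ 3)) + K * y0 ^+ 3) / y0.
    by apply/funext => n; field.
  apply: cvgM; last exact: cvg_cst.
  by apply: cvgD; [apply: cvgB; [exact: hw|exact: hr]|exact: cvg_cst].
exists ((w0 y0 - 0 + K * y0 ^+ 3) / y0) => y yI.
have h1 : w n y @[n --> \oo] --> 0 + ((w0 y0 - 0 + K * y0 ^+ 3) / y0 * y - K * y ^+ 3).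
  have -> : (fun n => w n y) = fun n => (w n y - (zeta n * y - K * y ^+ 3)) + (zeta n * y - K * y ^+ 3).
    by apply/funext => n; ring.
  apply: cvgD; first exact: hr.
  by apply: cvgB; [apply: cvgM; [exact: hz|exact: cvg_cst]|exact: cvg_cst].
by rewrite (cvg_unique (@Rhausdorff R) (hw y yI) h1) add0r addrC mulNr.
Qed.

End Limits.

Theorem theorem3p3 (R : realType) (beta : R) (beta_gt0 : 0 < beta)
    (f : R -> R) (f_C1 : Defs.C1 0 1 f)
    (u : R -> R -> R)
    (u_min : forall eps, eps \in `]0, 1[ -> is_minimizer_PMF eps beta f (u eps))
    (x : R -> R) (x_in : forall eps, eps \in `]0, 1[ -> x eps \in `]0, 1[)
    (x0 : R) (x0_in : x0 \in `]0, 1[)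
    (x_cvg : x eps @[eps --> 0^'+] --> x0)
    (df_neq0 : derive1 f x0 != 0)
    (H V : R)
    (H_def : H = (24 / (beta ^+ 2 * `|derive1 f x0| ^+ 3)) `^ (1 / 5))
    (V_def : V = derive1 f x0 * H)
    (v_cvg : locally_strict_cvg (blow_up u x) (staircase H V)) :
  (forall a b : R, - H < a -> a < b -> b < H ->
     relatively_compact_C1 a b (rescaled_blow_up u x)) /\
  (forall w0 : R -> R, limit_point_C1 H (rescaled_blow_up u x) w0 ->
     exists zeta0 : R, forall y : R, y \in `]- H, H[ ->
       w0 y = - (beta / 6) * derive1 f x0 * y ^+ 3 + zeta0 * y).
Proof.
have H0 : 0 < H by rewrite H_def powR_gt0// divr_gt0// mulr_gt0// exprn_gt0// normr_gt0.
have [zeta [Q [C [hzeta hprof]]]] :=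
  rescaled_profile beta_gt0 H0 f_C1 u_min x0_in x_cvg df_neq0 V_def v_cvg.
pose K := beta / 6 * derive1 f x0.
have sub3 (y : R) : beta * derive1 f x0 / 2 * y ^+ 2 = 3 * K * y ^+ 2 by rewrite /K; field.
have sub1 (y : R) : beta * derive1 f x0 / 6 * y ^+ 3 = K * y ^+ 3 by rewrite /K; field.
split.
- move=> a b ha ab hb e he.
  have [k [l [kinc kl]]] := bounded_subsequence (vanishing_near he hzeta).
  exists k, (fun y => l * y - K * y ^+ 3); split => //.
  apply: (@profile_cvg _ _ _ _ _ _ (fun n => Q (e (k n))) (zeta \o e \o k) kl) => d d0.
  pose c := Num.max (Num.max (- a) b) (H / 2).
  have [c1 c2 c3] : [/\ - c <= a, b <= c & H / 2 <= c].
    by rewrite lerNl /c !le_max !lexx !orbT.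
  have c0 : 0 < c by apply: lt_le_trans c3; rewrite divr_gt0.
  have cH : c < H by rewrite !gt_max hb ltrNl ha/=; move: H0; clear; lra.
  have hn := subsequence_near kinc (vanishing_near he (hprof c d c0 cH d0)).
  apply: filterS hn => n hn y yI.
  have [h1 h2 h3 h4] := hn y (sub_itv_cc c1 c2 yI).
  by rewrite sub3 in h3; rewrite sub1 in h4; split.
- move=> w0 [e he hlim].
  have [||zeta0 hzeta0] := @profile_limit _ H K (fun n => rescaled_blow_up u x (e n)) (zeta \o e) w0 H0.
  + move=> y; rewrite in_itv/= => /andP[y1 y2].
    have [h1 h2 h3] : [/\ - H < (y - H) / 2, (y - H) / 2 < (y + H) / 2 & (y + H) / 2 < H].
      by split; move: y1 y2 H0; clear; lra.
    have [g_ [g [_ _ hu _]]] := hlim _ _ h1 h2 h3.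
    apply: (uniform_cvg_point _ hu); apply: itv_ccI; move: y1 y2; clear; lra.
  + move=> y; rewrite in_itv/= => /andP[y1 y2]; apply/cvgrPdist_le => d d0.
    pose c := Num.max `|y| (H / 2).
    have [c1 c2] : `|y| <= c /\ H / 2 <= c by rewrite /c !le_max !lexx !orbT.
    have c0 : 0 < c by apply: lt_le_trans c2; rewrite divr_gt0.
    have cH : c < H by rewrite gt_max ltr_norml y1 y2/=; move: H0; clear; lra.
    apply: filterS (vanishing_near he (hprof c d c0 cH d0)) => n hn.
    have [|_ _ _] := hn y; first by move: c1; rewrite ler_norml in_itv.
    by rewrite sub1 sub0r normrN.
  + exists zeta0 => y yI; rewrite (hzeta0 y yI) /K; ring.
Qed.
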